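(* The simulation preorder $\precsim$ is a precongruence for all program combinators of $\Lambda$ (abstraction, application, and sub-convex weighted sum $\uplus$).
   Context: Work in the untyped lazy lambda calculus $\Lambda$ with formal weighted sums: a distribution of terms $M$ is a (countable) formal sum $\{p_i : t_i\}$ with weights in $[0,1]$ and total weight at most $1$; terms are variables, abstractions $\lambda x.M$ and applications $M\,N$ of distributions. Reduction is call-by-name, lazy, to weak head normal forms (abstractions and open applications $x\,\vec{M}$), lifted linearly to distributions, with $\mathrm{whnf}(M)$ the supremum of normal-form parts of finite reducts. Labelled transitions: $\tau$ for reduction; abstractions have ''apply to a variable $y$'' transitions to $(\lambda x.t)\,y$ and a ''converge'' transition to $\lambda x.x$; an open application $y\,\vec{M}$ with $|\vec{M}|=n$ has ''call $y$ at $(i,n)$'' transitions to $\vec{M}(i)$, $0\le i\le n$, with $\vec{M}(0)=\lambda x.x$. For a relation $R$, its probabilistic lift $\overline{R}$ relates sub-distributions $\sum_i p_i a_i$ and $\sum_j q_j b_j$ when a matching $f_{i,j}$ exists with $f_{i,j}\ne0\Rightarrow a_i R b_j$, $\sum_j f_{i,j}=p_i$, $\sum_i f_{i,j}\le q_j$. Relations are taken on pairs of normal forms that are both distributions of abstractions or both weighted point open applications, extended to all terms via $\mathrm{whnf}$. The simulation functional $F$: $M\,F(R)\,N$ if whenever $M,N$ have weak max transitions (one strong transition followed by full evaluation to $\mathrm{whnf}$) with the same label to $M',N'$, then $M'\,\overline{R}\,N'$. Simulation $\precsim$ is the greatest fixed point of $F$. *)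

(* Defs.v *)
From Stdlib Require Cantor.
From mathcomp Require Import all_boot all_order all_algebra.
From mathcomp Require Import all_classical all_reals all_analysis.

Set Implicit Arguments.
Unset Strict Implicit.
Unset Printing Implicit Defensive.

Import Order.TTheory GRing.Theory Num.Theory.
Local Open Scope classical_set_scope.
Local Open Scope ring_scope.

Record subprob (K : realType) := Subprob {
  prob :> nat -> K;
  prob_ge0 : forall i, 0 <= prob i;
  prob_le1 : (\sum_(0 <= i <oo) (prob i)%:E <= 1)%E }.

(* A countable formal sum {wt i : elt i}, given by an enumeration of its
   summands.  Entries of weight 0 are not part of the sum; this is how finite
   sums, and the empty one, are represented. *)
Record dist (K : realType) (T : Type) := Dist {
  wt : subprob K;
  elt : nat -> T }.

(* De Bruijn indices: variable 0 of the body of an abstraction is bound. *)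
Inductive term (K : realType) : Type :=
| Var of nat
| Lam of dist K (term K)
| App of dist K (term K) & dist K (term K).
Arguments Var {K}.

Notation prog K := (dist K (term K)).

Lemma esum_cantor (K : realType) (a : nat -> nat -> \bar K) :
  (forall i j, (0 <= a i j)%E) ->
  (\sum_(0 <= k <oo) a (Cantor.of_nat k).1 (Cantor.of_nat k).2 =
   \sum_(0 <= i <oo) \sum_(0 <= j <oo) a i j)%E.
Proof.
move=> a0.
rewrite nneseries_esumT//.
rewrite -(@reindex_esum K nat (nat * nat)%type [set: nat]
  [set: nat * nat] Cantor.of_nat (fun ij => a ij.1 ij.2)).
- rewrite nneseries_esumT; last by move=> i; exact: nneseries_ge0.
  under [RHS]eq_esum do rewrite nneseries_esumT//.
  rewrite esum_esum//; congr (esum _ _).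
  by apply/seteqP; split => // -[i j].
- split=> //.
  + by move=> i j _ _; exact: (can_inj Cantor.cancel_to_of).
  + move=> p _; exists (Cantor.to_nat p) => //; exact: Cantor.cancel_of_to.
Qed.

Lemma series_head (K : realType) (f : nat -> \bar K) :
  (forall i, (0 <= f i)%E) -> (forall i, f i.+1 = 0%E) ->
  (\sum_(0 <= i <oo) f i = f 0%N)%E.
Proof.
move=> f0 fS; rewrite nneseries_recl// eseries0 ?adde0// => -[|i]//.
Qed.

Lemma tot_ge0 (K : realType) (p : subprob K) :
  (0 <= \sum_(0 <= i <oo) (p i)%:E)%E.
Proof. by apply: nneseries_ge0 => i _ _; rewrite lee_fin prob_ge0. Qed.

Section Combinators.
Context {K : realType}.

Lemma zero_ge0 (i : nat) : 0 <= 0 :> K. Proof. exact: lexx. Qed.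
Lemma zero_le1 : (\sum_(0 <= i <oo) (0 : K)%:E <= 1)%E.
Proof. by rewrite eseries0//; exact: lee01. Qed.
Definition zerop : subprob K := Subprob zero_ge0 zero_le1.

Definition unit_wt (i : nat) : K := (i == 0%N)%:R.
Lemma unit_ge0 i : 0 <= unit_wt i. Proof. exact: ler0n. Qed.
Lemma unit_le1 : (\sum_(0 <= i <oo) (unit_wt i)%:E <= 1)%E.
Proof.
by rewrite series_head// => i; rewrite lee_fin unit_ge0.
Qed.
Definition unitp : subprob K := Subprob unit_ge0 unit_le1.

Definition restr_wt (p : subprob K) (b : nat -> bool) (i : nat) : K :=
  if b i then p i else 0.
Lemma restr_ge0 p b i : 0 <= restr_wt p b i.
Proof. by rewrite /restr_wt; case: ifP => // _; exact: prob_ge0. Qed.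
Lemma restr_le1 p b : (\sum_(0 <= i <oo) (restr_wt p b i)%:E <= 1)%E.
Proof.
apply: le_trans (prob_le1 p); apply: lee_nneseries => i _.
  by rewrite lee_fin restr_ge0.
by rewrite lee_fin /restr_wt; case: ifP => // _; exact: prob_ge0.
Qed.
Definition restrp p b : subprob K := Subprob (restr_ge0 p b) (restr_le1 p b).

Definition mix_wt (p : subprob K) (q : nat -> subprob K) (k : nat) : K :=
  let: (i, j) := Cantor.of_nat k in p i * q i j.
Lemma mix_ge0 p q k : 0 <= mix_wt p q k.
Proof. by rewrite /mix_wt; case: Cantor.of_nat => i j; rewrite mulr_ge0 ?prob_ge0. Qed.
Lemma mix_le p q :
  (\sum_(0 <= k <oo) (mix_wt p q k)%:E <= \sum_(0 <= i <oo) (p i)%:E)%E.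
Proof.
have pq0 i j : (0 <= (p i * q i j)%:E)%E by rewrite lee_fin mulr_ge0 ?prob_ge0.
have -> : (\sum_(0 <= k <oo) (mix_wt p q k)%:E =
    \sum_(0 <= i <oo) \sum_(0 <= j <oo) (p i * q i j)%:E)%E.
  rewrite -esum_cantor//; apply: eq_eseriesr => k _.
  by rewrite /mix_wt; case: Cantor.of_nat.
apply: lee_nneseries => i _.
  by move=> *; apply: nneseries_ge0 => j _ _; exact: pq0.
under eq_eseriesr do rewrite EFinM.
rewrite nneseriesZl; last by move=> j _; rewrite lee_fin prob_ge0.
rewrite -[leRHS]mule1; apply: lee_pmul => //; rewrite ?lee_fin ?prob_ge0//.
- exact: tot_ge0.
- exact: prob_le1.
Qed.
Lemma mix_le1 p q : (\sum_(0 <= k <oo) (mix_wt p q k)%:E <= 1)%E.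
Proof. exact: le_trans (mix_le p q) (prob_le1 p). Qed.
Definition mixp p q : subprob K := Subprob (mix_ge0 p q) (mix_le1 p q).

Definition dpoint {T} (t : T) : dist K T := Dist unitp (fun=> t).

Definition dmap {T U} (f : T -> U) (M : dist K T) : dist K U :=
  Dist (wt M) (fun i => f (elt M i)).

(* The sub-convex weighted sum of the F i, with weights p i. *)
Definition dsum {T} (p : subprob K) (F : nat -> dist K T) : dist K T :=
  Dist (mixp p (fun i => wt (F i)))
       (fun k => let: (i, j) := Cantor.of_nat k in elt (F i) j).

(* The linear extension of f. *)
Definition dbind {T U} (M : dist K T) (f : T -> dist K U) : dist K U :=
  dsum (wt M) (fun i => f (elt M i)).

Definition dfilter {T} (b : T -> bool) (M : dist K T) : dist K T :=
  Dist (restrp (wt M) (fun i => b (elt M i))) (elt M).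

(* The total weight with which t occurs in M. *)
Definition mass {T} (M : dist K T) (t : T) : \bar K :=
  (\sum_(0 <= i <oo | `[< elt M i = t >]) (wt M i)%:E)%E.

End Combinators.

Section Calculus.
Context {K : realType}.

Definition idterm : prog K := dpoint (Lam (dpoint (Var 0))).

Definition dzero : prog K := Dist zerop (fun=> Var 0).

Definition upren (r : nat -> nat) (x : nat) : nat :=
  if x is x'.+1 then (r x').+1 else 0%N.

Fixpoint rename (r : nat -> nat) (t : term K) : term K :=
  match t with
  | Var x => Var (r x)
  | Lam M => Lam (dmap (rename (upren r)) M)
  | App M N => App (dmap (rename r) M) (dmap (rename r) N)
  end.

Definition up (s : nat -> prog K) (x : nat) : prog K :=
  if x is x'.+1 then dmap (rename S) (s x') else dpoint (Var 0).

(* Variables are replaced by distributions, so the result is a distribution. *)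
Fixpoint subst (s : nat -> prog K) (t : term K) : prog K :=
  match t with
  | Var x => s x
  | Lam M => dpoint (Lam (dsum (wt M) (fun i => subst (up s) (elt M i))))
  | App M N => dpoint (App (dsum (wt M) (fun i => subst s (elt M i)))
                           (dsum (wt N) (fun i => subst s (elt N i))))
  end.

(* M[N/0], the other free variables being shifted down by one. *)
Definition subst0 (M N : prog K) : prog K :=
  dbind M (subst (fun x => if x is x'.+1 then dpoint (Var x') else N)).

Definition is_abs (t : term K) : bool := if t is Lam _ then true else false.

(* open_app t = Some (x, [:: M1; ...; Mn]) when t is x M1 ... Mn.  The function
   part of an application is a distribution; it has to be a point here, that
   is, its first summand has to have weight 1. *)
Fixpoint open_app (t : term K) : option (nat * seq (prog K)) :=
  match t with
  | Var x => Some (x, [::])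
  | Lam _ => None
  | App M N =>
      if wt M 0%N == 1 then
        if open_app (elt M 0%N) is Some (x, Ms) then Some (x, rcons Ms N)
        else None
      else None
  end.

Definition is_open (t : term K) : bool := isSome (open_app t).

Definition is_whnf (t : term K) : bool := is_abs t || is_open t.

(* One step of call-by-name reduction.  Application is linear in its function
   part: (Sum_i p_i t_i) N reduces to Sum_i p_i M_i, where M_i is the one-step
   reduct of t_i N, or t_i N itself if t_i is an open application. *)
Fixpoint reduct (t : term K) : prog K :=
  match t with
  | Var _ | Lam _ => dpoint t
  | App M N =>
      dsum (wt M) (fun i =>
        match elt M i with
        | Lam B => subst0 B N
        | Var x => dpoint (App (dpoint (Var x)) N)
        | App _ _ => dmap (fun s => App (dpoint s) N) (reduct (elt M i))
        end)
  end.

(* Normal forms are kept and the other terms reduce, all in parallel. *)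
Definition step (M : prog K) : prog K :=
  dbind M (fun t => if is_whnf t then dpoint t else reduct t).

Definition nfpart (M : prog K) : prog K := dfilter is_whnf M.

(* The n-th finite reduct of M, with the terms that have reached a normal form
   after fewer than n steps taken out. *)
Fixpoint pending (n : nat) (M : prog K) : prog K :=
  if n is n'.+1 then dbind (dfilter (predC is_whnf) (pending n' M)) reduct
  else M.

Definition whnf_wt (M : prog K) (k : nat) : K :=
  let: (n, i) := Cantor.of_nat k in wt (nfpart (pending n M)) i.

Lemma whnf_ge0 M k : 0 <= whnf_wt M k.
Proof. by rewrite /whnf_wt; case: Cantor.of_nat => n i; exact: prob_ge0. Qed.

Definition total {T} (M : dist K T) : \bar K :=
  (\sum_(0 <= i <oo) (wt M i)%:E)%E.

Lemma total_filter T (b : T -> bool) (M : dist K T) :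
  total M = (total (dfilter b M) + total (dfilter (predC b) M))%E.
Proof.
rewrite /total -nneseriesD; [|by move=> i _; rewrite lee_fin prob_ge0..].
apply: eq_eseriesr => i _; rewrite /= /restr_wt/= -EFinD.
by case: (b _) => /=; rewrite ?addr0 ?add0r.
Qed.

Lemma pending_total (M : prog K) n :
  (\sum_(0 <= k < n) total (nfpart (pending k M)) + total (pending n M) <= 1)%E.
Proof.
elim: n => [|n IH]; first by rewrite big_geq// add0e; exact: prob_le1.
apply: le_trans IH; rewrite big_nat_recr//= -addeA leeD2l//.
rewrite [leRHS](total_filter is_whnf) leeD2l//; exact: mix_le.
Qed.

Lemma whnf_le1 M : (\sum_(0 <= k <oo) (whnf_wt M k)%:E <= 1)%E.
Proof.
have -> : (\sum_(0 <= k <oo) (whnf_wt M k)%:E =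
           \sum_(0 <= n <oo) total (nfpart (pending n M)))%E.
  rewrite /total -esum_cantor; last by move=> i j; rewrite lee_fin prob_ge0.
  by apply: eq_eseriesr => k _; rewrite /whnf_wt; case: Cantor.of_nat.
apply: lime_le.
  by apply: is_cvg_nneseries => n _ _; exact: tot_ge0.
apply: nearW => n; apply: le_trans (pending_total M n).
by rewrite leeDl//; exact: tot_ge0.
Qed.

(* The supremum of the normal-form parts of the finite reducts of M (whnfE
   below), as the sum of what each further step of reduction adds to it. *)
Definition whnf (M : prog K) : prog K :=
  Dist (Subprob (whnf_ge0 M) (whnf_le1 M))
       (fun k => let: (n, i) := Cantor.of_nat k in elt (pending n M) i).

Definition expect {T} (phi : T -> \bar K) (M : dist K T) : \bar K :=
  (\sum_(0 <= i <oo) (wt M i)%:E * phi (elt M i))%E.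

Lemma expect_bind T U (phi : U -> \bar K) (M : dist K T) (f : T -> dist K U) :
  (forall u, (0 <= phi u)%E) ->
  expect phi (dbind M f) = expect (fun t => expect phi (f t)) M.
Proof.
move=> phi0; rewrite /expect /=.
pose F i j := ((wt M i * wt (f (elt M i)) j)%:E * phi (elt (f (elt M i)) j))%E.
transitivity (\sum_(0 <= k <oo) F (Cantor.of_nat k).1 (Cantor.of_nat k).2)%E.
  by apply: eq_eseriesr => k _; rewrite /mix_wt; case: Cantor.of_nat.
rewrite esum_cantor; last first.
  by move=> i j; rewrite mule_ge0// lee_fin mulr_ge0 ?prob_ge0.
apply: eq_eseriesr => i _; rewrite -nneseriesZl; last first.
  by move=> j _; rewrite mule_ge0// lee_fin prob_ge0.
by apply: eq_eseriesr => j _; rewrite /F EFinM muleA.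
Qed.

Lemma expect_ge0 T (phi : T -> \bar K) (M : dist K T) :
  (forall u, (0 <= phi u)%E) -> (0 <= expect phi M)%E.
Proof.
by move=> phi0; apply: nneseries_ge0 => i _ _; rewrite mule_ge0// lee_fin prob_ge0.
Qed.

Lemma expect_filter T (phi : T -> \bar K) (b : T -> bool) (M : dist K T) :
  expect phi (dfilter b M) = expect (fun t => if b t then phi t else 0%E) M.
Proof.
apply: eq_eseriesr => i _ /=; rewrite /restr_wt.
by case: (b _); rewrite ?mul0e ?mule0.
Qed.

Lemma expect_split T (phi : T -> \bar K) (b : T -> bool) (M : dist K T) :
  (forall u, (0 <= phi u)%E) -> expect phi M =
  (expect phi (dfilter b M) + expect phi (dfilter (predC b) M))%E.
Proof.
move=> phi0; rewrite /expect -nneseriesD; last 2 first.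
- by move=> i _; rewrite mule_ge0// lee_fin prob_ge0.
- by move=> i _; rewrite mule_ge0// lee_fin prob_ge0.
apply: eq_eseriesr => i _; rewrite /= /restr_wt/=.
by case: (b _) => /=; rewrite ?mul0e ?adde0 ?add0e.
Qed.

Lemma expect_step (phi : term K -> \bar K) (M : prog K) n :
  (forall u, (0 <= phi u)%E) -> expect phi (iter n step M) =
  (\sum_(0 <= k < n) expect phi (nfpart (pending k M)) +
   expect phi (pending n M))%E.
Proof.
elim: n phi => [|n IH] phi phi0; first by rewrite big_geq// add0e.
rewrite iterS [in LHS]/step expect_bind//.
set psi := (fun t => expect phi _).
have psi0 t : (0 <= psi t)%E by exact: expect_ge0.
have psi_nf t : is_whnf t -> psi t = phi t.
  move=> nft; rewrite /psi nft /expect series_head => [|i|i].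
  - by rewrite /= /unit_wt/= mul1e.
  - by rewrite mule_ge0// lee_fin unit_ge0.
  - by rewrite /= /unit_wt/= mul0e.
have nfE k : expect psi (nfpart (pending k M)) = expect phi (nfpart (pending k M)).
  rewrite !expect_filter; apply: eq_eseriesr => i _.
  by case: ifP => // /psi_nf ->.
rewrite IH// big_nat_recr//= -addeA; congr (_ + _)%E.
  by apply: eq_bigr => k _; exact: nfE.
rewrite (expect_split is_whnf)// -/(nfpart _) nfE; congr (_ + _)%E.
rewrite expect_bind// !expect_filter; apply: eq_eseriesr => i _ /=.
by rewrite /psi; case: ifP => //= /negbTE ->.
Qed.

Lemma massE T (M : dist K T) t :
  mass M t = expect (fun u => if `[< u = t >] then 1%E else 0%E) M.
Proof.
rewrite /mass eseries_mkcond; apply: eq_eseriesr => i _.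
by case: ifP => _; rewrite ?mule1 ?mule0.
Qed.

Lemma whnfE (M : prog K) t : mass (whnf M) t =
  ereal_sup (range (fun n => mass (nfpart (iter n step M)) t)).
Proof.
pose one u : \bar K := if `[< u = t >] then 1%E else 0%E.
have one0 u : (0 <= one u)%E by rewrite /one; case: ifP.
pose a n := mass (nfpart (pending n M)) t.
have a0 n : (0 <= a n)%E by rewrite /a massE; exact: expect_ge0.
have -> : mass (whnf M) t = (\sum_(0 <= n <oo) a n)%E.
  pose F n i := ((wt (nfpart (pending n M)) i)%:E * one (elt (pending n M) i))%E.
  rewrite massE; transitivity
    (\sum_(0 <= k <oo) F (Cantor.of_nat k).1 (Cantor.of_nat k).2)%E.
    by apply: eq_eseriesr => k _; rewrite /= /whnf_wt; case: Cantor.of_nat.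
  rewrite esum_cantor; last first.
    by move=> i j; rewrite mule_ge0// lee_fin prob_ge0.
  by apply: eq_eseriesr => n _; rewrite /a massE.
have E n : mass (nfpart (iter n step M)) t = (\sum_(0 <= k < n.+1) a k)%E.
  rewrite massE expect_filter expect_step; last first.
    by move=> u; case: ifP => // _; exact: one0.
  rewrite big_nat_recr//=; congr (_ + _)%E; last first.
    by rewrite /a massE expect_filter.
  apply: eq_bigr => k _; rewrite /a massE !expect_filter.
  by apply: eq_eseriesr => i _; case: (is_whnf _).
apply/eqP; rewrite eq_le; apply/andP; split.
  apply: lime_le; first by apply: is_cvg_nneseries => n _ _; exact: a0.
  apply: nearW => n; apply: (@le_trans _ _ (\sum_(0 <= k < n.+1) a k)%E).
    by rewrite big_nat_recr//= leeDl.
  by apply: ereal_sup_ubound; exists n.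
apply: ge_ereal_sup => _ [n _ <-]; rewrite E.
exact: nneseries_lim_ge.
Qed.

Lemma whnf_nf (M : prog K) k : wt (whnf M) k != 0 -> is_whnf (elt (whnf M) k).
Proof.
rewrite /= /whnf_wt; case: Cantor.of_nat => n i /=.
by rewrite /restr_wt; case: ifP => //; rewrite eqxx.
Qed.

End Calculus.

Inductive label := Tau | Apply of nat | Converge | Call of nat & nat & nat.

Section Simulation.
Context {K : realType}.

Definition trans (l : label) (t : term K) : option (prog K) :=
  match l with
  | Tau => if is_whnf t then None else Some (reduct t)
  | Apply y =>
      if is_abs t then Some (dpoint (App (dpoint t) (dpoint (Var y)))) else None
  | Converge => if is_abs t then Some idterm else None
  | Call y i n =>
      if open_app t is Some (x, Ms) then
        if [&& x == y, size Ms == n & (i <= n)%N]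
        then Some (nth idterm (idterm :: Ms) i) else None
      else None
  end.

(* Every distribution has exactly one strong max transition for each label:
   its terms that have an l-transition all take it, and the others contribute
   nothing to the target. *)
Definition strong_max (l : label) (M : prog K) : prog K :=
  dbind M (fun t => odflt dzero (trans l t)).

Definition weak_max (l : label) (M : prog K) : prog K := whnf (strong_max l M).

(* The lift of S, relating Sum_i p_i a_i to Sum_j q_j b_j. *)
Definition lift {T} (S : T -> T -> Prop) (p : nat -> K) (a : nat -> T)
    (q : nat -> K) (b : nat -> T) : Prop :=
  exists f : nat -> nat -> K,
    [/\ forall i j, 0 <= f i j,
        forall i j, f i j != 0 -> S (a i) (b j),
        forall i, (\sum_(0 <= j <oo) (f i j)%:E = (p i)%:E)%E
      & forall j, (\sum_(0 <= i <oo) (f i j)%:E <= (q j)%:E)%E].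

Definition abs_dist (M : prog K) : Prop :=
  forall i, wt M i != 0 -> is_abs (elt M i).

(* The weight of a point open application is its coefficient in the sum to
   which lift is applied (coef below). *)
Definition open_point (M : prog K) : Prop :=
  exists2 t, is_open t & M = dpoint t.

Definition nf_pair (M N : prog K) : Prop :=
  (abs_dist M /\ abs_dist N) \/ (open_point M /\ open_point N).

(* A distribution M of normal forms is the sum of its abstractions, taken
   together as one distribution A, and of its open applications t_i, taken one
   by one: M = 1 A + Sum_i (wt M i) t_i.  Abstractions of different summands
   are not told apart, since application is linear in its function part; the
   weight of A is compared by Converge. *)
Definition coef (M : prog K) (k : nat) : K :=
  if k is i.+1 then (if is_open (elt M i) then wt M i else 0) else 1.

Definition part (M : prog K) (k : nat) : prog K :=
  if k is i.+1 then dpoint (elt M i) else dfilter is_abs M.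

Definition lift_nf (S : prog K -> prog K -> Prop) (M N : prog K) : Prop :=
  lift S (coef M) (part M) (coef N) (part N).

Definition simF (S : prog K -> prog K -> Prop) (M N : prog K) : Prop :=
  nf_pair M N /\ forall l, lift_nf S (weak_max l M) (weak_max l N).

(* The greatest fixed point of simF, as the union of its post-fixed points. *)
Definition sim_nf (M N : prog K) : Prop :=
  exists2 S : prog K -> prog K -> Prop,
    (forall M N, S M N -> simF S M N) & S M N.

Definition sim (M N : prog K) : Prop := lift_nf sim_nf (whnf M) (whnf N).

Lemma simF_mono (S T : prog K -> prog K -> Prop) :
  (forall M N, S M N -> T M N) -> forall M N, simF S M N -> simF T M N.
Proof.
move=> ST M N [MN SMN]; split=> // l; have [f [f0 fS fp fq]] := SMN l.
by exists f; split=> // i j /fS /ST.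
Qed.

Lemma sim_nf_fix M N : sim_nf M N <-> simF sim_nf M N.
Proof.
have sub P Q : sim_nf P Q -> simF sim_nf P Q.
  move=> [S SF SPQ]; apply: simF_mono (SF _ _ SPQ) => P' Q' S'.
  by exists S.
split; first exact: sub.
by exists (simF sim_nf) => // P Q; exact: simF_mono.
Qed.

Definition lam (M : prog K) : prog K := dpoint (Lam M).
Definition app (M N : prog K) : prog K := dpoint (App M N).

End Simulation.

(* Main.v *)
From Pilot Require Import Defs.
From mathcomp Require Import all_boot all_order all_algebra.
From mathcomp Require Import all_classical all_reals all_analysis.
From mathcomp Require Import ring.
(* MathComp has another [total] and another [lift]. *)
Import Pilot.Defs.

(* Simulation is compared with the closure [crel] of an arbitrary relation [base]
   under substitution, application, abstraction and sums.  If related programs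
   of [base] evaluate to normal forms with related components ([progress]), then
   so do all programs related by [crel] ([crel_progress]), and [crel] is contained
   in simulation.  Evaluation is computed by a Krivine machine, whose observations
   depend linearly on the body of an abstraction, since simulation does not tell
   the abstractions of a sum apart.  By induction on [crel], one round of
   evaluation of a related pair produces related normal forms and a residual
   related pair, with one beta step less to do on the left ([round_spec]); rounds
   are iterated for ever and their couplings added up.

   Taking simulation itself for [base] needs that open programs are similar when
   all their instances by variables are.  As a program may contain all variables,
   none is fresh; [rsim] therefore considers sequences of renamings that separate
   variables in the limit, and extracts a limit of the matchings along a free
   ultrafilter. *)

Set Implicit Arguments.
Unset Strict Implicit.
Unset Printing Implicit Defensive.

Import Order.TTheory GRing.Theory Num.Theory.
Local Open Scope classical_set_scope.
Local Open Scope ring_scope.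

(** A matching has exact row sums but only bounded column sums. So what is said of the left program
    needs bounds in both directions, of the right one only a lower bound. Lower bounds telescope
    over the rounds with unlimited fuel. The upper bound is proved for finite fuel n: each round
    costs one unit ([delay]), so n + 1 rounds account for all that fuel n can reach, and the
    supremum over n is taken afterwards.

    Values of nonnegative tests in [\bar K] replace any comparison of enumerations: programs equal
    up to enumeration have the same values, and a program may be exchanged for another that
    evaluates alike. Total weights are tracked separately, since the data of countably many rounds
    must still add up to a sub-probability.

    Transitions apply an abstraction to variables only, whereas the closure puts arbitrary programs
    for the bound variable. Bodies must therefore be related as open programs, which is why [rsim]
    serves as [base]: under a binder, the bound variable is instantiated by one that is eventually
    distinct from the image of each free variable. *)

Section Dist.
Context {K : realType}.
Implicit Types T U : Type.

Lemma expect_eq T (phi psi : T -> \bar K) (M : dist K T) :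
  (forall i, wt M i != 0 -> phi (elt M i) = psi (elt M i)) ->
  expect phi M = expect psi M.
Proof.
move=> e; apply: eq_eseriesr => i _.
by have [->|/e ->//] := eqVneq (wt M i) (0 : K); rewrite !mul0e.
Qed.

Lemma expect_le T (phi psi : T -> \bar K) (M : dist K T) :
  (forall t, 0 <= phi t)%E ->
  (forall i, wt M i != 0 -> (phi (elt M i) <= psi (elt M i))%E) ->
  (expect phi M <= expect psi M)%E.
Proof.
move=> p0 e; apply: lee_nneseries => i _; first by rewrite mule_ge0// lee_fin prob_ge0.
have [->|/e pe] := eqVneq (wt M i) (0 : K); first by rewrite !mul0e.
by rewrite lee_wpmul2l// lee_fin prob_ge0.
Qed.

Lemma expectD T (phi psi : T -> \bar K) (M : dist K T) :
  (forall t, 0 <= phi t)%E -> (forall t, 0 <= psi t)%E ->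
  expect (fun t => phi t + psi t)%E M = (expect phi M + expect psi M)%E.
Proof.
move=> p0 q0; rewrite /expect -nneseriesD.
- by apply: eq_eseriesr => i _; rewrite ge0_muleDr.
- by move=> i _; rewrite mule_ge0// lee_fin prob_ge0.
- by move=> i _; rewrite mule_ge0// lee_fin prob_ge0.
Qed.

(** The factor may be infinite: then either all terms vanish, or one positive term makes both sides
    [+oo]. *)
Lemma nneseriesZ (c : \bar K) (f : nat -> \bar K) :
  (0 <= c)%E -> (forall i, 0 <= f i)%E ->
  (\sum_(0 <= i <oo) (c * f i) = c * \sum_(0 <= i <oo) f i)%E.
Proof.
move=> c0 f0; case: c c0 => [r|_|//]; first by move=> _; rewrite nneseriesZl.
have [[i fi]|nf] := pselect (exists i, f i != 0%E); last first.
  have {}nf i : f i = 0%E by apply/eqP; apply: contra_notT nf => ?; exists i.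
  by rewrite !eseries0 ?mule0// => i _ _; rewrite nf ?mule0.
have {}fi : (0 < f i)%E by rewrite lt_def fi f0.
rewrite gt0_mulye; last first.
  rewrite (lt_le_trans fi)// (@nneseriesD1 _ f i)// leeDl//.
  by apply: nneseries_ge0.
rewrite (@nneseriesD1 _ _ i)//; last by move=> k _; rewrite mule_ge0.
rewrite gt0_mulye// addye// gt_eqF// (@lt_le_trans _ _ 0%E) ?ltNye//.
by apply: nneseries_ge0 => *; rewrite mule_ge0.
Qed.

Lemma expectZ T (c : \bar K) (phi : T -> \bar K) (M : dist K T) :
  (0 <= c)%E -> (forall t, 0 <= phi t)%E ->
  expect (fun t => c * phi t)%E M = (c * expect phi M)%E.
Proof.
move=> c0 p0; rewrite /expect -nneseriesZ//.
  by apply: eq_eseriesr => i _; rewrite muleCA.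
by move=> i; rewrite mule_ge0// lee_fin prob_ge0.
Qed.

Lemma expect0 T (M : dist K T) : expect (fun=> 0%E) M = 0%E.
Proof. by apply: eseries0 => i _ _; rewrite mule0. Qed.

Lemma nneseries_swap (f : nat -> nat -> \bar K) : (forall i j, 0 <= f i j)%E ->
  (\sum_(0 <= i <oo) \sum_(0 <= j <oo) f i j =
   \sum_(0 <= j <oo) \sum_(0 <= i <oo) f i j)%E.
Proof. by move=> f0; apply: nneseries_interchange. Qed.

Lemma expect_series T (h : nat -> T -> \bar K) (M : dist K T) :
  (forall k t, 0 <= h k t)%E ->
  expect (fun t => \sum_(0 <= k <oo) h k t)%E M =
  (\sum_(0 <= k <oo) expect (h k) M)%E.
Proof.
move=> h0; rewrite /expect nneseries_swap; last first.
  by move=> i j; rewrite mule_ge0// lee_fin prob_ge0.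
apply: eq_eseriesr => i _; rewrite nneseriesZ// lee_fin; exact: prob_ge0.
Qed.

Lemma expect_dpoint T (phi : T -> \bar K) t : (forall t, 0 <= phi t)%E ->
  expect phi (dpoint t) = phi t.
Proof.
move=> p0; rewrite /expect series_head/= /unit_wt ?mul1e// => i.
  by rewrite mule_ge0// lee_fin ler0n.
by rewrite mul0e.
Qed.

Lemma expect_dmap T U (f : T -> U) phi (M : dist K T) :
  expect phi (dmap f M) = expect (phi \o f) M.
Proof. by []. Qed.

Lemma expect_dsum T (phi : T -> \bar K) p (F : nat -> dist K T) :
  (forall t, 0 <= phi t)%E ->
  expect phi (dsum p F) = (\sum_(0 <= i <oo) (p i)%:E * expect phi (F i))%E.
Proof. by move=> p0; exact: (expect_bind (Dist p id) F p0). Qed.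

Lemma expect_dzero (phi : term K -> \bar K) : expect phi dzero = 0%E.
Proof. by apply: eseries0 => i _ _ /=; rewrite mul0e. Qed.

Lemma totalE T (M : dist K T) : total M = expect (fun=> 1%E) M.
Proof. by apply: eq_eseriesr => i _; rewrite mule1. Qed.

Lemma total_ge0 T (M : dist K T) : (0 <= total M)%E.
Proof. exact: tot_ge0. Qed.

Lemma total_le1 T (M : dist K T) : (total M <= 1)%E.
Proof. exact: prob_le1. Qed.

Lemma expect_le_total T (phi : T -> \bar K) (M : dist K T) :
  (forall t, 0 <= phi t <= 1)%E -> (expect phi M <= total M)%E.
Proof.
by move=> p; rewrite totalE; apply: expect_le => [t|i _]; [case/andP: (p t)|case/andP: (p (elt M i))].
Qed.

(** Monotone convergence in the form of a bound: finite partial sums commute with increasing limits,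
    and each of them stays below [c]. *)
Lemma nneseries_le_sup (f : nat -> nat -> \bar K) (c : \bar K) :
  (forall n i, 0 <= f n i)%E -> (forall i, {homo f^~ i : n m / (n <= m)%N >-> (n <= m)%E}) ->
  (forall n, \sum_(0 <= i <oo) f n i <= c)%E ->
  (\sum_(0 <= i <oo) ereal_sup (range (f^~ i)) <= c)%E.
Proof.
move=> f0 fm fc.
have s0 i : (0 <= ereal_sup (range (f^~ i)))%E.
  by apply: le_trans (f0 0%N i) _; apply: ereal_sup_ubound; exists 0%N.
apply: lime_le; first by apply: is_cvg_nneseries.
apply: nearW => N.
have cv : ((fun n => \sum_(0 <= i < N) f n i)%E @ \oo -->
           (\sum_(0 <= i < N) ereal_sup (range (f^~ i)))%E).
  apply: cvg_nnesum => [i _|i _]; first exact: nearW.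
  by apply: ereal_nondecreasing_cvgn; exact: fm.
rewrite -(cvg_lim _ cv)//; apply: lime_le; first by apply/cvg_ex; eexists; exact: cv.
apply: nearW => n; apply: le_trans (fc n).
by apply: nneseries_lim_ge => *; exact: f0.
Qed.

Lemma expect_sup T (h : nat -> T -> \bar K) (M : dist K T) (c : \bar K) :
  (forall n t, 0 <= h n t)%E -> (forall t, {homo h^~ t : n m / (n <= m)%N >-> (n <= m)%E}) ->
  (forall n, expect (h n) M <= c)%E ->
  (expect (fun t => ereal_sup (range (h^~ t))) M <= c)%E.
Proof.
move=> h0 hm hc; rewrite /expect.
rewrite (@eq_eseriesr _ _ (fun i => ereal_sup (range (fun n => (wt M i)%:E * h n (elt M i)))%E)).
  apply: nneseries_le_sup => //.
  - by move=> n i; rewrite mule_ge0// lee_fin prob_ge0.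
  - by move=> i n m nm; rewrite lee_wpmul2l ?lee_fin ?prob_ge0//; exact: hm.
move=> i _; rewrite -ereal_supZl ?prob_ge0//; last by apply/set0P; exists (h 0%N (elt M i)); exists 0%N.
congr ereal_sup; apply/seteqP; split => [_ [_ [n _ <-] <-]|_ [n _ <-]]; first by exists n.
by exists (h n (elt M i)) => //; exists n.
Qed.

(** [dsum] takes weights that form a sub-probability. Here only the resulting total weight is
    bounded, so that two programs, or the results of infinitely many rounds, can be added with
    weight 1 each. *)
Lemma wsum_ex T (t0 : T) (p : nat -> K) (F : nat -> dist K T) :
  (forall k, 0 <= p k) -> (\sum_(0 <= k <oo) (p k)%:E * total (F k) <= 1)%E ->
  exists M : dist K T, forall phi, (forall t, 0 <= phi t)%E ->
    expect phi M = (\sum_(0 <= k <oo) (p k)%:E * expect phi (F k))%E.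
Proof.
move=> p0 pF.
pose w k : K := let: (i, j) := Cantor.of_nat k in p i * wt (F i) j.
have w0 k : 0 <= w k by rewrite /w; case: Cantor.of_nat => i j; rewrite mulr_ge0// prob_ge0.
have wE (phi : T -> \bar K) : (forall t, 0 <= phi t)%E ->
   (\sum_(0 <= k <oo) (w k)%:E * phi (let: (i, j) := Cantor.of_nat k in elt (F i) j) =
    \sum_(0 <= k <oo) (p k)%:E * expect phi (F k))%E.
  move=> phi0; pose a i j := ((p i * wt (F i) j)%:E * phi (elt (F i) j))%E.
  transitivity (\sum_(0 <= k <oo) a (Cantor.of_nat k).1 (Cantor.of_nat k).2)%E.
    by apply: eq_eseriesr => k _; rewrite /w; case: Cantor.of_nat.
  rewrite esum_cantor; last first.
    by move=> i j; rewrite mule_ge0// lee_fin mulr_ge0 ?prob_ge0.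
  apply: eq_eseriesr => i _; rewrite -nneseriesZ//.
  - by apply: eq_eseriesr => j _; rewrite /a EFinM muleA.
  - by rewrite lee_fin.
  - by move=> j; rewrite mule_ge0// lee_fin prob_ge0.
have w1 : (\sum_(0 <= k <oo) (w k)%:E <= 1)%E.
  apply: le_trans pF; under eq_eseriesr do rewrite -[(w _)%:E]mule1.
  rewrite (wE (fun=> 1%E))//; apply: lee_nneseries => i _.
    by rewrite mule_ge0 ?lee_fin// -totalE total_ge0.
  by rewrite totalE.
by exists (Dist (Subprob w0 w1) (fun k => let: (i, j) := Cantor.of_nat k in elt (F i) j)).
Qed.

End Dist.

(** * Renaming and substitution; renaming keeps every enumeration, so its equations are genuine
    equalities *)

Section Syntax.
Context {K : realType}.
Implicit Types (t u : term K) (M N : prog K).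

(** [term] is nested in [dist]: hypotheses on the summands come from opening the record and calling
    the fixpoint on the values of its enumeration. *)
Lemma term_elim (P : term K -> Prop) :
  (forall x, P (Var x)) ->
  (forall M, (forall i, P (elt M i)) -> P (Lam M)) ->
  (forall M N, (forall i, P (elt M i)) -> (forall i, P (elt N i)) -> P (App M N)) ->
  forall t, P t.
Proof.
move=> PV PL PA; fix IH 1 => -[x|[w e]|[w e] [w' e']].
- exact: PV.
- by apply: PL => i; exact: IH.
- by apply: PA => i; exact: IH.
Qed.

Definition msub (s : nat -> prog K) M : prog K := dbind M (subst s).

Lemma dmap_ext T U (f g : T -> U) (M : dist K T) :
  (forall i, f (elt M i) = g (elt M i)) -> dmap f M = dmap g M.
Proof. by move=> e; rewrite /dmap; congr Dist; apply: funext. Qed.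

Lemma dmap_dmap T U V (f : T -> U) (g : V -> T) (M : dist K V) :
  dmap f (dmap g M) = dmap (f \o g) M.
Proof. by []. Qed.

Lemma dmap_id T (M : dist K T) : dmap id M = M.
Proof. by case: M. Qed.

Lemma dmap_dsum T U (f : T -> U) p (F : nat -> dist K T) :
  dmap f (dsum p F) = dsum p (fun i => dmap f (F i)).
Proof.
by rewrite /dmap/dsum /=; congr Dist; apply: funext => k; case: Cantor.of_nat.
Qed.

Lemma dsum_ext T p (F G : nat -> dist K T) :
  (forall i, F i = G i) -> dsum p F = dsum p G.
Proof. by move=> e; congr dsum; apply: funext. Qed.

Lemma subprob_eq (p q : subprob K) : prob p = prob q -> p = q.
Proof.
by case: p q => p p0 p1 [q q0 q1] /= e; subst q; rewrite (Prop_irrelevance p0 q0) (Prop_irrelevance p1 q1).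
Qed.

Lemma dist_eq T (M N : dist K T) : prob (wt M) = prob (wt N) -> elt M = elt N -> M = N.
Proof. by case: M N => w e [w' e'] /= /subprob_eq -> ->. Qed.

Lemma upren_id : upren id = id.
Proof. by apply: funext => -[]. Qed.

Lemma upren_comp r r' : upren (r \o r') = upren r \o upren r'.
Proof. by apply: funext => -[]. Qed.

Lemma rename_id t : rename id t = t.
Proof.
elim/term_elim: t => [x|M IH|M N IH1 IH2] //=.
  by rewrite upren_id; congr Lam; rewrite -[RHS]dmap_id; apply: dmap_ext.
by congr App; rewrite -[RHS]dmap_id; apply: dmap_ext.
Qed.

Lemma rename_comp r r' t : rename r (rename r' t) = rename (r \o r') t.
Proof.
elim/term_elim: t r r' => [x|M IH|M N IH1 IH2] r r' //=.
  by rewrite upren_comp dmap_dmap; congr Lam; apply: dmap_ext => i; exact: IH.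
by rewrite !dmap_dmap; congr App; apply: dmap_ext => i; [exact: IH1|exact: IH2].
Qed.

Lemma subst_rename s r t : subst s (rename r t) = subst (s \o r) t.
Proof.
elim/term_elim: t s r => [x|M IH|M N IH1 IH2] s r //=.
  congr (dpoint (Lam _)); apply: dsum_ext => i; rewrite IH; congr subst.
  by apply: funext => -[].
by congr (dpoint (App _ _)); apply: dsum_ext => i.
Qed.

Lemma msub_rename s r M : msub s (dmap (rename r) M) = msub (s \o r) M.
Proof. by apply: dsum_ext => i /=; rewrite subst_rename. Qed.

Lemma up_rename r (s : nat -> prog K) :
  up (fun x => dmap (rename r) (s x)) = (fun x => dmap (rename (upren r)) (up s x)).
Proof.
apply: funext => -[|x] //=.
by rewrite /dmap/=; congr Dist; apply: funext => i; rewrite !rename_comp.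
Qed.

Lemma rename_subst r s t :
  dmap (rename r) (subst s t) = subst (fun x => dmap (rename r) (s x)) t.
Proof.
elim/term_elim: t s r => [x|M IH|M N IH1 IH2] s r //=.
  congr (dpoint (Lam _)); rewrite dmap_dsum; apply: dsum_ext => i.
  by rewrite IH up_rename.
by congr (dpoint (App _ _)); rewrite dmap_dsum; apply: dsum_ext => i.
Qed.

Lemma rename_msub r s M :
  dmap (rename r) (msub s M) = msub (fun x => dmap (rename r) (s x)) M.
Proof. by rewrite /msub/dbind dmap_dsum; apply: dsum_ext => i; exact: rename_subst. Qed.

Definition scons N (s : nat -> prog K) (x : nat) : prog K := if x is x'.+1 then s x' else N.

Definition vars (x : nat) : prog K := dpoint (Var x).

Lemma subst0E M N : subst0 M N = msub (scons N vars) M.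
Proof. by []. Qed.

Lemma rename_subst0 r M N :
  dmap (rename r) (subst0 M N) = subst0 (dmap (rename (upren r)) M) (dmap (rename r) N).
Proof.
rewrite !subst0E rename_msub msub_rename; congr msub.
by apply: funext => -[].
Qed.

Lemma open_app_rename r t : open_app (rename r t) =
  omap (fun p => (r p.1, [seq dmap (rename r) N | N <- p.2])) (open_app t).
Proof.
elim/term_elim: t r => [x|M IH|M N IH1 IH2] r //=.
case: ifP => // _; rewrite IH1; case: (open_app (elt M 0)) => [[x Ms]|] //=.
by rewrite map_rcons.
Qed.

Lemma is_open_rename r t : is_open (rename r t) = is_open t.
Proof. by rewrite /is_open open_app_rename; case: open_app. Qed.

Lemma is_abs_rename r t : is_abs (rename r t) = is_abs t.
Proof. by case: t. Qed.

Lemma is_whnf_rename r t : is_whnf (rename r t) = is_whnf t.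
Proof. by rewrite /is_whnf is_open_rename is_abs_rename. Qed.

Lemma reduct_rename r t : reduct (rename r t) = dmap (rename r) (reduct t).
Proof.
elim/term_elim: t r => [x|M IH|M N IH1 IH2] r //=.
rewrite dmap_dsum; apply: dsum_ext => i /=; have := IH1 i r.
case: (elt M i) => [x|B|M' N'] IHi; [by []|by rewrite rename_subst0|].
change (dmap (fun s => App (dpoint s) (dmap (rename r) N)) (reduct (rename r (App M' N'))) =
  dmap (rename r) (dmap (fun s => App (dpoint s) N) (reduct (App M' N')))).
by rewrite IHi.
Qed.

Lemma dfilter_rename (b : term K -> bool) r M : (forall t, b (rename r t) = b t) ->
  dfilter b (dmap (rename r) M) = dmap (rename r) (dfilter b M).
Proof.
move=> e; rewrite /dfilter/dmap/=; congr Dist; apply: subprob_eq.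
by apply: funext => i; rewrite /= /restr_wt e.
Qed.

Lemma pending_rename r n M : pending n (dmap (rename r) M) = dmap (rename r) (pending n M).
Proof.
elim: n => [|n IH] //=; rewrite IH dfilter_rename; last first.
  by move=> t /=; rewrite is_whnf_rename.
rewrite /dbind dmap_dsum; apply: dsum_ext => i; exact: reduct_rename.
Qed.

(** Renaming changes neither weights nor order of the summands at any stage of reduction.
    Consequently the normal forms of all renamings of a program share one index set, which later
    gives a meaning to a limit of matchings. *)
Lemma whnf_rename r M : whnf (dmap (rename r) M) = dmap (rename r) (whnf M).
Proof.
apply: dist_eq; apply: funext => k /=.
  rewrite /whnf_wt; case: Cantor.of_nat => n i; rewrite /nfpart pending_rename dfilter_rename//.
  exact: is_whnf_rename.
by case: Cantor.of_nat => n i; rewrite pending_rename.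
Qed.

End Syntax.

(* Substitution only satisfies its usual equations up to the enumeration of the
   sums at every depth.  [nrm] picks a representative at each level, so that
   [cn M = cn N] is equality of programs up to re-enumeration. *)
Section Normalise.
Context {K : realType}.

Definition ext_eq T (M N : dist K T) : Prop :=
  forall phi, (forall t, 0 <= phi t)%E -> expect phi M = expect phi N.

Lemma canon_subproof : {c : forall T, dist K T -> dist K T |
  (forall T (M : dist K T), ext_eq (c T M) M) /\
  (forall T (M N : dist K T), ext_eq M N -> c T M = c T N)}.
Proof.
have r T (M : dist K T) : exists N, ext_eq N M by exists M.
exists (fun T M => sval (cid (r T M))); split=> [T M|T M N MN]; first by case: cid.
move: (r T M) (r T N).
(* The representative is chosen from the predicate [ext_eq P M] alone; equivalent programs have
   equal predicates, and the proofs of existence are irrelevant, so the choices agree. *)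
have -> : (fun P => ext_eq P M) = (fun P => ext_eq P N).
  apply: funext => P; apply: propext.
  by split=> PM phi phi0; rewrite PM// MN.
by move=> e e'; rewrite (Prop_irrelevance e e').
Qed.

Definition canon T : dist K T -> dist K T := sval canon_subproof T.

Lemma expect_canon T (M : dist K T) phi : (forall t, 0 <= phi t)%E ->
  expect phi (canon M) = expect phi M.
Proof. by rewrite /canon; case: canon_subproof => c [/= h _] p0; rewrite h. Qed.

Lemma canon_eq T (M N : dist K T) : ext_eq M N -> canon M = canon N.
Proof. by rewrite /canon; case: canon_subproof => c [/= _ h]; exact: h. Qed.

Fixpoint nrm (t : term K) : term K :=
  match t with
  | Var x => Var x
  | Lam M => Lam (canon (dmap nrm M))
  | App M N => App (canon (dmap nrm M)) (canon (dmap nrm N))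
  end.

Definition cn (M : prog K) : prog K := canon (dmap nrm M).

Lemma expect_cn phi M : (forall t, 0 <= phi t)%E ->
  expect phi (cn M) = expect (phi \o nrm) M.
Proof. by move=> p0; rewrite expect_canon. Qed.

Lemma cnP M N : cn M = cn N <->
  (forall phi, (forall t, 0 <= phi t)%E -> expect (phi \o nrm) M = expect (phi \o nrm) N).
Proof.
split=> [e phi p0|e]; first by rewrite -(expect_cn M p0) e expect_cn.
by apply: canon_eq => phi p0; rewrite !expect_dmap e.
Qed.

Lemma nrmK t : nrm (nrm t) = nrm t.
Proof.
have cnK M : (forall i, nrm (nrm (elt M i)) = nrm (elt M i)) -> cn (cn M) = cn M.
  move=> e; apply/cnP => phi p0; rewrite expect_cn; last by move=> ?; exact: p0.
  by apply: expect_eq => i _ /=; rewrite e.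
move: t; apply: term_elim => [x|M IH|M N IH1 IH2] //=; first by congr Lam; exact: cnK.
by congr App; exact: cnK.
Qed.

Lemma cnK M : cn (cn M) = cn M.
Proof.
apply/cnP => phi p0; rewrite expect_cn; last by move=> ?; exact: p0.
by apply: expect_eq => i _ /=; rewrite nrmK.
Qed.

Lemma cn_dpoint t t' : nrm t = nrm t' -> cn (dpoint t) = cn (dpoint t').
Proof. by move=> e; apply/cnP => phi p0; rewrite !expect_dpoint//= ?e// => ?; exact: p0. Qed.

Lemma cn_ext M N : ext_eq M N -> cn M = cn N.
Proof. by move=> e; apply/cnP => phi p0; rewrite e// => ?; exact: p0. Qed.

Lemma expect_cn_eq (h h' : term K -> \bar K) M N :
  (forall t, 0 <= h t)%E -> (forall t, 0 <= h' t)%E ->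
  (forall t, h t = h' (nrm t)) -> (forall t, h' t = h' (nrm t)) ->
  cn M = cn N -> expect h M = expect h' N.
Proof.
move=> h0 h0' e e' /cnP/(_ h' h0').
rewrite (@expect_eq _ _ (h' \o nrm) h); last by move=> i _ /=; rewrite e.
by move=> ->; apply: expect_eq => i _ /=; rewrite -e'.
Qed.

Lemma rename_nrm r t : nrm (rename r (nrm t)) = nrm (rename r t).
Proof.
have aux f M : (forall i, nrm (f (nrm (elt M i))) = nrm (f (elt M i))) ->
    cn (dmap f (cn M)) = cn (dmap f M).
  move=> e; apply/cnP => phi p0; rewrite !expect_dmap expect_cn; last by move=> ?; exact: p0.
  by apply: expect_eq => i _ /=; rewrite e.
move: t r; apply: term_elim => [x|M IH|M N IH1 IH2] r //=; first by congr Lam; apply: aux.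
by congr App; apply: aux.
Qed.

Lemma cn_rename r M N : cn M = cn N -> cn (dmap (rename r) M) = cn (dmap (rename r) N).
Proof.
move=> e; apply/cnP => phi p0; rewrite !expect_dmap.
by apply: expect_cn_eq e => t /=; rewrite ?p0 ?rename_nrm.
Qed.

Lemma cn_up (s s' : nat -> prog K) : (forall x, cn (s x) = cn (s' x)) ->
  forall x, cn (up s x) = cn (up s' x).
Proof. by move=> e [|x] //=; exact: cn_rename. Qed.

Lemma cn_bind (f g : term K -> prog K) M N :
  (forall t, cn (f t) = cn (g (nrm t))) -> (forall t, cn (g t) = cn (g (nrm t))) ->
  cn M = cn N -> cn (dbind M f) = cn (dbind N g).
Proof.
move=> e e' MN; apply/cnP => phi p0.
have p0' t : (0 <= (phi \o nrm) t)%E by exact: p0.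
rewrite (expect_bind _ _ p0') [RHS](expect_bind _ _ p0'); apply: expect_cn_eq MN => t.
- exact: expect_ge0.
- exact: expect_ge0.
- by have /cnP := e t; exact.
- by have /cnP := e' t; exact.
Qed.

(** Two terms with the same normalisation offer no common structure for an induction. Comparing [t]
    with [nrm t], while the substitution changes as well, does; congruence in both arguments
    follows. *)
Lemma subst_nrm s s' t : (forall x, cn (s x) = cn (s' x)) ->
  cn (subst s t) = cn (subst s' (nrm t)).
Proof.
have aux (f g : term K -> prog K) M :
    (forall i, cn (f (elt M i)) = cn (g (nrm (elt M i)))) ->
    cn (dbind M f) = cn (dbind (cn M) g).
  move=> e; apply/cnP => phi p0.
  have p0' u : (0 <= (phi \o nrm) u)%E by exact: p0.
  rewrite (expect_bind _ _ p0') [RHS](expect_bind _ _ p0') expect_cn; last by move=> u; exact: expect_ge0.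
  by apply: expect_eq => i _; have /cnP := e i; exact.
move: t s s'; apply: term_elim => [x|M IH|M N IH1 IH2] s s' e //=.
  apply: cn_dpoint; congr Lam; apply: (aux (subst (up s)) (subst (up s'))) => i.
  by apply: IH; exact: cn_up.
apply: cn_dpoint; congr App.
  by apply: (aux (subst s) (subst s')) => i; exact: IH1.
by apply: (aux (subst s) (subst s')) => i; exact: IH2.
Qed.

Lemma subst_nrmr s t : cn (subst s (nrm t)) = cn (subst s t).
Proof. by rewrite -(@subst_nrm s s). Qed.

Lemma subst_cong s s' t t' : (forall x, cn (s x) = cn (s' x)) -> nrm t = nrm t' ->
  cn (subst s t) = cn (subst s' t').
Proof.
by move=> e n; rewrite (subst_nrm _ e) n -(subst_nrm t' (fun x => erefl (cn (s' x)))).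
Qed.

Lemma msub_cong s s' M M' : (forall x, cn (s x) = cn (s' x)) -> cn M = cn M' ->
  cn (msub s M) = cn (msub s' M').
Proof.
by move=> e; apply: cn_bind => t; apply: subst_cong => //; rewrite nrmK.
Qed.

Lemma cn_dbind_eq (f g : term K -> prog K) M :
  (forall i, cn (f (elt M i)) = cn (g (elt M i))) -> cn (dbind M f) = cn (dbind M g).
Proof.
move=> e; apply/cnP => phi p0.
have p0' u : (0 <= (phi \o nrm) u)%E by exact: p0.
by rewrite (expect_bind _ _ p0') [RHS](expect_bind _ _ p0'); apply: expect_eq => i _; have /cnP := e i; exact.
Qed.

Lemma dbind_dpoint T U (f : T -> dist K U) t : ext_eq (dbind (dpoint t) f) (f t).
Proof.
move=> phi p0; rewrite (expect_bind _ _ p0) expect_dpoint// => u; exact: expect_ge0.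
Qed.

Lemma dbindA T U V (M : dist K T) (f : T -> dist K U) (g : U -> dist K V) :
  ext_eq (dbind (dbind M f) g) (dbind M (fun t => dbind (f t) g)).
Proof.
move=> phi p0; rewrite (expect_bind _ _ p0) expect_bind; last by move=> u; exact: expect_ge0.
rewrite [RHS](expect_bind _ _ p0).
by apply: expect_eq => i _; rewrite expect_bind.
Qed.

Lemma msub_subst s s' t :
  cn (msub s (subst s' t)) = cn (subst (fun x => msub s (s' x)) t).
Proof.
have aux s1 s2 (f : term K -> prog K) M :
    (forall i, cn (msub s1 (subst s2 (elt M i))) = cn (f (elt M i))) ->
    cn (msub s1 (msub s2 M)) = cn (dbind M f).
  by move=> e; rewrite (cn_ext (@dbindA _ _ _ _ _ _)); exact: cn_dbind_eq.
move: t s s'; apply: term_elim => [x|M IH|M N IH1 IH2] s s' //.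
  rewrite /= /msub (cn_ext (dbind_dpoint _ _)) /=.
  apply: cn_dpoint; congr Lam.
  apply: (aux (up s) (up s')) => i; rewrite IH; apply: subst_cong => // -[|x] /=.
    by rewrite /msub (cn_ext (dbind_dpoint _ _)).
  by rewrite msub_rename -rename_msub.
rewrite /= /msub (cn_ext (dbind_dpoint _ _)) /=.
apply: cn_dpoint; congr App.
  by apply: (aux s s') => i; rewrite IH1.
by apply: (aux s s') => i; rewrite IH2.
Qed.

Lemma msub_msub s s' M :
  cn (msub s (msub s' M)) = cn (msub (fun x => msub s (s' x)) M).
Proof.
rewrite (cn_ext (@dbindA _ _ _ _ _ _)); apply: cn_dbind_eq => i; exact: msub_subst.
Qed.

Lemma subst_vars r t : cn (subst (fun x => vars (r x)) t) = cn (dpoint (rename r t)).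
Proof.
have aux s r' M : (forall i, cn (subst s (elt M i)) = cn (dpoint (rename r' (elt M i)))) ->
    cn (msub s M) = cn (dmap (rename r') M).
  move=> e; apply/cnP => phi p0.
  have p0' u : (0 <= (phi \o nrm) u)%E by exact: p0.
  rewrite (expect_bind _ _ p0') expect_dmap; apply: expect_eq => i _.
  by have /cnP -> := e i => //; rewrite expect_dpoint.
have upv r' : up (fun x => vars (r' x)) = (fun x => @vars K (upren r' x)).
  by apply: funext => -[].
move: t r; apply: term_elim => [x|M IH|M N IH1 IH2] r //=.
  by apply: cn_dpoint; congr Lam; rewrite upv; apply: (aux (fun x => vars (upren r x))).
apply: cn_dpoint; congr App; first by apply: (aux (fun x => vars (r x))).
by apply: (aux (fun x => vars (r x))).
Qed.

Lemma msub_vars r M : cn (msub (fun x => vars (r x)) M) = cn (dmap (rename r) M).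
Proof.
apply/cnP => phi p0.
have p0' u : (0 <= (phi \o nrm) u)%E by exact: p0.
rewrite (expect_bind _ _ p0') expect_dmap; apply: expect_eq => i _.
by have /cnP -> := subst_vars r (elt M i) => //; rewrite expect_dpoint.
Qed.

Lemma msub_id M : cn (msub vars M) = cn M.
Proof.
rewrite (msub_vars id); congr cn; rewrite -[RHS]dmap_id.
by apply: dmap_ext => i; exact: rename_id.
Qed.

Lemma msub_dpoint s t : cn (msub s (dpoint t)) = cn (subst s t).
Proof. exact: cn_ext (dbind_dpoint _ _). Qed.

Lemma msub_subst0 s M N :
  cn (msub s (subst0 M N)) = cn (subst0 (msub (up s) M) (msub s N)).
Proof.
rewrite !subst0E !msub_msub; apply: msub_cong => // -[|x] /=.
  by rewrite msub_dpoint.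
by rewrite msub_dpoint /= msub_rename msub_id.
Qed.

(** This turns the effect of an [Apply y] transition on a body into a renaming. *)
Lemma subst0_vars y M : cn (subst0 M (vars y)) = cn (dmap (rename (fun x => if x is x'.+1 then x' else y)) M).
Proof.
rewrite subst0E -msub_vars; congr (cn (msub _ _)).
by apply: funext => -[].
Qed.

Lemma subst0_cong M M' N N' : cn M = cn M' -> cn N = cn N' ->
  cn (subst0 M N) = cn (subst0 M' N').
Proof. by move=> e e'; apply: msub_cong => // -[]. Qed.

End Normalise.

(** * The Krivine machine, and how it interacts with substitutions and stacks *)

Section Machine.
Context {K : realType}.
Implicit Types (t u : term K) (M N B : prog K) (s : seq (prog K)).

(* Observations of weak head normal forms.  An abstraction contributes [ta] and,
   linearly in its body, [tb]: the bodies of the abstractions of a program are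
   never told apart. *)
Record test := Test {
  ta : \bar K;
  tb : term K -> \bar K;
  to : nat -> seq (prog K) -> \bar K }.

Definition nonneg (phi : test) : Prop :=
  [/\ (0 <= ta phi)%E, (forall u, 0 <= tb phi u)%E & (forall x s, 0 <= to phi x s)%E].

Definition tle (phi psi : test) : Prop :=
  [/\ (ta phi <= ta psi)%E, (forall u, tb phi u <= tb psi u)%E
    & (forall x s, to phi x s <= to psi x s)%E].

Definition nondecr (Phi : nat -> test) : Prop :=
  forall n m, (n <= m)%N -> tle (Phi n) (Phi m).

(* Krivine machine with fuel n for beta steps; the test may depend on the fuel
   left when the normal form is reached. *)
Fixpoint run (n : nat) (Phi : nat -> test) : seq (prog K) -> term K -> \bar K :=
  fix go (s : seq (prog K)) (t : term K) {struct t} : \bar K :=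
  match t with
  | Var x => to (Phi n) x (map cn s)
  | Lam B =>
      match s with
      | [::] => (ta (Phi n) + expect (tb (Phi n) \o nrm) B)%E
      | N :: s' => if n is n'.+1 then expect (run n' Phi s') (subst0 B N) else 0%E
      end
  | App F N => expect (go (N :: s)) F
  end.

Definition mrun n Phi s M : \bar K := expect (run n Phi s) M.

Lemma run_app n Phi s F N : run n Phi s (App F N) = mrun n Phi (N :: s) F.
Proof. by case: n. Qed.

Lemma run_var n Phi s x : run n Phi s (Var x) = to (Phi n) x (map cn s).
Proof. by case: n. Qed.

Lemma run_lam n Phi B : run n Phi [::] (Lam B) = (ta (Phi n) + expect (tb (Phi n) \o nrm) B)%E.
Proof. by case: n. Qed.

Lemma run_beta n Phi s B N : run n.+1 Phi (N :: s) (Lam B) = mrun n Phi s (subst0 B N).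
Proof. by []. Qed.

(** Lexicographic induction: a beta step reaches arbitrary terms with less fuel, an application
    passes to the summands of its function part with the same fuel. *)
Lemma run_ind (P : nat -> seq (prog K) -> term K -> Prop) :
  (forall n s x, P n s (Var x)) -> (forall n B, P n [::] (Lam B)) ->
  (forall B N s, P 0%N (N :: s) (Lam B)) ->
  (forall n B N s, (forall s t, P n s t) -> P n.+1 (N :: s) (Lam B)) ->
  (forall n s F N, (forall i, P n (N :: s) (elt F i)) -> P n s (App F N)) ->
  forall n s t, P n s t.
Proof.
move=> PV PL P0 PB PA; elim=> [|n IH] s t; move: t s; apply: term_elim => [x|B _|F N HF _] s.
- exact: PV.
- by case: s => [|N s]; [exact: PL|exact: P0].
- by apply: PA => i; exact: HF.
- exact: PV.
- by case: s => [|N s]; [exact: PL|exact: PB].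
- by apply: PA => i; exact: HF.
Qed.

Lemma run_ge0 n Phi s t : (forall n, nonneg (Phi n)) -> (0 <= run n Phi s t)%E.
Proof.
move=> H; move: n s t; apply: run_ind => [n s x|n B|B N s|n B N s IH|n s F N IH].
- by rewrite run_var; case: (H n).
- rewrite run_lam adde_ge0//; first by case: (H n).
  by apply: expect_ge0 => u; case: (H n) => _ h _; exact: h.
- exact: lexx.
- exact: expect_ge0.
- rewrite run_app; apply: nneseries_ge0 => i _ _; rewrite mule_ge0//.
  by rewrite lee_fin prob_ge0.
Qed.

Lemma mrun_ge0 n Phi s M : (forall n, nonneg (Phi n)) -> (0 <= mrun n Phi s M)%E.
Proof. by move=> H; apply: expect_ge0 => t; exact: run_ge0. Qed.

Lemma run_le n Phi Psi s t : (forall n, nonneg (Phi n)) ->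
  (forall m, (m <= n)%N -> tle (Phi m) (Psi m)) -> (run n Phi s t <= run n Psi s t)%E.
Proof.
move=> H; move: n s t; apply: run_ind => [n s x|n B|B N s|n B N s IH|n s F N IH] le.
- by rewrite !run_var; case: (le n).
- have [l1 l2 _] := le n (leqnn _); have [_ h _] := H n.
  by rewrite !run_lam; apply: leeD => //; apply: expect_le => [u|i _]; [exact: h|exact: l2].
- exact: lexx.
- apply: expect_le => [u|i _]; first exact: run_ge0.
  by apply: IH => m mn; apply: le; exact: leqW.
- rewrite !run_app; apply: expect_le => [u|i _]; first exact: run_ge0.
  exact: IH.
Qed.

Lemma mrun_le n Phi Psi s M : (forall n, nonneg (Phi n)) ->
  (forall m, (m <= n)%N -> tle (Phi m) (Psi m)) -> (mrun n Phi s M <= mrun n Psi s M)%E.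
Proof.
by move=> H le; apply: expect_le => [u|i _]; [exact: run_ge0|exact: run_le].
Qed.

Lemma run_homo n m Phi s t : (forall n, nonneg (Phi n)) -> nondecr Phi ->
  (n <= m)%N -> (run n Phi s t <= run m Phi s t)%E.
Proof.
move=> H mon; move: n s t m; apply: run_ind => [n s x|n B|B N s|n B N s IH|n s F N IH] m nm.
- by rewrite !run_var; case: (mon _ _ nm).
- have [l1 l2 _] := mon _ _ nm; have [_ h _] := H n.
  by rewrite !run_lam; apply: leeD => //; apply: expect_le => [u|i _]; [exact: h|exact: l2].
- exact: run_ge0.
- case: m nm => // m nm; apply: expect_le => [u|i _]; first exact: run_ge0.
  exact: IH.
- rewrite !run_app; apply: expect_le => [u|i _]; first exact: run_ge0.
  exact: IH.
Qed.

Lemma mrun_homo n m Phi s M : (forall n, nonneg (Phi n)) -> nondecr Phi ->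
  (n <= m)%N -> (mrun n Phi s M <= mrun m Phi s M)%E.
Proof.
by move=> H le nm; apply: expect_le => [u|i _]; [exact: run_ge0|exact: run_homo].
Qed.

Lemma expect_tb_nrm (phi : test) B : nonneg phi ->
  expect (tb phi \o nrm) (cn B) = expect (tb phi \o nrm) B.
Proof.
case=> _ h _; rewrite expect_cn; last by move=> u; exact: h.
by apply: expect_eq => i _ /=; rewrite nrmK.
Qed.

Lemma run_nrm n Phi s t : (forall n, nonneg (Phi n)) ->
  forall s', map cn s = map cn s' -> run n Phi s t = run n Phi s' (nrm t).
Proof.
move=> H; move: n s t; apply: run_ind => [n s x|n B|B N s|n B N s IH|n s F N IH] s' e.
- by rewrite !run_var e.
- by case: s' e => // _; rewrite /nrm -/nrm !run_lam expect_tb_nrm.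
- by case: s' e.
- case: s' e => // N' s' [e e'].
  rewrite [nrm _]/= !run_beta; apply: expect_cn_eq => [u|u|u|u|]; try exact: run_ge0.
  + exact: IH.
  + by rewrite -(IH s').
  + by apply: subst0_cong => //; rewrite -/(cn B) cnK.
- rewrite /nrm -/nrm !run_app -/(cn F) -/(cn N) /mrun expect_cn; last first.
    by move=> u; exact: run_ge0.
  by apply: expect_eq => i _ /=; apply: IH; rewrite /= cnK e.
Qed.

Lemma run_cong n Phi s s' t t' : (forall n, nonneg (Phi n)) ->
  map cn s = map cn s' -> nrm t = nrm t' -> run n Phi s t = run n Phi s' t'.
Proof.
by move=> H e n'; rewrite (run_nrm n t H e) n' -(run_nrm n t' H (erefl _)).
Qed.

Lemma mrun_cong n Phi s s' M M' : (forall n, nonneg (Phi n)) ->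
  map cn s = map cn s' -> cn M = cn M' -> mrun n Phi s M = mrun n Phi s' M'.
Proof.
move=> H e; apply: expect_cn_eq => u; try exact: run_ge0; apply: run_cong => //.
  by rewrite nrmK.
by rewrite nrmK.
Qed.

(** Makes the evaluation of a substituted program an observation of the original one: on reaching a
    head variable [x], the evaluator [f] continues with [sg x] on the substituted stack. *)
Definition tsubst (sg : nat -> prog K) (phi : test) (f : seq (prog K) -> prog K -> \bar K) : test :=
  Test (ta phi) (fun u => expect (tb phi \o nrm) (subst (up sg) u))
       (fun x s => f (map (msub sg) s) (sg x)).

Lemma expect_tsubst sg phi f B : nonneg phi ->
  expect (tb (tsubst sg phi f) \o nrm) B = expect (tb phi \o nrm) (msub (up sg) B).
Proof.
case=> _ h _; have h' u : (0 <= (tb phi \o nrm) u)%E by exact: h.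
rewrite (expect_bind _ _ h'); apply: expect_eq => i _ /=.
by have /cnP/(_ _ h) <- := subst_nrm (elt B i) (fun x => erefl (cn (up sg x))).
Qed.

Lemma map_cn_msub sg s : map cn (map (msub sg) (map cn s)) = map cn (map (msub sg) s).
Proof.
rewrite -!map_comp; apply: eq_map => N /=; apply: msub_cong => //; exact: cnK.
Qed.

Lemma mrun_dpoint n Phi s t : (forall n, nonneg (Phi n)) ->
  mrun n Phi s (dpoint t) = run n Phi s t.
Proof. by move=> H; apply: expect_dpoint => u; exact: run_ge0. Qed.

(** An equality at each fuel, because tests may depend on the fuel left: the continuation in [sg x]
    runs with exactly what the head evaluation has not consumed. *)
Lemma mrun_subst sg n Phi s t : (forall n, nonneg (Phi n)) ->
  mrun n Phi (map (msub sg) s) (subst sg t) =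
  run n (fun m => tsubst sg (Phi m) (mrun m Phi)) s t.
Proof.
move=> H; move: n s t; apply: run_ind => [n s x|n B|B N s|n B N s IH|n s F N IH].
- by rewrite run_var /=; apply: mrun_cong => //; rewrite map_cn_msub.
- by rewrite mrun_dpoint// !run_lam expect_tsubst.
- by rewrite mrun_dpoint.
- rewrite mrun_dpoint// [map _ _]/= !run_beta.
  rewrite -(@mrun_cong n Phi _ _ (msub sg (subst0 B N)) _ H erefl); last first.
    by rewrite msub_subst0.
  rewrite /mrun expect_bind; last by move=> u; exact: run_ge0.
  by apply: expect_eq => i _; exact: IH.
- rewrite mrun_dpoint// !run_app.
  rewrite -/(msub sg F) -/(msub sg N) /mrun expect_bind; last by move=> u; exact: run_ge0.
  by apply: expect_eq => i _; exact: IH.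
Qed.

Lemma mrun_msub sg n Phi s M : (forall n, nonneg (Phi n)) ->
  mrun n Phi (map (msub sg) s) (msub sg M) =
  mrun n (fun m => tsubst sg (Phi m) (mrun m Phi)) s M.
Proof.
move=> H; rewrite [LHS]/mrun expect_bind; last by move=> u; exact: run_ge0.
by apply: expect_eq => i _; exact: mrun_subst.
Qed.

(** Makes an evaluation on a longer stack an observation of one on its upper part: an abstraction
    found there is consumed by [N], hence the weight 0, and [f] continues with its body. *)
Definition tstack N s (phi : test) (f : term K -> \bar K) : test :=
  Test 0%E f (fun x Ms => to phi x (Ms ++ map cn (N :: s))).

Definition beta_run n Phi N s u : \bar K :=
  if n is n'.+1 then mrun n' Phi s (subst (scons N vars) u) else 0%E.

Lemma run_stack n Phi s1 N s t : (forall n, nonneg (Phi n)) ->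
  run n Phi (s1 ++ N :: s) t =
  run n (fun m => tstack N s (Phi m) (beta_run m Phi N s)) s1 t.
Proof.
move=> H; move: n s1 t; apply: run_ind => [n s1 x|n B|B N' s1|n B N' s1 IH|n s1 F N' IH].
- by rewrite !run_var map_cat.
- rewrite run_lam add0e; case: n => [|n]; first by rewrite expect0.
  rewrite run_beta /mrun subst0E expect_bind; last by move=> u; exact: run_ge0.
  apply: expect_eq => i _ /=; apply: mrun_cong => //.
  by rewrite subst_nrmr.
- by [].
- by rewrite [(_ :: _) ++ _]/= !run_beta; apply: expect_eq => i _; exact: IH.
- by rewrite !run_app; apply: expect_eq => i _; exact: IH.
Qed.

Definition rinf phi s t : \bar K := ereal_sup (range (fun n => run n (fun=> phi) s t)).
Definition minf phi s M : \bar K := expect (rinf phi s) M.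

Lemma run_rinf n phi s t : (run n (fun=> phi) s t <= rinf phi s t)%E.
Proof. by apply: ereal_sup_ubound; exists n. Qed.

Lemma nondecr_cst phi : nondecr (fun=> phi).
Proof. by move=> n m _; split. Qed.
#[local] Hint Resolve nondecr_cst : core.

Lemma rinf_ge0 phi s t : nonneg phi -> (0 <= rinf phi s t)%E.
Proof. by move=> H; apply: le_trans (run_rinf 0 _ _ _); exact: run_ge0. Qed.

Lemma minf_ge0 phi s M : nonneg phi -> (0 <= minf phi s M)%E.
Proof. by move=> H; apply: expect_ge0 => t; exact: rinf_ge0. Qed.

Lemma minf_le phi s M c : nonneg phi -> (forall n, mrun n (fun=> phi) s M <= c)%E ->
  (minf phi s M <= c)%E.
Proof.
move=> H; apply: expect_sup => [n t|t n m]; first exact: run_ge0.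
exact: run_homo.
Qed.

Lemma mrun_minf n phi s M : nonneg phi -> (mrun n (fun=> phi) s M <= minf phi s M)%E.
Proof.
by move=> H; apply: expect_le => [t|i _]; [exact: run_ge0|exact: run_rinf].
Qed.

Lemma rinf_le phi s t c : (forall n, run n (fun=> phi) s t <= c)%E -> (rinf phi s t <= c)%E.
Proof. by move=> h; apply: ge_ereal_sup => _ [n _ <-]. Qed.

Lemma rinf_var phi s x : rinf phi s (Var x) = to phi x (map cn s).
Proof.
apply/eqP; rewrite eq_le; apply/andP; split.
  by apply: rinf_le => n; rewrite run_var.
by apply: le_trans (run_rinf 0 _ _ _); rewrite run_var.
Qed.

Lemma rinf_lam phi B : rinf phi [::] (Lam B) = (ta phi + expect (tb phi \o nrm) B)%E.
Proof.
apply/eqP; rewrite eq_le; apply/andP; split.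
  by apply: rinf_le => n; rewrite run_lam.
by apply: le_trans (run_rinf 0 _ _ _); rewrite run_lam.
Qed.

Lemma rinf_app phi s F N : nonneg phi -> rinf phi s (App F N) = minf phi (N :: s) F.
Proof.
move=> H; apply/eqP; rewrite eq_le; apply/andP; split.
  by apply: rinf_le => n; rewrite run_app; exact: mrun_minf.
by apply: minf_le => // n; rewrite -run_app; exact: run_rinf.
Qed.

Lemma rinf_beta phi s B N : nonneg phi ->
  rinf phi (N :: s) (Lam B) = minf phi s (subst0 B N).
Proof.
move=> H; apply/eqP; rewrite eq_le; apply/andP; split.
  apply: rinf_le => -[|n]; first exact: minf_ge0.
  by rewrite run_beta; exact: mrun_minf.
by apply: minf_le => // n; rewrite -run_beta; exact: run_rinf.
Qed.

Lemma rinf_cong phi s s' t t' : nonneg phi ->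
  map cn s = map cn s' -> nrm t = nrm t' -> rinf phi s t = rinf phi s' t'.
Proof.
move=> H e n; rewrite /rinf.
have -> : (fun m => run m (fun=> phi) s t) = (fun m => run m (fun=> phi) s' t').
  by apply: funext => m; exact: run_cong.
by [].
Qed.

Lemma minf_cong phi s s' M M' : nonneg phi ->
  map cn s = map cn s' -> cn M = cn M' -> minf phi s M = minf phi s' M'.
Proof.
move=> H e; apply: expect_cn_eq => u; try exact: rinf_ge0; apply: rinf_cong => //.
  by rewrite nrmK.
by rewrite nrmK.
Qed.

Lemma minf_dpoint phi s t : nonneg phi -> minf phi s (dpoint t) = rinf phi s t.
Proof. by move=> H; apply: expect_dpoint => u; exact: rinf_ge0. Qed.

Lemma nonneg_tsubst sg phi f : nonneg phi -> (forall s M, 0 <= f s M)%E ->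
  nonneg (tsubst sg phi f).
Proof.
by case=> h1 h2 h3 f0; split => //= u; apply: expect_ge0 => ?; exact: h2.
Qed.

Lemma nonneg_tstack N s phi f : nonneg phi -> (forall u, 0 <= f u)%E ->
  nonneg (tstack N s phi f).
Proof. by case=> h1 h2 h3 f0; split => //= u. Qed.

(** Here the continuation has unlimited fuel, and the induction is on the fuel of the head
    evaluation. The reverse inequality is then a comparison with the equality at fixed fuel, whose
    continuations are smaller. *)
Lemma minf_msub sg phi s M : nonneg phi ->
  (minf (tsubst sg phi (minf phi)) s M <= minf phi (map (msub sg) s) (msub sg M))%E.
Proof.
move=> H; set Psi := tsubst _ _ _.
have HP : nonneg Psi by apply: nonneg_tsubst => // *; exact: minf_ge0.
have rec n s' t :
    (run n (fun=> Psi) s' t <= minf phi (map (msub sg) s') (subst sg t))%E.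
  move: n s' t; apply: run_ind => [n s' x|n B|B N s'|n B N s' IH|n s' F N IH].
  - by rewrite run_var /= (@minf_cong _ _ (map (msub sg) s') _ (sg x))// map_cn_msub.
  - by rewrite minf_dpoint// run_lam expect_tsubst// rinf_lam.
  - exact: minf_ge0.
  - rewrite minf_dpoint// run_beta [map _ _]/= rinf_beta//.
    rewrite -(@minf_cong phi _ _ (msub sg (subst0 B N)) _ H erefl); last first.
      by rewrite msub_subst0.
    rewrite /minf expect_bind; last by move=> u; exact: rinf_ge0.
    by apply: expect_le => [u|i _]; [exact: run_ge0|exact: IH].
  - rewrite minf_dpoint// run_app rinf_app//.
    rewrite -/(msub sg F) -/(msub sg N) /minf expect_bind; last by move=> u; exact: rinf_ge0.
    by apply: expect_le => [u|i _]; [exact: run_ge0|exact: IH].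
apply: minf_le => // n; rewrite [leRHS]/minf expect_bind; last by move=> u; exact: rinf_ge0.
by apply: expect_le => [u|i _]; [exact: run_ge0|exact: rec].
Qed.

Lemma minf_stack phi N s M : nonneg phi ->
  (minf (tstack N s phi (fun u => minf phi s (subst (scons N vars) u))) [::] M <=
   minf phi (N :: s) M)%E.
Proof.
move=> H; set Psi := tstack _ _ _ _.
have HP : nonneg Psi by apply: nonneg_tstack => // *; exact: minf_ge0.
have rec n s1 t : (run n (fun=> Psi) s1 t <= rinf phi (s1 ++ N :: s) t)%E.
  move: n s1 t; apply: run_ind => [n s1 x|n B|B N' s1|n B N' s1 IH|n s1 F N' IH].
  - by rewrite run_var rinf_var map_cat.
  - rewrite run_lam rinf_beta// add0e /minf subst0E expect_bind; last first.
      by move=> u; exact: rinf_ge0.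
    apply: expect_le => [u|i _]; first by case: HP => _ h _; exact: h.
    by rewrite /= (@minf_cong _ _ s _ (subst (scons N vars) (elt B i)))// subst_nrmr.
  - exact: rinf_ge0.
  - rewrite run_beta [(_ :: _) ++ _]/= rinf_beta//.
    by apply: expect_le => [u|i _]; [exact: run_ge0|exact: IH].
  - rewrite run_app rinf_app//.
    by apply: expect_le => [u|i _]; [exact: run_ge0|exact: IH].
apply: minf_le => // n.
by apply: expect_le => [u|i _]; [exact: run_ge0|exact: rec].
Qed.

Lemma minf_stackE phi N s M : nonneg phi ->
  minf phi (N :: s) M =
  minf (tstack N s phi (fun u => minf phi s (subst (scons N vars) u))) [::] M.
Proof.
move=> H; apply/eqP; rewrite eq_le minf_stack// andbT; apply: minf_le => // n.
set psi := tstack _ _ _ _.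
have HP : nonneg psi by apply: nonneg_tstack => // *; exact: minf_ge0.
apply: le_trans (mrun_minf n [::] M HP).
have E : mrun n (fun=> phi) (N :: s) M =
    mrun n (fun m => tstack N s phi (beta_run m (fun=> phi) N s)) [::] M.
  by apply: expect_eq => i _; rewrite -(run_stack n [::]).
rewrite E; apply: mrun_le => [k|k _].
  by apply: nonneg_tstack => // u; case: k => // k; exact: mrun_ge0.
split=> //= u; case: k => [|k]; first exact: minf_ge0.
exact: mrun_minf.
Qed.

Lemma minf_msubE sg phi M : nonneg phi ->
  minf phi [::] (msub sg M) = minf (tsubst sg phi (minf phi)) [::] M.
Proof.
move=> H; apply/eqP; rewrite eq_le (minf_msub sg [::])// andbT; apply: minf_le => // n.
set psi := tsubst _ _ _.
have HP : nonneg psi by apply: nonneg_tsubst => // *; exact: minf_ge0.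
apply: le_trans (mrun_minf n [::] M HP).
rewrite (mrun_msub sg n [::])//; apply: mrun_le => [k|k _].
  by apply: nonneg_tsubst => // *; exact: mrun_ge0.
by split=> //= x s; exact: mrun_minf.
Qed.

Lemma run_le1 n phi s t : nonneg phi ->
  (forall B, ta phi + expect (tb phi \o nrm) B <= 1)%E -> (forall x s, to phi x s <= 1)%E ->
  (run n (fun=> phi) s t <= 1)%E.
Proof.
move=> H h1 h2; move: n s t; apply: run_ind => [n s x|n B|B N s|n B N s IH|n s F N IH].
- by rewrite run_var.
- by rewrite run_lam.
- exact: lee01.
- rewrite run_beta; apply: le_trans (total_le1 (subst0 B N)).
  by apply: expect_le_total => t; rewrite IH run_ge0.
- rewrite run_app; apply: le_trans (total_le1 F); rewrite totalE.
  by apply: expect_le => // u; exact: run_ge0.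
Qed.

Lemma minf_le_total phi s M : nonneg phi ->
  (forall B, ta phi + expect (tb phi \o nrm) B <= 1)%E -> (forall x s, to phi x s <= 1)%E ->
  (minf phi s M <= total M)%E.
Proof.
move=> H h1 h2; apply: minf_le => // n; apply: expect_le_total => t.
by rewrite run_ge0//= run_le1.
Qed.

End Machine.
#[global] Hint Resolve nondecr_cst : core.

(** * Agreement of the machine with call-by-name reduction to [whnf] *)

Section Adequacy.
Context {K : realType}.
Implicit Types (t u : term K) (M N B : prog K) (s : seq (prog K)).

(** The total weight is at most 1. So the test on the first summand in [open_app] does select point
    distributions. *)
Lemma head_weights T (M : dist K T) i : wt M 0%N = 1 -> wt M i.+1 = 0.
Proof.
move=> w1; apply/eqP; rewrite eq_le prob_ge0 andbT.
have := prob_le1 (wt M); rewrite nneseries_recl//; last by move=> k _; rewrite lee_fin prob_ge0.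
rewrite w1 -[leRHS]adde0 leeD2lE// => h.
rewrite -lee_fin; apply: le_trans h.
have k0 k : (0 <= (wt M k)%:E)%E by rewrite lee_fin prob_ge0.
apply: le_trans (@nneseries_lim_ge _ (fun k => (wt M k)%:E) xpredT 1%N i.+2 _) => //.
by rewrite big_nat_recr//= leeDr//; apply: sume_ge0.
Qed.

Lemma expect_head T (phi : T -> \bar K) (M : dist K T) : (forall v, 0 <= phi v)%E ->
  wt M 0%N = 1 -> expect phi M = phi (elt M 0%N).
Proof.
move=> p0 w1; rewrite /expect series_head ?w1 ?mul1e// => i.
  by rewrite mule_ge0// lee_fin prob_ge0.
by rewrite head_weights// mul0e.
Qed.

Lemma run_open n Phi s t x Ms : (forall n, nonneg (Phi n)) ->
  open_app t = Some (x, Ms) -> run n Phi s t = to (Phi n) x (map cn (Ms ++ s)).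
Proof.
move=> H; move: t s Ms; apply: term_elim => [y|B _|F N IH _] s Ms //=.
  by case=> <- <-; rewrite run_var.
case: eqP => // w1; case e: open_app => [[y Ns]|] // [yx <-]; subst y.
rewrite run_app /mrun expect_head//; last by move=> u; exact: run_ge0.
by rewrite (IH _ _ _ e) -cats1 -catA.
Qed.

Lemma rinf_open phi s t x Ms : nonneg phi ->
  open_app t = Some (x, Ms) -> rinf phi s t = to phi x (map cn (Ms ++ s)).
Proof.
move=> H e; apply/eqP; rewrite eq_le; apply/andP; split.
  by apply: rinf_le => n; rewrite (@run_open _ _ _ _ x Ms).
by apply: le_trans (run_rinf 0 _ _ _); rewrite (@run_open _ _ _ _ x Ms).
Qed.

Definition obs phi t : \bar K := run 0 (fun=> phi) [::] t.

Lemma obs_ge0 phi t : nonneg phi -> (0 <= obs phi t)%E.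
Proof. by move=> H; exact: run_ge0. Qed.

Lemma obs_open phi t x Ms : nonneg phi ->
  open_app t = Some (x, Ms) -> obs phi t = to phi x (map cn Ms).
Proof. by move=> H e; rewrite /obs (@run_open _ _ _ _ x Ms)// cats0. Qed.

(** Unlimited fuel makes beta steps invisible. No case distinction on normal forms arises, as
    [reduct] leaves the value of an open application unchanged too. *)
Lemma rinf_reduct phi s u : nonneg phi -> minf phi s (reduct u) = rinf phi s u.
Proof.
move=> H; have R0 s' v : (0 <= rinf phi s' v)%E by exact: rinf_ge0.
move: u s; apply: term_elim => [x|B _|F N IH _] s /=; rewrite ?minf_dpoint//.
rewrite rinf_app// /minf expect_dsum//; apply: eq_eseriesr => i _; congr (_ * _)%E.
have := IH i (N :: s); case: (elt F i) => [x _|B _|F' N' IHi].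
- by rewrite expect_dpoint// rinf_app// minf_dpoint.
- by rewrite rinf_beta.
- rewrite -IHi expect_dmap; apply: expect_eq => j _ /=.
  by rewrite rinf_app// minf_dpoint.
Qed.

(* [iter k later (now phi) u] is the contribution of the normal forms that u
   reaches after exactly k parallel steps. *)
Definition later (psi : term K -> \bar K) u : \bar K :=
  if is_whnf u then 0%E else expect psi (reduct u).
Definition now (phi : term K -> \bar K) u : \bar K := if is_whnf u then phi u else 0%E.
Definition einf phi u : \bar K := (\sum_(0 <= k <oo) iter k later (now phi) u)%E.

Section Einf.
Variable phi : term K -> \bar K.
Hypothesis phi0 : forall u, (0 <= phi u)%E.

Lemma later_ge0 psi u : (forall v, 0 <= psi v)%E -> (0 <= later psi u)%E.
Proof. by move=> p0; rewrite /later; case: ifP => // _; exact: expect_ge0. Qed.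

Lemma iter_later_ge0 k u : (0 <= iter k later (now phi) u)%E.
Proof.
elim: k u => [|k IH] u /=; first by rewrite /now; case: ifP.
exact: later_ge0.
Qed.

Lemma einf_ge0 u : (0 <= einf phi u)%E.
Proof. by apply: nneseries_ge0 => k _ _; exact: iter_later_ge0. Qed.

Lemma expect_pending psi k M : (forall v, 0 <= psi v)%E ->
  expect psi (pending k M) = expect (iter k later psi) M.
Proof.
elim: k psi => [//|k IH] psi p0 /=; rewrite expect_bind// expect_filter.
rewrite -iterS iterSr -IH; last by move=> v; exact: later_ge0.
by apply: expect_eq => i _; rewrite /later /=; case: (is_whnf _).
Qed.

Lemma expect_whnf M : expect phi (whnf M) = expect (einf phi) M.
Proof.
pose a n := expect phi (nfpart (pending n M)).
transitivity (\sum_(0 <= n <oo) a n)%E.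
  pose F n i := ((wt (nfpart (pending n M)) i)%:E * phi (elt (pending n M) i))%E.
  transitivity (\sum_(0 <= k <oo) F (Cantor.of_nat k).1 (Cantor.of_nat k).2)%E.
    by apply: eq_eseriesr => k _; rewrite /= /whnf_wt; case: Cantor.of_nat.
  rewrite esum_cantor; last by move=> i j; rewrite mule_ge0// lee_fin prob_ge0.
  by [].
rewrite expect_series; last by move=> k t; exact: iter_later_ge0.
apply: eq_eseriesr => k _; rewrite /a expect_filter -expect_pending//.
by move=> v; rewrite /now; case: ifP.
Qed.

Lemma einf_whnf u : is_whnf u -> einf phi u = phi u.
Proof.
move=> w; rewrite /einf series_head => [|k|k]; last 2 first.
- exact: iter_later_ge0.
- by rewrite /= /later w.
- by rewrite /= /now w.
Qed.

Lemma einf_step u : ~~ is_whnf u -> einf phi u = expect (einf phi) (reduct u).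
Proof.
move=> w; rewrite [RHS]expect_series; last by move=> k t; exact: iter_later_ge0.
rewrite /einf nneseries_recl//; last by move=> k _; exact: iter_later_ge0.
rewrite /= {1}/now (negbTE w) add0e.
rewrite -[LHS](nneseries_addn 1); last by move=> k; exact: iter_later_ge0.
by apply: eq_eseriesr => k _; rewrite addn1 /= /later (negbTE w).
Qed.

Lemma expect_big n (h : nat -> term K -> \bar K) M : (forall k t, 0 <= h k t)%E ->
  expect (fun t => \sum_(0 <= k < n) h k t)%E M = (\sum_(0 <= k < n) expect (h k) M)%E.
Proof.
move=> h0; elim: n => [|n IH].
  by rewrite big_geq//; under eq_fun do rewrite big_geq//; exact: expect0.
rewrite big_nat_recr//= -IH -expectD//.
  by apply: expect_eq => i _; rewrite big_nat_recr.
by move=> t; exact: sume_ge0.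
Qed.

(** [einf phi] is the least function that dominates [phi] on normal forms and does not grow along
    reduction; by induction on the number of parallel steps. *)
Lemma einf_le (h : term K -> \bar K) u : 
  (forall u, is_whnf u -> phi u <= h u)%E ->
  (forall u, 0 <= h u)%E ->
  (forall u, ~~ is_whnf u -> expect h (reduct u) <= h u)%E -> (einf phi u <= h u)%E.
Proof.
move=> hw h0 hs; apply: lime_le.
  by apply: is_cvg_nneseries => *; exact: iter_later_ge0.
apply: nearW => n; elim: n u => [|n IH] u; first by rewrite big_geq.
rewrite big_nat_recl//=; have [w|w] := boolP (is_whnf u).
  rewrite /now w big1 ?adde0 ?hw// => k _; by rewrite /later w.
rewrite /now (negbTE w) add0e; apply: le_trans (hs _ w).
rewrite (eq_bigr (fun k => expect (iter k later (now phi)) (reduct u))); last first.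
  by move=> k _; rewrite /later (negbTE w).
rewrite -expect_big; last by move=> k t; exact: iter_later_ge0.
apply: expect_le => [t|i _]; last exact: IH.
by apply: sume_ge0 => k _; exact: iter_later_ge0.
Qed.

End Einf.

Definition apps t s : term K := foldl (fun u N => App (dpoint u) N) t s.

Lemma unit_wt0 : unit_wt 0 == 1 :> K. Proof. by rewrite /unit_wt. Qed.

Lemma open_apps t s : open_app (apps t s) =
  omap (fun p => (p.1, p.2 ++ s)) (open_app t).
Proof.
elim: s t => [|N s IH] t /=.
  by case: open_app => [[x Ms]|] //=; rewrite cats0.
rewrite IH /= unit_wt0; case: open_app => [[x Ms]|] //=.
by rewrite -cats1 -catA.
Qed.

Lemma is_open_apps t s : is_open (apps t s) = is_open t.
Proof. by rewrite /is_open open_apps; case: open_app. Qed.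

Lemma apps_not_whnf t s : ~~ is_whnf t -> ~~ is_whnf (apps t s).
Proof.
rewrite /is_whnf !negb_or is_open_apps => /andP[a ->]; rewrite andbT.
by elim: s t a => [|N s IH] t a //=; apply: IH.
Qed.

Lemma reduct_apps (h : term K -> \bar K) u s : (forall t, 0 <= h t)%E -> ~~ is_whnf u ->
  expect h (reduct (apps u s)) = expect (fun v => h (apps v s)) (reduct u).
Proof.
move=> h0; elim: s u => [//|N s IH] u w.
rewrite [apps u _]/= -/(apps (App (dpoint u) N) s) IH; last first.
  by apply: (apps_not_whnf [:: N]).
case: u w => // F N' w.
have E : ext_eq (reduct (App (dpoint (App F N')) N))
  (dmap (fun v => App (dpoint v) N) (reduct (App F N'))).
  by move=> phi p0; rewrite [reduct _]/= expect_dsum// series_head// => *;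
    rewrite ?mul1e ?mul0e// mule_ge0 ?lee_fin ?prob_ge0//; exact: expect_ge0.
by rewrite E.
Qed.

(** Reducing an open application only rebuilds it with the same head and arguments. Such reductions
    do occur, inside a function part that has other, reducible summands. *)
Lemma reduct_open (h : term K -> \bar K) t w c : (forall t, 0 <= h t)%E ->
  open_app t = Some w -> (forall v, open_app v = Some w -> h v = c) ->
  expect h (reduct t) = c.
Proof.
move=> h0; move: t w h h0 c; apply: term_elim => [x|B _|F N IH _] w h h0 c //=.
  by move=> e hc; rewrite expect_dpoint// hc.
case: eqP => // w1; case e: open_app => [[y Ns]|] // [<-] hc.
rewrite expect_dsum// series_head ?w1 ?mul1e => [|i|i]; last 2 first.
- by rewrite mule_ge0 ?lee_fin ?prob_ge0//; exact: expect_ge0.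
- by rewrite head_weights// mul0e.
have hc' v : open_app v = Some (y, Ns) -> h (App (dpoint v) N) = c.
  by move=> ev; apply: hc; rewrite /= unit_wt0 ev.
have := IH 0%N (y, Ns) (fun v => h (App (dpoint v) N)) (fun v => h0 _) c e hc'.
case: (elt F 0%N) e => [x ex _|//|F' N' _ IH0].
  by rewrite expect_dpoint//; exact: (hc' (Var x)).
by rewrite -IH0.
Qed.

Section Whnf.
Variable phi : @test K.
Hypothesis H : nonneg phi.

Let o0 t : (0 <= obs phi t)%E. Proof. exact: obs_ge0. Qed.
Let e0 t : (0 <= einf (obs phi) t)%E. Proof. exact: einf_ge0. Qed.

Lemma einf_open t x Ms : open_app t = Some (x, Ms) ->
  einf (obs phi) t = to phi x (map cn Ms).
Proof.
move=> e; rewrite einf_whnf ?(obs_open H e)//.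
by rewrite /is_whnf /is_open e orbT.
Qed.

(** Evaluation is linear in the function part. If [App F N] is open, [F] is a point and nothing
    reduces; otherwise one step distributes over the summands of [F], and each of them contributes
    what it would contribute alone. *)
Lemma einf_app F N s : einf (obs phi) (apps (App F N) s) =
  expect (fun t => einf (obs phi) (apps t (N :: s))) F.
Proof.
have [|no] := boolP (is_open (App F N)).
  rewrite /is_open /=; case: eqP => // w1; case e: open_app => [[y Ns]|] // _.
  rewrite expect_head//.
  rewrite (@einf_open _ y (Ns ++ N :: s)); last first.
    by rewrite open_apps /= w1 eqxx e /= -cats1 -catA.
  by rewrite (@einf_open _ y (Ns ++ N :: s))// (open_apps _ (N :: s)) e.
rewrite einf_step ?apps_not_whnf// reduct_apps// [reduct _]/= expect_dsum//.
apply: eq_eseriesr => i _; congr (_ * _)%E.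
have E (t : term K) M : ~~ is_open (App (dpoint t) N) ->
    ext_eq (reduct (App (dpoint t) N)) M ->
    expect (fun v => einf (obs phi) (apps v s)) M = einf (obs phi) (apps t (N :: s)).
  move=> nt EM; rewrite -EM//.
  by rewrite [apps t _]/= -/(apps (App (dpoint t) N) s) einf_step ?apps_not_whnf// reduct_apps.
have U M P (psi : term K -> \bar K) : (forall t, 0 <= psi t)%E ->
    expect psi (dsum unitp (fun i => if i is 0%N then P else M)) = expect psi P.
  move=> p0; rewrite expect_dsum// series_head => [|k|k]; rewrite ?mul1e ?mul0e//.
  by rewrite mule_ge0 ?lee_fin ?prob_ge0//; exact: expect_ge0.
case: (elt F i) => [x|B|F' N'].
- by rewrite expect_dpoint.
- apply: E; first by rewrite /is_open /= unit_wt0.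
  by move=> psi p0; rewrite /= expect_dsum// series_head => [|k|k]; rewrite ?mul1e ?mul0e//;
    rewrite mule_ge0 ?lee_fin ?prob_ge0//; exact: expect_ge0.
(* An open summand of a function part that is not open has been reduced along with the others; this
   does not change what is observed of it. *)
set t := App F' N'; have [|nt] := boolP (is_open t).
  rewrite /is_open; case e: open_app => [[y Ns]|] // _.
  rewrite (@einf_open _ y (Ns ++ N :: s)); last by rewrite (open_apps t (N :: s)) e.
  rewrite expect_dmap (reduct_open _ e (c := to phi y (map cn (Ns ++ N :: s))))//=.
  move=> v ev; apply: einf_open; rewrite open_apps /= unit_wt0 ev /=.
  by rewrite -cats1 -catA.
apply: E.
  by rewrite (is_open_apps t [:: N]).
by move=> psi p0; rewrite [reduct _]/= expect_dsum// series_head => [|k|k]; rewrite ?mul1e ?mul0e//;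
    rewrite mule_ge0 ?lee_fin ?prob_ge0//; exact: expect_ge0.
Qed.

Lemma run_einf n s t : (run n (fun=> phi) s t <= einf (obs phi) (apps t s))%E.
Proof.
move: n s t; apply: run_ind => [n s x|n B|B N s|n B N s IH|n s F N IH].
- by rewrite run_var (@einf_open _ x s)// open_apps.
- by rewrite run_lam einf_whnf// /obs run_lam.
- exact: e0.
- rewrite run_beta [apps _ _]/= -/(apps (App (dpoint (Lam B)) N) s).
  have nw : ~~ is_whnf (App (dpoint (Lam B)) N) by rewrite /is_whnf/is_open /= unit_wt0.
  rewrite einf_step ?apps_not_whnf// reduct_apps// [reduct _]/= expect_dsum// series_head;
    [|by move=> k; rewrite mule_ge0 ?lee_fin ?prob_ge0//; exact: expect_ge0|
     by move=> k; rewrite mul0e].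
  rewrite mul1e; apply: expect_le => [v|i _]; [exact: run_ge0|exact: IH].
- rewrite run_app einf_app; apply: expect_le => [v|i _]; [exact: run_ge0|exact: IH].
Qed.

(** One inequality is an induction on fuel; for the other, [rinf phi [::]] is invariant under
    reduction and hence above the least solution [einf]. *)
Theorem minf_whnf M : minf phi [::] M = expect (obs phi) (whnf M).
Proof.
rewrite expect_whnf//; apply/eqP; rewrite eq_le; apply/andP; split.
  apply: minf_le => // n; apply: expect_le => [v|i _]; first exact: run_ge0.
  exact: run_einf.
apply: expect_le => // i _; apply: einf_le => [//|u w|u|u w].
- exact: run_rinf.
- exact: rinf_ge0.
- by rewrite -/(minf _ _ _) rinf_reduct.
Qed.

End Whnf.
End Adequacy.

(** * Sums with arbitrary nonnegative weights *)

Section WeightedSums.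
Context {K : realType}.
Implicit Types (p : nat -> K) (f g : nat -> \bar K).

Definition psum p f : \bar K := (\sum_(0 <= k <oo) (p k)%:E * f k)%E.

Lemma psum_ge0 p f : (forall k, 0 <= p k) -> (forall k, 0 <= f k)%E -> (0 <= psum p f)%E.
Proof. by move=> p0 f0; apply: nneseries_ge0 => k _ _; rewrite mule_ge0 ?lee_fin. Qed.

Lemma psum_le p f g : (forall k, 0 <= p k) -> (forall k, p k != 0 -> (0 <= f k)%E) ->
  (forall k, p k != 0 -> (f k <= g k)%E) -> (psum p f <= psum p g)%E.
Proof.
move=> p0 f0 fg; apply: lee_nneseries => k _ => [_|].
  by have [->|/f0 h] := eqVneq (p k) 0; rewrite ?mul0e// mule_ge0 ?lee_fin.
by have [->|/fg h] := eqVneq (p k) 0; rewrite ?mul0e// lee_wpmul2l ?lee_fin.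
Qed.

Lemma psum_eq p f g : (forall k, p k != 0 -> f k = g k) -> psum p f = psum p g.
Proof.
by move=> fg; apply: eq_eseriesr => k _; have [->|/fg ->//] := eqVneq (p k) 0; rewrite !mul0e.
Qed.

Lemma psumD p f g : (forall k, 0 <= p k) -> (forall k, 0 <= f k)%E -> (forall k, 0 <= g k)%E ->
  psum p (fun k => f k + g k)%E = (psum p f + psum p g)%E.
Proof.
move=> p0 f0 g0; rewrite /psum -nneseriesD.
- by apply: eq_eseriesr => k _; rewrite ge0_muleDr.
- by move=> k _; rewrite mule_ge0 ?lee_fin.
- by move=> k _; rewrite mule_ge0 ?lee_fin.
Qed.

Lemma psumZ p f (c : \bar K) : (forall k, 0 <= p k) -> (forall k, 0 <= f k)%E -> (0 <= c)%E ->
  psum p (fun k => f k * c)%E = (psum p f * c)%E.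
Proof.
move=> p0 f0 c0; rewrite muleC /psum -nneseriesZ//.
  by apply: eq_eseriesr => k _; rewrite muleA muleC.
by move=> k; rewrite mule_ge0 ?lee_fin.
Qed.

Lemma psum0 p : psum p (fun=> 0%E) = 0%E.
Proof. by apply: eseries0 => k _ _; rewrite mule0. Qed.

Definition delta0 (k : nat) : K := (k == 0%N)%:R.
Lemma psum_delta0 f : (0 <= f 0%N)%E -> psum delta0 f = f 0%N.
Proof.
move=> f0; rewrite /psum series_head => [|[|k]|k]; rewrite /delta0 ?mul1e ?mul0e//.
Qed.

(** Weight 1 on each of two summands: a plain binary sum, not a convex one. *)
Definition pair_wt (k : nat) : K := (k < 2)%N%:R.
Lemma pair_wt_ge0 k : 0 <= pair_wt k. Proof. exact: ler0n. Qed.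

Lemma psum_pair (x y : \bar K) : (0 <= x)%E -> (0 <= y)%E ->
  psum pair_wt (fun k => if k is 0%N then x else y) = (x + y)%E.
Proof.
move=> x0 y0; rewrite /psum nneseries_recl//; last first.
  by move=> k _; rewrite mule_ge0 ?lee_fin ?pair_wt_ge0//; case: k.
rewrite -[X in (_ + X)%E](nneseries_addn 1); last first.
  by move=> k; rewrite mule_ge0 ?lee_fin ?pair_wt_ge0//; case: k.
rewrite series_head => [|k|k].
- by rewrite /pair_wt /= !mul1e.
- by rewrite mule_ge0 ?lee_fin ?pair_wt_ge0//; case: k.
- by rewrite /pair_wt /= addn1 mul0e.
Qed.

(** A property of the support becomes a vanishing expectation, and can be carried along equations
    between expectations. *)
Lemma expect_supp T (P : T -> Prop) (M : dist K T) :
  (forall i, wt M i != 0 -> P (elt M i)) <->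
  expect (fun t => if `[< P t >] then 0%E else 1%E) M = 0%E.
Proof.
split=> [h|h i wi].
  by rewrite -[RHS](expect0 M); apply: expect_eq => i /h Pi; rewrite asboolT.
apply: contrapT => nP; have : ((wt M i)%:E <= 0)%E.
  rewrite -h; have f0 k : (0 <= (wt M k)%:E * (if `[< P (elt M k) >] then 0%E else 1%E))%E.
    by rewrite mule_ge0 ?lee_fin ?prob_ge0//; case: ifP.
  apply: le_trans (@nneseries_lim_ge _ _ xpredT 0%N i.+1 _); last by move=> k _ _; exact: f0.
  rewrite big_nat_recr//= asboolF// mule1 leeDr//; exact: sume_ge0.
by rewrite lee_fin => le0; move: wi; rewrite eq_le le0 prob_ge0.
Qed.

Lemma wsum_supp T p (F : nat -> dist K T) (M : dist K T) (P : T -> Prop) :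
  (forall phi, (forall t, 0 <= phi t)%E -> expect phi M = psum p (fun k => expect phi (F k))) ->
  (forall k, p k != 0 -> forall i, wt (F k) i != 0 -> P (elt (F k) i)) ->
  forall i, wt M i != 0 -> P (elt M i).
Proof.
move=> e h; apply/expect_supp; rewrite e => [|t]; last by case: ifP.
rewrite -[RHS](psum0 p); apply: psum_eq => k pk; apply/(expect_supp P (F k)); exact: h.
Qed.

End WeightedSums.

(** * The contextual closure and single rounds of evaluation *)

Section Closure.
Context {K : realType}.
Variable base : prog K -> prog K -> Prop.
Implicit Types (t u : term K) (M N B : prog K) (s : seq (prog K)) (m : \bar K).
Implicit Types (phi : @test K) (Phi : nat -> @test K).

Definition dapps M s : prog K := dmap (fun t => apps t s) M.

Definition body M : prog K := dbind M (fun t => if t is Lam B then B else dzero).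

(** [M] need not be the sum of the [Ms], it only has to evaluate like it. The upper bound is
    required at each fuel, since rounds count the beta steps of the left program; [below] ignores
    fuel. *)
Definition above p (Ms : nat -> prog K) M : Prop :=
  forall n Phi, (forall n, nonneg (Phi n)) -> nondecr Phi ->
  (mrun n Phi [::] M <= psum p (fun k => mrun n Phi [::] (Ms k)))%E.

Definition below p (Ms : nat -> prog K) M : Prop :=
  forall phi, nonneg phi -> (psum p (fun k => minf phi [::] (Ms k)) <= minf phi [::] M)%E.

(* The contextual closure of [base].  The bound m on the total weights is an
   index of its own, since a substitution can lower the total weight of a program
   below that of what remains to be evaluated of it. *)
Inductive crel : \bar K -> prog K -> prog K -> Prop :=
| RBase m M M' : base M M' -> (total M <= m)%E -> (total M' <= m)%E -> (m <= 1)%E ->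
    crel m M M'
| RLe m M M' : (forall phi, nonneg phi -> (minf phi [::] M <= minf phi [::] M')%E) ->
    (total M <= m)%E -> (total M' <= m)%E -> (m <= 1)%E -> crel m M M'
| RSum m p mk Ms Ms' M M' : (forall k, 0 <= p k) ->
    (forall k, p k != 0 -> crel (mk k) (Ms k) (Ms' k)) -> (psum p mk <= m)%E -> (m <= 1)%E ->
    (total M <= m)%E -> (total M' <= m)%E ->
    above p Ms M -> below p Ms M -> below p Ms' M' -> crel m M M'
| RSubst m sg sg' M M' : crel m M M' -> (forall x, crel 1%E (sg x) (sg' x)) ->
    crel m (msub sg M) (msub sg' M')
| RApps m s s' M M' : crel m M M' -> size s = size s' ->
    (forall i, crel 1%E (nth dzero s i) (nth dzero s' i)) -> crel m (dapps M s) (dapps M' s')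
| RAbs m A A' : abs_dist A -> abs_dist A' -> (total A <= total A')%E ->
    crel (total A') (body A) (body A') -> (total A' <= m)%E -> (m <= 1)%E -> crel m A A'.

Lemma run_apps n Phi s s' t : (forall n, nonneg (Phi n)) ->
  run n Phi s' (apps t s) = run n Phi (s ++ s') t.
Proof.
move=> H; elim: s t => [//|N s IH] t; rewrite [apps _ _]/= -/(apps _ s) IH run_app.
by rewrite mrun_dpoint.
Qed.

Lemma mrun_dapps n Phi s M : (forall n, nonneg (Phi n)) ->
  mrun n Phi [::] (dapps M s) = mrun n Phi s M.
Proof.
by move=> H; rewrite /mrun expect_dmap; apply: expect_eq => i _ /=; rewrite run_apps// cats0.
Qed.

Lemma minf_dapps phi s M : nonneg phi -> minf phi [::] (dapps M s) = minf phi s M.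
Proof.
move=> H; rewrite /minf expect_dmap; apply: expect_eq => i _ /=; rewrite /rinf.
have -> // : (fun n => run n (fun=> phi) [::] (apps (elt M i) s)) =
          (fun n => run n (fun=> phi) s (elt M i)).
by apply: funext => n; rewrite run_apps// cats0.
Qed.

Lemma total_msub sg M : (total (msub sg M) <= total M)%E.
Proof. exact: mix_le. Qed.

Lemma crel_bounds m M M' : crel m M M' -> [/\ (total M <= m)%E, (total M' <= m)%E & (m <= 1)%E].
Proof.
elim=> {m M M'} //.
- by move=> m sg sg' M M' _ [h1 h2 h3] _ _; split=> //; apply: le_trans (total_msub _ _) _.
- by move=> m A A' _ _ AA' _ _ A'm m1; split=> //; apply: le_trans AA' _.
Qed.

Lemma crel_ge0 m M M' : crel m M M' -> (0 <= m)%E.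
Proof. by move=> /crel_bounds[h _ _]; apply: le_trans h; exact: total_ge0. Qed.

Lemma crel_refl M : crel 1%E M M.
Proof. by apply: RLe => //; exact: total_le1. Qed.

Lemma total_dzero : total (@dzero K) = 0%E.
Proof. by rewrite totalE expect_dzero. Qed.

Lemma crel_dzero : crel 0%E dzero dzero.
Proof. by apply: RLe => //; rewrite ?total_dzero// lee01. Qed.

(** A sum with a single summand: [RSum] also serves to exchange programs for others that evaluate
    suitably. *)
Lemma crel_conv m m' M1 M1' M M' : crel m' M1 M1' -> (m' <= m)%E -> (m <= 1)%E ->
  (total M <= m)%E -> (total M' <= m)%E ->
  (forall n Phi, (forall n, nonneg (Phi n)) -> nondecr Phi ->
    mrun n Phi [::] M <= mrun n Phi [::] M1)%E ->
  (forall phi, nonneg phi -> minf phi [::] M1 <= minf phi [::] M)%E ->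
  (forall phi, nonneg phi -> minf phi [::] M1' <= minf phi [::] M')%E ->
  crel m M M'.
Proof.
move=> r mm m1 t t' h1 h2 h3.
apply: (@RSum m delta0 (fun=> m') (fun=> M1) (fun=> M1')) => //.
- by rewrite psum_delta0//; exact: crel_ge0 r.
- by move=> n Phi H mon; rewrite psum_delta0 ?h1//; exact: mrun_ge0.
- by move=> phi H; rewrite psum_delta0 ?h2//; exact: minf_ge0.
- by move=> phi H; rewrite psum_delta0 ?h3//; exact: minf_ge0.
Qed.

Lemma crel_cn m m' M1 M1' M M' : crel m' M1 M1' -> (m' <= m)%E -> (m <= 1)%E ->
  cn M = cn M1 -> cn M' = cn M1' -> crel m M M'.
Proof.
move=> r mm m1 e e'; have [b1 b2 _] := crel_bounds r.
have tE N N' : cn N = cn N' -> total N = total N'.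
  by move=> E; rewrite !totalE; have /cnP/(_ (fun=> 1%E)) := E; apply.
apply: (crel_conv r mm m1).
- by rewrite (tE _ _ e); exact: le_trans mm.
- by rewrite (tE _ _ e'); exact: le_trans mm.
- by move=> n Phi H _; rewrite (mrun_cong n H (erefl _) e).
- by move=> phi H; rewrite (minf_cong H (erefl _) e).
- by move=> phi H; rewrite (minf_cong H (erefl _) e').
Qed.

Lemma crel_rename r m M M' : crel m M M' -> crel m (dmap (rename r) M) (dmap (rename r) M').
Proof.
move=> h; have [_ _ m1] := crel_bounds h.
apply: (@crel_cn m m (msub (fun x => vars (r x)) M) (msub (fun x => vars (r x)) M')) => //.
- by apply: RSubst => // x; exact: crel_refl.
- by rewrite msub_vars.
- by rewrite msub_vars.
Qed.

Definition args_rel s s' : Prop :=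
  size s = size s' /\ forall i, crel 1%E (nth dzero s i) (nth dzero s' i).

Lemma args_rel_cat s1 s1' s2 s2' : args_rel s1 s1' -> args_rel s2 s2' ->
  args_rel (s1 ++ s2) (s1' ++ s2').
Proof.
move=> [e r] [e' r']; split=> [|i]; first by rewrite !size_cat e e'.
by rewrite !nth_cat -e; case: ifP.
Qed.

(** A coupling of open applications: each entry has one head and the arguments on either side; [lo]
    and [ro] observe its two marginals. *)
Notation opens := (dist K (nat * (seq (prog K) * seq (prog K)))).
Definition lo phi (w : nat * (seq (prog K) * seq (prog K))) : \bar K := to phi w.1 (map cn w.2.1).
Definition ro phi (w : nat * (seq (prog K) * seq (prog K))) : \bar K := to phi w.1 (map cn w.2.2).

Definition opens_rel (W : opens) : Prop :=
  forall i, wt W i != 0 -> args_rel (elt W i).2.1 (elt W i).2.2.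

(** All that a test sees of a family of abstractions: their total weight [a] and the weighted sum
    [B] of their bodies. *)
Definition aval phi (a : \bar K) B : \bar K := (a * ta phi + expect (tb phi \o nrm) B)%E.
Definition lval phi a B (W : opens) : \bar K := (aval phi a B + expect (lo phi) W)%E.
Definition rval phi a B (W : opens) : \bar K := (aval phi a B + expect (ro phi) W)%E.

Lemma lo_ge0 phi w : nonneg phi -> (0 <= lo phi w)%E. Proof. by case=> _ _ h; exact: h. Qed.
Lemma ro_ge0 phi w : nonneg phi -> (0 <= ro phi w)%E. Proof. by case=> _ _ h; exact: h. Qed.
Lemma tbnrm_ge0 phi u : nonneg phi -> (0 <= (tb phi \o nrm) u)%E.
Proof. by case=> _ h _; exact: h. Qed.
Lemma aval_ge0 phi a B : nonneg phi -> (0 <= a)%E -> (0 <= aval phi a B)%E.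
Proof.
move=> H a0; rewrite adde_ge0 ?mule_ge0//; first by case: H.
by apply: expect_ge0 => u; exact: tbnrm_ge0.
Qed.
Lemma elo_ge0 phi (W : opens) : nonneg phi -> (0 <= expect (lo phi) W)%E.
Proof. by move=> H; apply: expect_ge0 => w; exact: lo_ge0. Qed.
Lemma ero_ge0 phi (W : opens) : nonneg phi -> (0 <= expect (ro phi) W)%E.
Proof. by move=> H; apply: expect_ge0 => w; exact: ro_ge0. Qed.
Lemma lval_ge0 phi a B W : nonneg phi -> (0 <= a)%E -> (0 <= lval phi a B W)%E.
Proof. by move=> H a0; rewrite adde_ge0 ?aval_ge0 ?elo_ge0. Qed.
Lemma rval_ge0 phi a B W : nonneg phi -> (0 <= a)%E -> (0 <= rval phi a B W)%E.
Proof. by move=> H a0; rewrite adde_ge0 ?aval_ge0 ?ero_ge0. Qed.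

Definition delay n Phi M : \bar K := if n is n'.+1 then mrun n' Phi [::] M else 0%E.

Lemma delay_ge0 n Phi M : (forall n, nonneg (Phi n)) -> (0 <= delay n Phi M)%E.
Proof. by case: n => // n H; exact: mrun_ge0. Qed.

(** Primes mark the right side. [ra] is the weight of the abstractions found, [rB] the sum of their
    bodies, [rw] the coupling of open applications, [rD] the residual; [rb] and [rd] are the indices
    at which bodies and residuals are related. *)
Record rdata := RData {
  ra : \bar K; ra' : \bar K; rb : \bar K; rB : prog K; rB' : prog K;
  rw : opens; rd : \bar K; rD : prog K; rD' : prog K }.

(* One round of evaluation of a pair of programs: the normal forms that are
   found, and a related pair D, D' still to be evaluated.  On the left, D has
   one beta step less left. *)
Record round_spec m (L : nat -> (nat -> @test K) -> \bar K) (l r : @test K -> \bar K)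
    (x : rdata) : Prop := RoundSpec {
  r_a0 : (0 <= ra x)%E;
  r_aa' : (ra x <= ra' x)%E;
  r_ba' : (rb x <= ra' x)%E;
  r_B : crel (rb x) (rB x) (rB' x);
  r_w : opens_rel (rw x);
  r_D : crel (rd x) (rD x) (rD' x);
  r_m : (ra' x + total (rw x) + rd x <= m)%E;
  r_L : forall n Phi, (forall n, nonneg (Phi n)) -> nondecr Phi ->
    (L n Phi <= lval (Phi n) (ra x) (rB x) (rw x) + delay n Phi (rD x))%E;
  r_l : forall phi, nonneg phi ->
    (lval phi (ra x) (rB x) (rw x) + minf phi [::] (rD x) <= l phi)%E;
  r_r : forall phi, nonneg phi ->
    (rval phi (ra' x) (rB' x) (rw x) + minf phi [::] (rD' x) <= r phi)%E }.

Definition round m L l r : Prop := exists x, round_spec m L l r x.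

Lemma r_a'0 m L l r x : round_spec m L l r x -> (0 <= ra' x)%E.
Proof. by case=> h1 h2 *; exact: le_trans h2. Qed.

Lemma round_mono m m' L L' l l' r r' : round m L l r -> (m <= m')%E ->
  (forall n Phi, (forall n, nonneg (Phi n)) -> nondecr Phi -> L' n Phi <= L n Phi)%E ->
  (forall phi, nonneg phi -> l phi <= l' phi)%E ->
  (forall phi, nonneg phi -> r phi <= r' phi)%E -> round m' L' l' r'.
Proof.
move=> [x [h1 h2 h3 h4 h5 h6 h7 h8 h9 h10]] mm LL ll rr; exists x; split=> //.
- exact: le_trans mm.
- by move=> n Phi H mon; apply: le_trans (LL n Phi H mon) _; exact: h8.
- by move=> phi H; apply: le_trans (ll phi H); exact: h9.
- by move=> phi H; apply: le_trans (rr phi H); exact: h10.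
Qed.

Definition rzero : rdata := RData 0%E 0%E 0%E dzero dzero (Dist zerop (fun=> (0%N, ([::], [::]))))
  0%E dzero dzero.

Lemma minf_dzero phi s : minf phi s dzero = 0%E.
Proof. exact: expect_dzero. Qed.

Lemma mrun_dzero n Phi s : mrun n Phi s dzero = 0%E.
Proof. exact: expect_dzero. Qed.

Lemma delay_dzero n Phi : delay n Phi dzero = 0%E.
Proof. by case: n => // n; exact: mrun_dzero. Qed.

Lemma expect_zerop T (f : nat -> T) (h : T -> \bar K) : expect h (Dist (@zerop K) f) = 0%E.
Proof. by apply: eseries0 => i _ _ /=; rewrite mul0e. Qed.

Lemma total_zerop T (f : nat -> T) : total (Dist (@zerop K) f) = 0%E.
Proof. by rewrite totalE expect_zerop. Qed.

Lemma round_open (W : opens) : opens_rel W ->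
  round (total W) (fun n Phi => expect (lo (Phi n)) W) (fun phi => expect (lo phi) W)
    (fun phi => expect (ro phi) W).
Proof.
move=> h; exists (RData 0%E 0%E 0%E dzero dzero W 0%E dzero dzero); split=> //=.
- exact: crel_dzero.
- exact: crel_dzero.
- by rewrite add0e adde0.
- by move=> n Phi H mon; rewrite delay_dzero /lval /aval mul0e expect_dzero !add0e adde0.
- by move=> phi H; rewrite minf_dzero /lval /aval mul0e expect_dzero !add0e adde0.
- by move=> phi H; rewrite minf_dzero /rval /aval mul0e expect_dzero !add0e adde0.
Qed.

Lemma round_delay d D D' : crel d D D' ->
  round d (fun n Phi => delay n Phi D) (fun phi => minf phi [::] D) (fun phi => minf phi [::] D').
Proof.
move=> h; exists (RData 0%E 0%E 0%E dzero dzero (rw rzero) d D D'); split=> //=.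
- exact: crel_dzero.
- by move=> i; rewrite eqxx.
- by rewrite total_zerop !add0e.
- by move=> n Phi H mon; rewrite /lval /aval mul0e expect_dzero expect_zerop !add0e.
- by move=> phi H; rewrite /lval /aval mul0e expect_dzero expect_zerop !add0e.
- by move=> phi H; rewrite /rval /aval mul0e expect_dzero expect_zerop !add0e.
Qed.

Lemma round_abs a a' b B B' : (0 <= a)%E -> (a <= a')%E -> (b <= a')%E -> crel b B B' ->
  round a' (fun n Phi => aval (Phi n) a B) (fun phi => aval phi a B) (fun phi => aval phi a' B').
Proof.
move=> a0 aa' ba' h; exists (RData a a' b B B' (rw rzero) 0%E dzero dzero); split=> //=.
- by move=> i; rewrite eqxx.
- exact: crel_dzero.
- by rewrite total_zerop !adde0.
- by move=> n Phi H mon; rewrite delay_dzero /lval expect_zerop !adde0.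
- by move=> phi H; rewrite minf_dzero /lval expect_zerop !adde0.
- by move=> phi H; rewrite minf_dzero /rval expect_zerop !adde0.
Qed.

End Closure.

(** * Weighted sums of rounds *)

Section Rounds.
Context {K : realType}.
Variable base : prog K -> prog K -> Prop.
Implicit Types (t u : term K) (M N B : prog K) (s : seq (prog K)) (m : \bar K).
Implicit Types (Phi : nat -> @test K).
Notation crel := (crel base).
Notation round := (round base).
Notation round_spec := (round_spec base).
Notation args_rel := (args_rel base).
Notation opens_rel := (opens_rel base).
Notation opens := (dist K (nat * (seq (prog K) * seq (prog K)))).

Lemma total_psum T p (F : nat -> dist K T) (M : dist K T) :
  (forall phi, (forall v, 0 <= phi v)%E -> expect phi M = psum p (fun k => expect phi (F k))) ->
  total M = psum p (fun k => total (F k)).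
Proof. by move=> e; rewrite totalE e//; apply: psum_eq => k _; rewrite totalE. Qed.

Lemma crel_psum p bk Bk Bk' b B B' : (forall k, 0 <= p k) ->
  (forall k, p k != 0 -> crel (bk k) (Bk k) (Bk' k)) -> (psum p bk <= b)%E -> (b <= 1)%E ->
  (forall phi, (forall t, 0 <= phi t)%E -> expect phi B = psum p (fun k => expect phi (Bk k))) ->
  (forall phi, (forall t, 0 <= phi t)%E -> expect phi B' = psum p (fun k => expect phi (Bk' k))) ->
  crel b B B'.
Proof.
move=> p0 h bb b1 e e'; apply: (@RSum _ _ b p bk Bk Bk') => //.
- rewrite (total_psum e); apply: le_trans bb; apply: psum_le => // k pk.
    exact: total_ge0.
  by have [] := crel_bounds (h k pk).
- rewrite (total_psum e'); apply: le_trans bb; apply: psum_le => // k pk.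
    exact: total_ge0.
  by have [] := crel_bounds (h k pk).
- by move=> n Phi H mon; rewrite /mrun e// => t; exact: run_ge0.
- by move=> phi H; rewrite [leRHS]/minf e// => t; exact: rinf_ge0.
- by move=> phi H; rewrite [leRHS]/minf e'// => t; exact: rinf_ge0.
Qed.

Section Sum.
Variables (p : nat -> K) (x : nat -> @rdata K) (mk : nat -> \bar K).
Variables (Lk : nat -> nat -> (nat -> @test K) -> \bar K) (lk rk : nat -> @test K -> \bar K).
Hypothesis p0 : forall k, 0 <= p k.
Hypothesis xk : forall k, p k != 0 -> round_spec (mk k) (Lk k) (lk k) (rk k) (x k).

(** Where the weight vanishes [x k] is arbitrary, so it is replaced by data that are zero. *)
Let z k : rdata := if p k == 0 then rzero else x k.
Let z_a0 k : (0 <= ra (z k))%E.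
Proof. by rewrite /z; case: eqP => //= /eqP /xk[]. Qed.
Let z_a'0 k : (0 <= ra' (z k))%E.
Proof. by rewrite /z; case: eqP => //= /eqP /xk h; exact: r_a'0 h. Qed.
Let z_d0 k : (0 <= rd (z k))%E.
Proof. by rewrite /z; case: eqP => //= /eqP /xk h; exact: crel_ge0 (r_D h). Qed.
Let z_b0 k : (0 <= rb (z k))%E.
Proof. by rewrite /z; case: eqP => //= /eqP /xk h; exact: crel_ge0 (r_B h). Qed.

(** All components are added with the weights [p]. The mass condition [r_m], together with [r_ba']
    for the bodies, bounds each of these sums by 1, so that they exist as programs. *)
Lemma round_sum_aux m L l r : (psum p mk <= m)%E -> (m <= 1)%E ->
  (forall n Phi, (forall n, nonneg (Phi n)) -> nondecr Phi ->
     L n Phi <= psum p (fun k => Lk k n Phi))%E ->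
  (forall phi, nonneg phi -> psum p (fun k => lk k phi) <= l phi)%E ->
  (forall phi, nonneg phi -> psum p (fun k => rk k phi) <= r phi)%E ->
  (forall k n Phi, (forall n, nonneg (Phi n)) -> p k != 0 -> (0 <= Lk k n Phi)%E) ->
  round m L l r.
Proof.
move=> mm m1 LL ll rr L0.
have w0 k : (0 <= total (rw (z k)))%E by exact: total_ge0.
have zp k : p k != 0 -> z k = x k by rewrite /z => /negbTE ->.
have mass : (psum p (fun k => ra' (z k)) + psum p (fun k => total (rw (z k))) +
    psum p (fun k => rd (z k)) <= m)%E.
  rewrite -!psumD//; last by move=> k; rewrite adde_ge0.
  apply: le_trans mm; apply: psum_le => // k pk; first by rewrite !adde_ge0.
  by rewrite zp//; exact: r_m (xk pk).
have a'0 := psum_ge0 p0 z_a'0; have d0 := psum_ge0 p0 z_d0; have ww0 := psum_ge0 p0 w0.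
have a'm : (psum p (fun k => ra' (z k)) <= m)%E.
  by apply: le_trans mass; rewrite -addeA leeDl// adde_ge0.
have wm : (psum p (fun k => total (rw (z k))) <= m)%E.
  by apply: le_trans mass; rewrite addeAC leeDr// adde_ge0.
have dm : (psum p (fun k => rd (z k)) <= m)%E.
  by apply: le_trans mass; rewrite leeDr// adde_ge0.
have ba' : (psum p (fun k => rb (z k)) <= psum p (fun k => ra' (z k)))%E.
  by apply: psum_le => // k pk; rewrite zp//; exact: r_ba' (xk pk).
have sub (F : rdata -> prog K) (c : rdata -> \bar K) : (psum p (fun k => c (z k)) <= m)%E ->
    (forall k, p k != 0 -> (total (F (x k)) <= c (x k))%E) ->
    exists M, forall phi, (forall t, 0 <= phi t)%E ->
      expect phi M = psum p (fun k => expect phi (F (z k))).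
  move=> cm h; apply: wsum_ex => //; first exact: (Var 0).
  apply: le_trans m1; apply: le_trans cm; apply: psum_le => // k pk; first exact: total_ge0.
  by rewrite zp//; exact: h.
have bm := le_trans ba' a'm.
have [BB hB] : exists M, forall phi, (forall t, 0 <= phi t)%E ->
      expect phi M = psum p (fun k => expect phi (rB (z k))).
  by apply: (sub rB rb) => // k pk; have [] := crel_bounds (r_B (xk pk)).
have [BB' hB'] : exists M, forall phi, (forall t, 0 <= phi t)%E ->
      expect phi M = psum p (fun k => expect phi (rB' (z k))).
  by apply: (sub rB' rb) => // k pk; have [] := crel_bounds (r_B (xk pk)).
have [DD hD] : exists M, forall phi, (forall t, 0 <= phi t)%E ->
      expect phi M = psum p (fun k => expect phi (rD (z k))).
  by apply: (sub rD rd) => // k pk; have [] := crel_bounds (r_D (xk pk)).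
have [DD' hD'] : exists M, forall phi, (forall t, 0 <= phi t)%E ->
      expect phi M = psum p (fun k => expect phi (rD' (z k))).
  by apply: (sub rD' rd) => // k pk; have [] := crel_bounds (r_D (xk pk)).
have [W hW] : exists W : opens, forall phi, (forall v, 0 <= phi v)%E ->
      expect phi W = psum p (fun k => expect phi (rw (z k))).
  apply: wsum_ex => //; first exact: (0%N, ([::], [::])).
  exact: le_trans m1.
have tbn phi u : nonneg phi -> (0 <= (tb phi \o nrm) u)%E by exact: tbnrm_ge0.
have avalE phi B f : nonneg phi -> (forall k, 0 <= f (z k))%E ->
   forall F, (forall phi, (forall t, 0 <= phi t)%E -> expect phi B = psum p (fun k => expect phi (F (z k)))) ->
   aval phi (psum p (fun k => f (z k))) B = psum p (fun k => aval phi (f (z k)) (F (z k))).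
  move=> H f0 F hF; rewrite /aval hF; last by move=> u; exact: tbn.
  have ta0 : (0 <= ta phi)%E by case: H.
  rewrite -psumZ// -psumD// => k; first by rewrite mule_ge0.
  by apply: expect_ge0 => u; exact: tbn.
have lvalE phi : nonneg phi -> lval phi (psum p (fun k => ra (z k))) BB W =
    psum p (fun k => lval phi (ra (z k)) (rB (z k)) (rw (z k))).
  move=> H; rewrite /lval (avalE phi BB ra H z_a0 rB hB) hW; last by move=> w; exact: lo_ge0.
  by rewrite -psumD// => k; [exact: aval_ge0|exact: elo_ge0].
have rvalE phi : nonneg phi -> rval phi (psum p (fun k => ra' (z k))) BB' W =
    psum p (fun k => rval phi (ra' (z k)) (rB' (z k)) (rw (z k))).
  move=> H; rewrite /rval (avalE phi BB' ra' H z_a'0 rB' hB') hW; last by move=> w; exact: ro_ge0.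
  by rewrite -psumD// => k; [exact: aval_ge0|exact: ero_ge0].
exists (RData (psum p (fun k => ra (z k))) (psum p (fun k => ra' (z k)))
  (psum p (fun k => rb (z k))) BB BB' W (psum p (fun k => rd (z k))) DD DD'); split=> /=.
- exact: psum_ge0.
- by apply: psum_le => // k pk; rewrite zp//; exact: r_aa' (xk pk).
- exact: ba'.
- apply: (crel_psum p0 _ (lexx _) (le_trans bm m1) hB hB') => k pk.
  by rewrite zp//; exact: r_B (xk pk).
- apply: (@wsum_supp _ _ p _ W (fun w => args_rel w.2.1 w.2.2) hW) => k pk i; rewrite zp//; exact: r_w (xk pk) i.
- apply: (crel_psum p0 _ (lexx _) (le_trans dm m1) hD hD') => k pk.
  by rewrite zp//; exact: r_D (xk pk).
- by rewrite (total_psum hW).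
- move=> n Phi H mon; apply: le_trans (LL n Phi H mon) _.
  have -> : delay n Phi DD = psum p (fun k => delay n Phi (rD (z k))).
    case: n => [|n]; first by rewrite psum0.
    by rewrite /delay /mrun hD// => t; exact: run_ge0.
  rewrite lvalE// -psumD//; last 2 first.
  + by move=> k; exact: lval_ge0.
  + by move=> k; exact: delay_ge0.
  apply: psum_le => // k pk; first exact: L0.
  by rewrite zp//; exact: r_L (xk pk) _ _ _ _.
- move=> phi H; apply: le_trans (ll phi H).
  have -> : minf phi [::] DD = psum p (fun k => minf phi [::] (rD (z k))).
    by rewrite /minf hD// => t; exact: rinf_ge0.
  rewrite lvalE// -psumD//; last 2 first.
  + by move=> k; exact: lval_ge0.
  + by move=> k; exact: minf_ge0.
  apply: psum_le => // k pk; first by rewrite adde_ge0 ?lval_ge0 ?minf_ge0.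
  by rewrite zp//; exact: r_l (xk pk) _ _.
- move=> phi H; apply: le_trans (rr phi H).
  have -> : minf phi [::] DD' = psum p (fun k => minf phi [::] (rD' (z k))).
    by rewrite /minf hD'// => t; exact: rinf_ge0.
  rewrite rvalE// -psumD//; last 2 first.
  + by move=> k; exact: rval_ge0.
  + by move=> k; exact: minf_ge0.
  apply: psum_le => // k pk; first by rewrite adde_ge0 ?rval_ge0 ?minf_ge0.
  by rewrite zp//; exact: r_r (xk pk) _ _.
Qed.

End Sum.

Lemma round_sum p mk Lk lk rk m L l r : (forall k, 0 <= p k) ->
  (forall k, p k != 0 -> round (mk k) (Lk k) (lk k) (rk k)) ->
  (psum p mk <= m)%E -> (m <= 1)%E ->
  (forall n Phi, (forall n, nonneg (Phi n)) -> nondecr Phi ->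
     L n Phi <= psum p (fun k => Lk k n Phi))%E ->
  (forall phi, nonneg phi -> psum p (fun k => lk k phi) <= l phi)%E ->
  (forall phi, nonneg phi -> psum p (fun k => rk k phi) <= r phi)%E ->
  (forall k n Phi, (forall n, nonneg (Phi n)) -> p k != 0 -> (0 <= Lk k n Phi)%E) ->
  round m L l r.
Proof.
move=> p0 h; have /choice[x hx] : forall k, exists x, p k != 0 ->
    round_spec (mk k) (Lk k) (lk k) (rk k) x.
  move=> k; have [pk|/h[x hx]] := eqVneq (p k) 0; last by exists x.
  by exists rzero.
exact: (round_sum_aux p0 hx).
Qed.

Lemma round_add m1 m2 L1 L2 l1 l2 r1 r2 m L l r :
  round m1 L1 l1 r1 -> round m2 L2 l2 r2 ->
  (0 <= m1)%E -> (0 <= m2)%E -> (m1 + m2 <= m)%E -> (m <= 1)%E ->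
  (forall n Phi, (forall n, nonneg (Phi n)) -> nondecr Phi -> L n Phi <= L1 n Phi + L2 n Phi)%E ->
  (forall phi, nonneg phi -> l1 phi + l2 phi <= l phi)%E ->
  (forall phi, nonneg phi -> r1 phi + r2 phi <= r phi)%E ->
  (forall n Phi, (forall n, nonneg (Phi n)) -> 0 <= L1 n Phi)%E ->
  (forall n Phi, (forall n, nonneg (Phi n)) -> 0 <= L2 n Phi)%E ->
  (forall phi, nonneg phi -> 0 <= l1 phi)%E ->
  (forall phi, nonneg phi -> 0 <= l2 phi)%E ->
  (forall phi, nonneg phi -> 0 <= r1 phi)%E ->
  (forall phi, nonneg phi -> 0 <= r2 phi)%E ->
  round m L l r.
Proof.
move=> R1 R2 m10 m20 mm m1' LL ll rr L10 L20 l10 l20 r10 r20.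
apply: (@round_sum pair_wt (fun k => if k is 0%N then m1 else m2)
  (fun k => if k is 0%N then L1 else L2) (fun k => if k is 0%N then l1 else l2)
  (fun k => if k is 0%N then r1 else r2)) => //.
- by case.
- by rewrite psum_pair.
- move=> n Phi H mon; apply: le_trans (LL n Phi H mon) _.
  rewrite -psum_pair ?L10 ?L20//; by apply: psum_le => // -[|k] _; rewrite ?L10 ?L20.
- move=> phi H; apply: le_trans (ll phi H); rewrite -psum_pair ?l10 ?l20//.
  by apply: psum_le => // -[|k] _; rewrite ?l10 ?l20.
- move=> phi H; apply: le_trans (rr phi H); rewrite -psum_pair ?r10 ?r20//.
  by apply: psum_le => // -[|k] _; rewrite ?r10 ?r20.
- by move=> [|k] n Phi H _; [exact: L10|exact: L20].
Qed.

End Rounds.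

(** * Normal forms of related programs, and rounds under a stack *)

Section Evaluation.
Context {K : realType}.
Variable base : prog K -> prog K -> Prop.
Implicit Types (t u : term K) (M N B : prog K) (s : seq (prog K)) (m : \bar K).
Implicit Types (Phi : nat -> @test K).
Notation crel := (crel base).
Notation round := (round base).
Notation round_spec := (round_spec base).
Notation args_rel := (args_rel base).
Notation opens_rel := (opens_rel base).
Notation opens := (dist K (nat * (seq (prog K) * seq (prog K)))).

Lemma expect_body phi M : (forall t, 0 <= phi t)%E ->
  expect phi (body M) = expect (fun t => if t is Lam B then expect phi B else 0%E) M.
Proof.
move=> p0; rewrite expect_bind//; apply: expect_eq => i _.
by case: (elt M i) => *; rewrite ?expect_dzero.
Qed.

(* A coupling [W] of the open applications, and one pair for all abstractions;
   on the left the description of the normal forms is exact. *)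
Definition progress M M' : Prop := exists a a' b B B' (W : opens),
  [/\ (0 <= a)%E, (a <= a')%E, (b <= a')%E & crel b B B'] /\
  [/\ opens_rel W,
      (forall phi, nonneg phi -> minf phi [::] M = lval phi a B W)
    & (forall phi, nonneg phi -> (rval phi a' B' W <= minf phi [::] M')%E)].

Definition absmass M : \bar K := expect (fun t => if is_abs t then 1%E else 0%E) M.

Definition diag_opens M : opens :=
  dbind M (fun t => if open_app t is Some (x, Ms) then dpoint (x, (Ms, Ms))
                    else Dist zerop (fun=> (0%N, ([::], [::])))).

Lemma absmass_le1 M : (absmass M <= 1)%E.
Proof.
apply: le_trans (total_le1 M); apply: expect_le_total => t.
by case: ifP; rewrite ?lexx ?lee01.
Qed.

Lemma total_body M : (total (body M) <= absmass M)%E.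
Proof.
rewrite totalE expect_body//; apply: expect_le => [t|i _].
  by case: t => // B; exact: expect_ge0.
by case: (elt M i) => //= B; rewrite -totalE total_le1.
Qed.

Lemma expect_obs_whnf phi M : nonneg phi ->
  (forall i, wt M i != 0 -> is_whnf (elt M i)) ->
  expect (obs phi) M = lval phi (absmass M) (body M) (diag_opens M).
Proof.
move=> H nf; rewrite /lval /aval.
have tb0 u : (0 <= (tb phi \o nrm) u)%E by exact: tbnrm_ge0.
have ta0 : (0 <= ta phi)%E by case: H.
have lo0 w : (0 <= lo phi w)%E by exact: lo_ge0.
have if0 t : (0 <= (if is_abs t then 1%E else 0%E) :> \bar K)%E by case: ifP.
rewrite muleC -expectZ// expect_body// expect_bind// -expectD; last 2 first.
- by move=> t; rewrite mule_ge0.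
- by case=> // B; exact: expect_ge0.
rewrite -expectD; last 2 first.
- move=> t; rewrite adde_ge0 ?mule_ge0//; case: t => // B; exact: expect_ge0.
- by move=> t; case: open_app => [[x Ms]|]; exact: expect_ge0.
apply: expect_eq => i /nf; rewrite /is_whnf /is_open.
case e : (open_app (elt M i)) => [[x Ms]|].
  rewrite (obs_open H e) expect_dpoint// => _.
  by case: (elt M i) e => [y|B|F N] // e; rewrite mule0 !add0e.
rewrite orbF expect_zerop adde0; case: (elt M i) => // B _.
by rewrite /obs run_lam mule1.
Qed.

Lemma diag_opens_rel M : opens_rel (diag_opens M).
Proof.
apply: (@wsum_supp _ _ (wt M) (fun i => if open_app (elt M i) is Some (x, Ms)
   then dpoint (x, (Ms, Ms)) else Dist zerop (fun=> (0%N, ([::], [::]))))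
   _ (fun w => args_rel w.2.1 w.2.2)).
  by move=> phi p0; rewrite expect_bind.
move=> k _ i; case: open_app => [[x Ms] _|] /=; last by rewrite eqxx.
by split=> // j; exact: crel_refl.
Qed.

Lemma expect_ro_diag phi M : nonneg phi ->
  expect (ro phi) (diag_opens M) = expect (lo phi) (diag_opens M).
Proof.
have lo0 w : nonneg phi -> (0 <= lo phi w)%E by exact: lo_ge0.
have ro0 w : nonneg phi -> (0 <= ro phi w)%E by exact: ro_ge0.
move=> H; rewrite expect_bind; last by move=> w; exact: ro0.
rewrite expect_bind; last by move=> w; exact: lo0.
apply: expect_eq => i _; case: open_app => [[x Ms]|]; last by rewrite !expect_zerop.
rewrite expect_dpoint; last by move=> w; exact: ro0.
by rewrite expect_dpoint // => w; exact: lo0.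
Qed.

Lemma minf_lval phi M : nonneg phi ->
  minf phi [::] M = lval phi (absmass (whnf M)) (body (whnf M)) (diag_opens (whnf M)).
Proof. by move=> H; rewrite minf_whnf// expect_obs_whnf// => i; exact: whnf_nf. Qed.

(** The diagonal works: the normal forms of [M] are paired with themselves, and the hypothesis is
    the inequality required on the right. *)
Lemma progress_le M M' :
  (forall phi, nonneg phi -> (minf phi [::] M <= minf phi [::] M')%E) -> progress M M'.
Proof.
move=> h; set P := whnf M.
have a0 : (0 <= absmass P)%E by apply: expect_ge0 => t; case: ifP.
exists (absmass P), (absmass P), (absmass P), (body P), (body P), (diag_opens P).
split; split=> //.
- by apply: RLe; rewrite ?total_body ?absmass_le1.
- exact: diag_opens_rel.
- by move=> phi H; rewrite minf_lval.
- by move=> phi H; apply: le_trans (h phi H); rewrite minf_lval// /rval expect_ro_diag.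
Qed.

Definition unit_test : @test K := Test 1%E (fun=> 0%E) (fun _ _ => 1%E).
Lemma nonneg_unit : nonneg unit_test. Proof. by split=> //=; rewrite lee01. Qed.

Lemma minf_unit_le s M : (minf unit_test s M <= total M)%E.
Proof.
apply: minf_le_total => [|B|//]; first exact: nonneg_unit.
by rewrite /= [expect _ _]expect0 adde0.
Qed.

Lemma rval_unit a B W : rval unit_test a B W = (a + total W)%E.
Proof. by rewrite /rval /aval /= mule1 [expect _ B]expect0 adde0 totalE. Qed.

Lemma progress_round m M M' : progress M M' -> (total M' <= m)%E -> (m <= 1)%E ->
  round m (fun n Phi => mrun n Phi [::] M) (fun phi => minf phi [::] M)
    (fun phi => minf phi [::] M').
Proof.
move=> [a [a' [b [B [B' [W [[a0 aa' ba' BB'] [hW hl hr]]]]]]]] Mm m1.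
exists (RData a a' b B B' W 0%E dzero dzero); split=> //=.
- exact: crel_dzero.
(* At [unit_test], which counts each normal form once, the inequality for the right program becomes
   a bound on weights. *)
- rewrite adde0 -(rval_unit a' B'); apply: le_trans Mm.
  by apply: le_trans (minf_unit_le [::] _); apply: hr; exact: nonneg_unit.
(* Since [Phi] increases with the fuel, it may be frozen at [Phi n]; dropping the limit on fuel then
   only increases the value. *)
- move=> n Phi H mon; rewrite delay_dzero adde0 -hl//.
  apply: le_trans (mrun_minf n [::] M (H n)); apply: mrun_le => // k kn; exact: mon.
- by move=> phi H; rewrite minf_dzero adde0 -hl.
- by move=> phi H; rewrite minf_dzero adde0 hr.
Qed.

Definition stack_test N s phi : @test K :=
  tstack N s phi (fun u => minf phi s (subst (scons N vars) u)).

Lemma nonneg_psi N s phi : nonneg phi -> nonneg (stack_test N s phi).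
Proof. by move=> H; apply: nonneg_tstack => // u; exact: minf_ge0. Qed.

Lemma stack_below N s phi a B D F (W : opens) g : nonneg phi ->
  (aval (stack_test N s phi) a B +
     expect (fun w => to (stack_test N s phi) w.1 (map cn (g w))) W +
   minf (stack_test N s phi) [::] D <= minf (stack_test N s phi) [::] F)%E ->
  (minf phi [::] (dapps (subst0 B N) s) + minf phi [::] (dapps D (N :: s)) +
   expect (fun w => to phi w.1 (map cn (g w ++ N :: s))) W <= minf phi (N :: s) F)%E.
Proof.
move=> H h; rewrite [leRHS]minf_stackE//; apply: le_trans h.
rewrite !minf_dapps// [X in (_ + X + _)%E]minf_stackE// /aval mule0 add0e addeAC.
have -> : minf phi s (subst0 B N) = expect (tb (stack_test N s phi) \o nrm) B.
  rewrite /minf subst0E expect_bind; last by move=> u; exact: rinf_ge0.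
  by apply: expect_eq => i _ /=; apply: minf_cong => //; rewrite subst_nrmr.
rewrite leeD2r// leeD2l//; apply: expect_le => [w|i _]; first by case: H => _ _; exact.
by rewrite /= map_cat.
Qed.

Section Stack.
Variables (N N' : prog K) (s s' : seq (prog K)).

Lemma expect_beta n Phi B : (forall n, nonneg (Phi n)) ->
  expect (beta_run n Phi N s \o nrm) B = delay n Phi (dapps (subst0 B N) s).
Proof.
move=> H; case: n => [|n]; first exact: expect0.
rewrite /delay mrun_dapps// /mrun subst0E expect_bind; last by move=> u; exact: run_ge0.
by apply: expect_eq => i _ /=; apply: mrun_cong => //; exact: subst_nrmr.
Qed.

(** The abstractions found by the round of [F] meet [N]: this is the beta step that pays for
    [delay]. No abstraction remains, open applications receive [N :: s] as further arguments, and
    [r_ba'] bounds the index of the instantiated bodies. *)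
Lemma round_stack m F F' : crel 1%E N N' -> args_rel s s' -> (m <= 1)%E ->
  round m (fun n Phi => mrun n Phi [::] F) (fun phi => minf phi [::] F)
    (fun phi => minf phi [::] F') ->
  round m (fun n Phi => mrun n Phi (N :: s) F) (fun phi => minf phi (N :: s) F)
    (fun phi => minf phi (N' :: s') F').
Proof.
move=> NN' ss' m1 [x hx]; have a'0 := r_a'0 hx; case: hx => a0 aa' ba' hB hW hD hm hL hl hr.
have b0 := crel_ge0 hB; have d0 := crel_ge0 hD; have w0 := total_ge0 (rw x).
have wbd : (rb x + rd x + total (rw x) <= m)%E.
  by apply: le_trans hm; rewrite addeAC leeD2r// leeD2r.
have bd1 : (rb x + rd x <= 1)%E.
  by apply: le_trans m1; apply: le_trans wbd; rewrite leeDl.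
have Nss' : args_rel (N :: s) (N' :: s').
  by case: ss' => e h; split=> [|[|i]] //=; rewrite ?e.
pose W2 : opens := dmap (fun w => (w.1, (w.2.1 ++ N :: s, w.2.2 ++ N' :: s'))) (rw x).
have hW2 : opens_rel W2 by move=> i /hW h /=; exact: args_rel_cat.
have rB2 : crel (rb x) (dapps (subst0 (rB x) N) s) (dapps (subst0 (rB' x) N') s').
  case: ss' => e h; apply: RApps => //; rewrite !subst0E; apply: RSubst => // -[|i] //=.
  exact: crel_refl.
have rD2 : crel (rd x) (dapps (rD x) (N :: s)) (dapps (rD' x) (N' :: s')).
  by case: Nss' => e h; exact: RApps.
(* The new residual has two parts: the bodies instantiated by [N], on the stack [s], and the old
   residual on the whole stack. *)
pose L n Phi := (delay n Phi (dapps (subst0 (rB x) N) s) + delay n Phi (dapps (rD x) (N :: s)))%E.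
pose l phi := (minf phi [::] (dapps (subst0 (rB x) N) s) + minf phi [::] (dapps (rD x) (N :: s)))%E.
pose r phi := (minf phi [::] (dapps (subst0 (rB' x) N') s') +
               minf phi [::] (dapps (rD' x) (N' :: s')))%E.
have R1 : round (rb x + rd x)%E L l r.
  apply: (round_add (round_delay rB2) (round_delay rD2)) => //.
  1,2: by move=> *; exact: delay_ge0.
  1,2,3,4: by move=> *; exact: minf_ge0.
apply: (round_add R1 (round_open hW2)) => //.
- by rewrite adde_ge0.
- move=> n Phi H mon; set Psi := fun k => tstack N s (Phi k) (beta_run k Phi N s).
  have HP k : nonneg (Psi k).
    by apply: nonneg_tstack => // u; case: k => // k; exact: mrun_ge0.
  have mP : nondecr Psi.
    move=> k j kj; split=> //= [u|y Ms]; last by case: (mon _ _ kj).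
    case: k j kj => [|k] [|j] // kj; first exact: mrun_ge0.
    exact: mrun_homo.
  have -> : mrun n Phi (N :: s) F = mrun n Psi [::] F.
    by apply: expect_eq => i _; rewrite -(run_stack n [::]).
  apply: le_trans (hL n Psi HP mP) _; rewrite /lval /aval mule0 add0e.
  rewrite [X in (X + _ + _)%E](expect_beta n (rB x) H) [leLHS]addeAC /L.
  have -> : delay n Psi (rD x) = delay n Phi (dapps (rD x) (N :: s)).
    case: n => // n; rewrite /delay mrun_dapps//.
    by apply: expect_eq => i _; rewrite -(run_stack n [::]).
  rewrite leeD2l// /W2 expect_dmap; apply: expect_le => [w|i _]; first exact: lo_ge0.
  by rewrite /lo /= map_cat.
- move=> phi H; exact: (@stack_below N s phi (ra x) (rB x) (rD x) F (rw x) (fun w => w.2.1) H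
    (hl _ (nonneg_psi N s H))).
- move=> phi H; exact: (@stack_below N' s' phi (ra' x) (rB' x) (rD' x) F' (rw x) (fun w => w.2.2) H
    (hr _ (nonneg_psi N' s' H))).
- by move=> n Phi H; rewrite adde_ge0 ?delay_ge0.
- by move=> n Phi H; exact: elo_ge0.
- by move=> phi H; rewrite adde_ge0 ?minf_ge0.
- by move=> phi H; exact: elo_ge0.
- by move=> phi H; rewrite adde_ge0 ?minf_ge0.
- by move=> phi H; exact: ero_ge0.
Qed.

End Stack.
End Evaluation.

(** * Rounds under substitution, and their infinite iteration *)

Section Progress.
Context {K : realType}.
Variable base : prog K -> prog K -> Prop.
Implicit Types (t u : term K) (M N B : prog K) (s : seq (prog K)) (m : \bar K).
Implicit Types (Phi : nat -> @test K).
Notation crel := (crel base).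
Notation round := (round base).
Notation round_spec := (round_spec base).
Notation args_rel := (args_rel base).
Notation opens_rel := (opens_rel base).
Notation opens := (dist K (nat * (seq (prog K) * seq (prog K)))).
Notation progress := (progress base).

Definition prog_round m M M' : Prop :=
  round m (fun n Phi => mrun n Phi [::] M) (fun phi => minf phi [::] M)
    (fun phi => minf phi [::] M').

Lemma round_stacks m s s' F F' : args_rel s s' -> (m <= 1)%E -> prog_round m F F' ->
  round m (fun n Phi => mrun n Phi s F) (fun phi => minf phi s F) (fun phi => minf phi s' F').
Proof.
move=> [e h] m1 R; case: s s' e h => [|N s] [|N' s'] //= [e] h.
by apply: round_stack R => //; [exact: (h 0%N)|split=> // i; exact: (h i.+1)].
Qed.

Lemma minf_subst_val sg phi a B D M (W : opens) g : nonneg phi ->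
  (aval (tsubst sg phi (minf phi)) a B +
     expect (fun w => to (tsubst sg phi (minf phi)) w.1 (map cn (g w))) W +
   minf (tsubst sg phi (minf phi)) [::] D <= minf (tsubst sg phi (minf phi)) [::] M)%E ->
  (aval phi a (msub (up sg) B) + minf phi [::] (msub sg D) +
   psum (wt W) (fun k => minf phi (map (msub sg) (g (elt W k))) (sg (elt W k).1))
   <= minf phi [::] (msub sg M))%E.
Proof.
move=> H h; rewrite [leRHS]minf_msubE//; apply: le_trans h.
rewrite minf_msubE// [leRHS]addeAC /aval [in leRHS]expect_tsubst// leeD2l//.
apply: lee_nneseries => k _ => [_|].
  by rewrite mule_ge0 ?lee_fin ?prob_ge0// minf_ge0.
rewrite lee_wpmul2l ?lee_fin ?prob_ge0//= (@minf_cong _ phi _ (map (msub sg) (map cn (g (elt W k)))) _ (sg (elt W k).1))//.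
by rewrite map_cn_msub.
Qed.

(** Bodies and residual are simply substituted. An open application with head [x] is no longer
    normal; evaluation continues with the round of [sg x], put on the stack of its substituted
    arguments. *)
Lemma round_subst m sg sg' M M' : (m <= 1)%E -> (forall x, crel 1%E (sg x) (sg' x)) ->
  (forall x, prog_round 1%E (sg x) (sg' x)) -> prog_round m M M' ->
  prog_round m (msub sg M) (msub sg' M').
Proof.
move=> m1 ss Rs [x hx]; have a'0 := r_a'0 hx.
case: hx => a0 aa' ba' hB hW hD hm hL hl hr.
have b0 := crel_ge0 hB; have d0 := crel_ge0 hD; have w0 := total_ge0 (rw x).
have a'd1 : (ra' x + rd x <= 1)%E.
  by apply: le_trans m1; apply: le_trans hm; rewrite leeD2r// leeDl.
have ups i : crel 1%E (up sg i) (up sg' i).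
  by case: i => [|i] /=; [exact: crel_refl|exact: crel_rename].
have hB2 := RSubst hB ups.
have hD2 := RSubst hD ss.
have RA := round_abs a0 aa' ba' hB2.
have RAD : round (ra' x + rd x)%E
    (fun n Phi => aval (Phi n) (ra x) (msub (up sg) (rB x)) + delay n Phi (msub sg (rD x)))%E
    (fun phi => aval phi (ra x) (msub (up sg) (rB x)) + minf phi [::] (msub sg (rD x)))%E
    (fun phi => aval phi (ra' x) (msub (up sg') (rB' x)) + minf phi [::] (msub sg' (rD' x)))%E.
  apply: (round_add RA (round_delay hD2)) => //.
  - by move=> n Phi H; exact: aval_ge0.
  - by move=> n Phi H; exact: delay_ge0.
  - by move=> phi H; exact: aval_ge0.
  - by move=> phi H; exact: minf_ge0.
  - by move=> phi H; exact: aval_ge0.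
  - by move=> phi H; exact: minf_ge0.
pose LW n Phi := psum (wt (rw x)) (fun k =>
  mrun n Phi (map (msub sg) (elt (rw x) k).2.1) (sg (elt (rw x) k).1)).
pose lW phi := psum (wt (rw x)) (fun k =>
  minf phi (map (msub sg) (elt (rw x) k).2.1) (sg (elt (rw x) k).1)).
pose rW phi := psum (wt (rw x)) (fun k =>
  minf phi (map (msub sg') (elt (rw x) k).2.2) (sg' (elt (rw x) k).1)).
have LW0 n Phi : (forall n, nonneg (Phi n)) -> (0 <= LW n Phi)%E.
  by move=> H; apply: psum_ge0 => k; [exact: prob_ge0|exact: mrun_ge0].
have lW0 phi : nonneg phi -> (0 <= lW phi)%E.
  by move=> H; apply: psum_ge0 => k; [exact: prob_ge0|exact: minf_ge0].
have rW0 phi : nonneg phi -> (0 <= rW phi)%E.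
  by move=> H; apply: psum_ge0 => k; [exact: prob_ge0|exact: minf_ge0].
(* One round per entry of the coupling, added with the weights of the coupling. Each has index 1, so
   the total index is the weight of the coupling. *)
have RW : round (total (rw x)) LW lW rW.
  apply: (@round_sum _ base (wt (rw x)) (fun=> 1%E)
    (fun k n Phi => mrun n Phi (map (msub sg) (elt (rw x) k).2.1) (sg (elt (rw x) k).1))
    (fun k phi => minf phi (map (msub sg) (elt (rw x) k).2.1) (sg (elt (rw x) k).1))
    (fun k phi => minf phi (map (msub sg') (elt (rw x) k).2.2) (sg' (elt (rw x) k).1))) => //.
  - by move=> k; exact: prob_ge0.
  - move=> k wk; apply: round_stacks => //.
    have [e h] := hW k wk; split=> [|i]; first by rewrite !size_map.
    have [lt|ge] := ltnP i (size (elt (rw x) k).2.1).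
      by rewrite !(nth_map dzero) -?e//; apply: RSubst.
    by rewrite !nth_default ?size_map -?e//; exact: crel_refl.
  - by rewrite /psum; under eq_eseriesr do rewrite mule1.
  - exact: total_le1.
  - by move=> k n Phi H _; exact: mrun_ge0.
apply: (round_add RAD RW) => //.
- by rewrite adde_ge0.
- by rewrite addeAC.
- move=> n Phi H mon; set Psi := fun k => tsubst sg (Phi k) (mrun k Phi).
  have HP k : nonneg (Psi k) by apply: nonneg_tsubst => // *; exact: mrun_ge0.
  have mP : nondecr Psi.
    move=> k j kj; have [h1 h2 h3] := mon _ _ kj; split=> //= [u|y Ms].
      by apply: expect_le => [v|i _]; [exact: tbnrm_ge0|exact: h2].
    exact: mrun_homo.
  rewrite (mrun_msub sg n [::])//; apply: le_trans (hL n Psi HP mP) _.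
  rewrite /lval /aval expect_tsubst// [leLHS]addeAC.
  have -> : delay n Psi (rD x) = delay n Phi (msub sg (rD x)).
    by case: n => // n; rewrite /delay (mrun_msub sg n [::]).
  rewrite leeD2l//; apply: lee_nneseries => k _ => [_|].
    by rewrite mule_ge0 ?lee_fin ?prob_ge0// lo_ge0.
  rewrite lee_wpmul2l ?lee_fin ?prob_ge0// /lo /=.
  rewrite (@mrun_cong _ n Phi _ (map (msub sg) (elt (rw x) k).2.1) _ (sg (elt (rw x) k).1))//.
  by rewrite map_cn_msub.
- move=> phi H; have HP : nonneg (tsubst sg phi (minf phi)).
    by apply: nonneg_tsubst => // *; exact: minf_ge0.
  exact: (@minf_subst_val sg phi (ra x) (rB x) (rD x) M (rw x) (fun w => w.2.1) H (hl _ HP)).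
- move=> phi H; have HP : nonneg (tsubst sg' phi (minf phi)).
    by apply: nonneg_tsubst => // *; exact: minf_ge0.
  exact: (@minf_subst_val sg' phi (ra' x) (rB' x) (rD' x) M' (rw x) (fun w => w.2.2) H (hr _ HP)).
- by move=> n Phi H; rewrite adde_ge0 ?aval_ge0 ?delay_ge0.
- by move=> phi H; rewrite adde_ge0 ?aval_ge0 ?minf_ge0.
- by move=> phi H; rewrite adde_ge0 ?aval_ge0 ?minf_ge0.
Qed.

Lemma expect_abs_dist phi A (h : term K -> \bar K) : nonneg phi -> abs_dist A ->
  (forall B, h (Lam B) = ta phi + expect (tb phi \o nrm) B)%E ->
  expect h A = aval phi (total A) (body A).
Proof.
move=> H absA hl; have ta0 : (0 <= ta phi)%E by case: H.
have tb0 u : (0 <= (tb phi \o nrm) u)%E by exact: tbnrm_ge0.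
rewrite /aval expect_body// totalE muleC -expectZ// -expectD//; last first.
- by case=> // B; exact: expect_ge0.
- by move=> t; rewrite mule1.
by apply: expect_eq => i /absA; case: (elt A i) => // B _; rewrite hl mule1.
Qed.

Hypothesis base_progress : forall M M', base M M' -> progress M M'.

Theorem crel_round m M M' : crel m M M' -> prog_round m M M'.
Proof.
elim=> {m M M'}.
- move=> m M M' /base_progress P tM tM' m1; exact: progress_round P _ m1.
- by move=> m M M' le tM tM' m1; apply: progress_round => //; exact: progress_le.
- move=> m p mk Ms Ms' M M' p0 _ IH mm m1 _ _ hab hb hb'.
  apply: (round_sum p0 IH) => //.
  by move=> k n Phi H _; exact: mrun_ge0.
- move=> m sg sg' M M' r IH ss IHs; have [_ _ m1] := crel_bounds r.
  exact: round_subst.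
- move=> m s s' M M' r IH e h _; have [_ _ m1] := crel_bounds r.
  apply: (round_mono (round_stacks (conj e h) m1 IH)) => //.
  + by move=> n Phi H _; rewrite mrun_dapps.
  + by move=> phi H; rewrite minf_dapps.
  + by move=> phi H; rewrite minf_dapps.
- move=> m A A' hA hA' le hb _ A'm m1.
  apply: (round_mono (round_abs (total_ge0 A) le (lexx _) hb)) => //.
  + by move=> n Phi H _; rewrite /mrun (expect_abs_dist (H n) hA)// => B; rewrite run_lam.
  + by move=> phi H; rewrite /minf (expect_abs_dist H hA)// => B; rewrite rinf_lam.
  + by move=> phi H; rewrite /minf (expect_abs_dist H hA')// => B; rewrite rinf_lam.
Qed.

Definition ones (k : nat) : K := 1.

Lemma total_series_psum1 (f : nat -> \bar K) : psum ones f = (\sum_(0 <= k <oo) f k)%E.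
Proof. by apply: eq_eseriesr => k _; rewrite mul1e. Qed.

Theorem crel_progress m M M' : crel m M M' -> progress M M'.
Proof.
move=> r0.
have /choice[F hF] : forall w : \bar K * (prog K * prog K), exists x,
   crel w.1 w.2.1 w.2.2 -> round_spec w.1 (fun n Phi => mrun n Phi [::] w.2.1)
     (fun phi => minf phi [::] w.2.1) (fun phi => minf phi [::] w.2.2) x.
  move=> w; have [/crel_round[x hx]|nr] := pselect (crel w.1 w.2.1 w.2.2).
    by exists x.
  by exists rzero.
pose st := fix st k := if k is k'.+1 then
  let x := F (st k') in (rd x, (rD x, rD' x)) else (m, (M, M')).
have rst k : crel (st k).1 (st k).2.1 (st k).2.2.
  by elim: k => [//|k IH]; exact: r_D (hF _ IH).
pose x k := F (st k).
have hx k := hF _ (rst k).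
have st0 k : (0 <= (st k).1)%E by exact: crel_ge0 (rst k).
have [_ _ m1] := crel_bounds r0.
have one0 k : 0 <= ones k by exact: ler01.
have a0 k : (0 <= ra (x k))%E := r_a0 (hx k).
have a'0 k : (0 <= ra' (x k))%E := r_a'0 (hx k).
have w0 k : (0 <= total (rw (x k)))%E by exact: total_ge0.
(* Each round distributes the index of the current residual among what it finds and the next
   residual, so infinitely many rounds never exceed [m]. *)
have mass n : (\sum_(0 <= k < n) (ra' (x k) + total (rw (x k))) + (st n).1 <= m)%E.
  elim: n => [|n IH]; first by rewrite big_geq// add0e.
  apply: le_trans IH; rewrite big_nat_recr//= -addeA leeD2l//.
  exact: r_m (hx n).
have mass_oo : (psum ones (fun k => ra' (x k) + total (rw (x k)))%E <= m)%E.
  rewrite total_series_psum1; apply: lime_le.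
    by apply: is_cvg_nneseries => k _ _; rewrite adde_ge0.
  by apply: nearW => n; apply: le_trans (mass n); rewrite leeDl.
have a'm : (psum ones (fun k => ra' (x k)) <= m)%E.
  by apply: le_trans mass_oo; apply: psum_le => // k _; rewrite leeDl.
have wm : (psum ones (fun k => total (rw (x k))) <= m)%E.
  by apply: le_trans mass_oo; apply: psum_le => // k _; rewrite leeDr.
have ba' : (psum ones (fun k => rb (x k)) <= psum ones (fun k => ra' (x k)))%E.
  apply: psum_le => // k _; first exact: crel_ge0 (r_B (hx k)).
  exact: r_ba' (hx k).
have b1 := le_trans (le_trans ba' a'm) m1.
have [BB hB] : exists B, forall phi, (forall t, 0 <= phi t)%E ->
    expect phi B = psum ones (fun k => expect phi (rB (x k))).
  apply: wsum_ex => //; first exact: (Var 0).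
  apply: le_trans b1; apply: psum_le => // k _; first exact: total_ge0.
  by have [] := crel_bounds (r_B (hx k)).
have [BB' hB'] : exists B, forall phi, (forall t, 0 <= phi t)%E ->
    expect phi B = psum ones (fun k => expect phi (rB' (x k))).
  apply: wsum_ex => //; first exact: (Var 0).
  apply: le_trans b1; apply: psum_le => // k _; first exact: total_ge0.
  by have [] := crel_bounds (r_B (hx k)).
have [W hW] : exists W : opens, forall phi, (forall v, 0 <= phi v)%E ->
    expect phi W = psum ones (fun k => expect phi (rw (x k))).
  apply: wsum_ex => //; first exact: (0%N, ([::], [::])).
  exact: le_trans m1.
have avalE phi (f : nat -> \bar K) B (G : nat -> prog K) : nonneg phi -> (forall k, 0 <= f k)%E ->
   (forall phi, (forall t, 0 <= phi t)%E -> expect phi B = psum ones (fun k => expect phi (G k))) ->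
   aval phi (psum ones f) B = psum ones (fun k => aval phi (f k) (G k)).
  move=> H f0 hG; rewrite /aval hG; last by move=> u; exact: tbnrm_ge0.
  have ta0 : (0 <= ta phi)%E by case: H.
  rewrite -psumZ// -psumD// => k; first by rewrite mule_ge0.
  by apply: expect_ge0 => u; exact: tbnrm_ge0.
pose lv phi k := lval phi (ra (x k)) (rB (x k)) (rw (x k)).
pose rv phi k := rval phi (ra' (x k)) (rB' (x k)) (rw (x k)).
have lv0 phi k : nonneg phi -> (0 <= lv phi k)%E by move=> H; exact: lval_ge0.
have rv0 phi k : nonneg phi -> (0 <= rv phi k)%E by move=> H; exact: rval_ge0.
have lvalE phi : nonneg phi -> lval phi (psum ones (fun k => ra (x k))) BB W =
    (\sum_(0 <= k <oo) lv phi k)%E.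
  move=> H; rewrite /lval (avalE phi _ _ _ H a0 hB) hW; last by move=> w; exact: lo_ge0.
  rewrite -psumD//; [|by move=> k; exact: aval_ge0|by move=> k; exact: elo_ge0].
  exact: total_series_psum1.
have rvalE phi : nonneg phi -> rval phi (psum ones (fun k => ra' (x k))) BB' W =
    (\sum_(0 <= k <oo) rv phi k)%E.
  move=> H; rewrite /rval (avalE phi _ _ _ H a'0 hB') hW; last by move=> w; exact: ro_ge0.
  rewrite -psumD//; [|by move=> k; exact: aval_ge0|by move=> k; exact: ero_ge0].
  exact: total_series_psum1.
(* Telescoping, with the value of the n-th residual dropped; it is used for both sides. *)
have lower (v : @test K -> nat -> \bar K) (G : \bar K * (prog K * prog K) -> prog K) phi :
    nonneg phi -> (forall k, 0 <= v phi k)%E ->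
    (forall k, v phi k + minf phi [::] (G (st k.+1)) <= minf phi [::] (G (st k)))%E ->
    (\sum_(0 <= k <oo) v phi k <= minf phi [::] (G (st 0%N)))%E.
  move=> H v0 h; apply: lime_le; first by apply: is_cvg_nneseries => k _ _.
  apply: nearW => n.
  apply: (@le_trans _ _ (\sum_(0 <= k < n) v phi k + minf phi [::] (G (st n)))%E).
    by rewrite leeDl// minf_ge0.
  elim: n => [|n IH]; first by rewrite big_geq// add0e.
  by apply: le_trans IH; rewrite big_nat_recr//= -addeA leeD2l.
(* Only here does the decrease of fuel matter: fuel 0 leaves nothing to the residual, fuel n + 1
   leaves it fuel n. The start [j] is arbitrary because the induction moves on to the next round. *)
have upper phi n j : nonneg phi ->
    (mrun n (fun=> phi) [::] (st j).2.1 <= \sum_(0 <= k <oo) lv phi (k + j)%N)%E.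
  move=> H; elim: n j => [|n IH] j; apply: le_trans (r_L (hx j) _ (fun=> H) (@nondecr_cst _ phi)) _;
    rewrite -/(lv phi j).
    rewrite adde0 nneseries_recl//; last by move=> k _; exact: lv0.
    by rewrite add0n leeDl//; apply: nneseries_ge0 => k _ _; exact: lv0.
  rewrite nneseries_recl//; last by move=> k _; exact: lv0.
  rewrite add0n leeD2l//; apply: le_trans (IH j.+1) _.
  rewrite -[leRHS](nneseries_addn 1); last by move=> k; exact: lv0.
  by apply: lee_nneseries => k _ => [_|]; rewrite ?lv0// addn1 addSnnS.
exists (psum ones (fun k => ra (x k))), (psum ones (fun k => ra' (x k))),
  (psum ones (fun k => rb (x k))), BB, BB', W; split; split=> //.
- exact: psum_ge0.
- by apply: psum_le => // k _; exact: r_aa' (hx k).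
- by apply: (crel_psum one0 _ (lexx _) b1 hB hB') => k _; exact: r_B (hx k).
- apply: (@wsum_supp _ _ ones _ W (fun w => args_rel w.2.1 w.2.2) hW) => k _ i.
  exact: r_w (hx k) i.
- move=> phi H; rewrite lvalE//; apply/eqP; rewrite eq_le; apply/andP; split.
    apply: minf_le => // n; apply: le_trans (upper phi n 0%N H) _.
    by apply: lee_nneseries => k _ => [_|]; rewrite addn0 ?lv0.
  apply: (lower lv (fun w => w.2.1) phi H) => k; first exact: lv0.
  exact: r_l (hx k) _ H.
- move=> phi H; rewrite rvalE//; apply: (lower rv (fun w => w.2.2) phi H) => k; first exact: rv0.
  exact: r_r (hx k) _ H.
Qed.

End Progress.

(** * From couplings of keys to matchings of entries *)

Section Matching.
Context {K : realType}.

Lemma series_shift (f : nat -> \bar K) : (forall i, 0 <= f i)%E ->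
  (\sum_(0 <= i <oo) f i = f 0%N + \sum_(0 <= i <oo) f i.+1)%E.
Proof.
move=> f0; rewrite nneseries_recl//; congr (_ + _)%E.
by rewrite -(nneseries_addn 1)//; apply: eq_eseriesr => i _; rewrite addn1.
Qed.

Lemma series_term_le (f : nat -> \bar K) i : (forall i, 0 <= f i)%E ->
  (f i <= \sum_(0 <= i <oo) f i)%E.
Proof.
move=> f0; apply: le_trans (@nneseries_lim_ge _ f xpredT 0%N i.+1 _) => //.
by rewrite big_nat_recr//= leeDr// sume_ge0.
Qed.

Definition ind {V : Type} (u v : V) : K := if `[< u = v >] then 1 else 0.

Lemma ind_ge0 V (u v : V) : 0 <= ind u v. Proof. by rewrite /ind; case: ifP. Qed.

Lemma ind_le1 V (u v : V) : ind u v <= 1. Proof. by rewrite /ind; case: ifP. Qed.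

Lemma ind_neq0 V (u v : V) : ind u v != 0 -> u = v.
Proof. by rewrite /ind; case: asboolP => //; rewrite eqxx. Qed.

Lemma ind_rr V (u : V) : ind u u = 1.
Proof. by rewrite /ind asboolT. Qed.

(* A coupling of two families only specifies how much weight is matched between
   keys; the weight of a key is spread over its occurrences proportionally. *)
Lemma coupling_matching X V (W : dist K X) (ka kb : X -> V) (p q : nat -> K) (a b : nat -> V) :
  (forall i, 0 <= p i) -> (forall i, 0 <= q i) -> (\sum_(0 <= i <oo) (q i)%:E <= 1)%E ->
  (forall v, (\sum_(0 <= i <oo) (p i * ind (a i) v)%:E <=
              \sum_(0 <= k <oo) (wt W k * ind (ka (elt W k)) v)%:E)%E) ->
  (forall v, (\sum_(0 <= k <oo) (wt W k * ind (kb (elt W k)) v)%:E <=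
              \sum_(0 <= j <oo) (q j * ind (b j) v)%:E)%E) ->
  exists f : nat -> nat -> K,
   [/\ forall i j, 0 <= f i j,
       forall i j, f i j != 0 -> [/\ p i != 0, q j != 0 &
         exists2 k, wt W k != 0 & ka (elt W k) = a i /\ kb (elt W k) = b j],
       forall i, (\sum_(0 <= j <oo) (f i j)%:E = (p i)%:E)%E
     & forall j, (\sum_(0 <= i <oo) (f i j)%:E <= (q j)%:E)%E].
Proof.
move=> p0 q0 q1 hp hq.
pose w k := wt W k; pose x k := ka (elt W k); pose y k := kb (elt W k).
have w0 k : 0 <= w k by exact: prob_ge0.
pose SA v : \bar K := (\sum_(0 <= k <oo) (w k * ind (x k) v)%:E)%E.
pose SB v : \bar K := (\sum_(0 <= j <oo) (q j * ind (b j) v)%:E)%E.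
have SA0 v : (0 <= SA v)%E by apply: nneseries_ge0 => k _ _; rewrite lee_fin mulr_ge0 ?ind_ge0.
have SB0 v : (0 <= SB v)%E by apply: nneseries_ge0 => k _ _; rewrite lee_fin mulr_ge0 ?ind_ge0.
have SA1 v : (SA v <= 1)%E.
  apply: le_trans (prob_le1 (wt W)); apply: lee_nneseries => k _.
    by move=> _; rewrite lee_fin mulr_ge0 ?ind_ge0.
  by rewrite lee_fin -[leRHS]mulr1 ler_wpM2l ?ind_le1.
have SB1 v : (SB v <= 1)%E.
  apply: le_trans q1; apply: lee_nneseries => k _.
    by move=> _; rewrite lee_fin mulr_ge0 ?ind_ge0.
  by rewrite lee_fin -[leRHS]mulr1 ler_wpM2l ?ind_le1.
have fin z : (0 <= z)%E -> (z <= 1)%E -> z = (fine z)%:E :> \bar K.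
  move=> z0 z1; rewrite fineK// ge0_fin_numE//; exact: le_lt_trans z1 (ltry 1).
pose A v := fine (SA v); pose B v := fine (SB v).
have A0 v : 0 <= A v by exact: fine_ge0.
have B0 v : 0 <= B v by exact: fine_ge0.
have SAE v : SA v = (A v)%:E by exact: fin.
have SBE v : SB v = (B v)%:E by exact: fin.
(* Dividing [p i] by the weight that the coupling gives to its key makes row sums exactly [p i];
   dividing [q j] by the weight of its key under [q] keeps column sums below [q j]. Division by zero
   yields 0, which is right on the rows as [hp] then forces [p i = 0]. *)
have [c cE] : exists c : nat -> K, forall i, c i = p i / A (a i) by eexists.
have [d dE] : exists d : nat -> K, forall j, d j = q j / B (b j) by eexists.
have c0 i : 0 <= c i by rewrite cE divr_ge0.
have d0 j : 0 <= d j by rewrite dE divr_ge0.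
pose F k i j := w k * ind (x k) (a i) * ind (y k) (b j) * (c i * d j).
have F0 k i j : 0 <= F k i j by rewrite /F !mulr_ge0 ?ind_ge0.
have FE0 k i j : (0 <= (F k i j)%:E)%E by rewrite lee_fin.
pose f i j := fine (\sum_(0 <= k <oo) (F k i j)%:E)%E.
have fE i j : (f i j)%:E = (\sum_(0 <= k <oo) (F k i j)%:E)%E.
  rewrite /f fineK// ge0_fin_numE; last by apply: nneseries_ge0 => *.
  apply: (@le_lt_trans _ _ ((c i * d j)%:E * \sum_(0 <= k <oo) (w k)%:E)%E).
    rewrite -nneseriesZ; [|by rewrite lee_fin mulr_ge0|by move=> k; rewrite lee_fin].
    apply: lee_nneseries => k _ => [_|]; first exact: FE0.
    rewrite -EFinM lee_fin /F mulrC ler_wpM2l ?mulr_ge0//.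
    rewrite -mulrA -[leRHS]mulr1 ler_wpM2l// mulr_ile1 ?ind_ge0 ?ind_le1//.
  apply: (@le_lt_trans _ _ ((c i * d j)%:E * 1)%E); last by rewrite mule1 ltry.
  by rewrite lee_wpmul2l ?lee_fin ?mulr_ge0//; exact: prob_le1.
exists f; split.
- by move=> i j; apply: fine_ge0; apply: nneseries_ge0 => *.
- move=> i j fij.
  have [k Fk] : exists k, F k i j != 0.
    apply: contrapT => nF; move: fij; rewrite /f eseries0 ?fine0 ?eqxx// => k _ _.
    by congr EFin; apply/eqP; apply: contra_notT nF => ?; exists k.
  move: Fk; rewrite /F cE dE !mulf_eq0 !negb_or => /andP[/andP[/andP[wk ik] jk] /andP[]].
  move=> /andP[pi _] /andP[qj _]; split=> //; exists k => //.
  by split; [exact: ind_neq0 ik|exact: ind_neq0 jk].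
- move=> i; under eq_eseriesr do rewrite fE.
  rewrite nneseries_swap; last by move=> j k; exact: FE0.
  transitivity (\sum_(0 <= k <oo) (c i)%:E * (w k * ind (x k) (a i))%:E)%E.
    apply: eq_eseriesr => k _.
    have [wk|wk] := eqVneq (w k) 0.
      by rewrite wk mul0r mule0; apply: eseries0 => j _ _; rewrite /F wk !mul0r.
    transitivity (\sum_(0 <= j <oo) (c i * (w k * ind (x k) (a i)) / B (y k))%:E *
                    (q j * ind (b j) (y k))%:E)%E.
      apply: eq_eseriesr => j _; rewrite -EFinM; congr EFin; rewrite /F dE /ind.
      case: (asboolP (y k = b j)) => [->|ne].
        by rewrite (asboolT erefl) !mulr1; move: (B _)^-1 => z; ring.
      by rewrite (asboolF (nesym ne)) !(mulr0, mul0r).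
    rewrite nneseriesZ; last 2 first.
    + by rewrite lee_fin !mulr_ge0 ?ind_ge0 ?invr_ge0.
    + by move=> j; rewrite lee_fin mulr_ge0 ?ind_ge0.
    rewrite -/(SB (y k)) SBE -EFinM divfK//.
    (* The entry [k] has positive weight, so by [hq] its right key occurs among the [b j] with
       positive weight. *)
    have : (0 < SB (y k))%E.
      apply: lt_le_trans (hq (y k)).
      apply: lt_le_trans (@series_term_le (fun k' => (w k' * ind (y k') (y k))%:E) k _).
        by rewrite ind_rr mulr1 lte_fin lt_def wk w0.
      by move=> k'; rewrite lee_fin mulr_ge0 ?ind_ge0.
    by rewrite SBE lte_fin lt_def => /andP[].
  rewrite nneseriesZ; [|by rewrite lee_fin|by move=> k; rewrite lee_fin mulr_ge0 ?ind_ge0].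
  rewrite -/(SA (a i)) SAE -EFinM; congr EFin; rewrite cE.
  have [Ai|Ai] := eqVneq (A (a i)) 0; last by rewrite divfK.
  rewrite Ai mulr0; apply/eqP; rewrite eq_sym eq_le p0 andbT -lee_fin.
  have /= := hp (a i); rewrite -/(SA (a i)) SAE Ai; apply: le_trans.
  apply: le_trans (@series_term_le (fun i' => (p i' * ind (a i') (a i))%:E) i _).
    by rewrite ind_rr mulr1.
  by move=> i'; rewrite lee_fin mulr_ge0 ?ind_ge0.
- move=> j; under eq_eseriesr do rewrite fE.
  rewrite nneseries_swap; last by move=> i k; exact: FE0.
  apply: (@le_trans _ _ (\sum_(0 <= k <oo) (d j)%:E * (w k * ind (y k) (b j))%:E)%E); last first.
    rewrite nneseriesZ; [|by rewrite lee_fin|by move=> k; rewrite lee_fin mulr_ge0 ?ind_ge0].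
    apply: (@le_trans _ _ ((d j)%:E * SB (b j))%E).
      by rewrite lee_wpmul2l ?lee_fin//; exact: hq.
    rewrite SBE -EFinM lee_fin dE.
    have [Bj|Bj] := eqVneq (B (b j)) 0; last by rewrite divfK.
    by rewrite Bj mulr0.
  apply: lee_nneseries => k _ => [_|]; first by apply: nneseries_ge0 => *.
  have -> : (\sum_(0 <= i <oo) (F k i j)%:E =
     \sum_(0 <= i <oo) (d j * (w k * ind (y k) (b j)) / A (x k))%:E *
                    (p i * ind (a i) (x k))%:E)%E.
    apply: eq_eseriesr => i _; rewrite -EFinM; congr EFin; rewrite /F cE /ind.
    case: (asboolP (x k = a i)) => [->|ne].
      by rewrite (asboolT erefl) !mulr1; move: (A _)^-1 => z; ring.
    by rewrite (asboolF (nesym ne)) !(mulr0, mul0r).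
  rewrite nneseriesZ; last 2 first.
  + by rewrite lee_fin !mulr_ge0 ?ind_ge0 ?invr_ge0.
  + by move=> i; rewrite lee_fin mulr_ge0 ?ind_ge0.
  apply: (@le_trans _ _ ((d j * (w k * ind (y k) (b j)) / A (x k))%:E * SA (x k))%E).
    by rewrite lee_wpmul2l ?lee_fin ?mulr_ge0 ?ind_ge0 ?invr_ge0//; exact: hp.
  rewrite SAE -!EFinM lee_fin.
  have [Ai|Ai] := eqVneq (A (x k)) 0; last by rewrite divfK.
  by rewrite Ai mulr0 !mulr_ge0 ?ind_ge0.
Qed.

End Matching.

(** * The closure is contained in simulation *)

Section ToSim.
Context {K : realType}.
Variable base : prog K -> prog K -> Prop.
Implicit Types (t u : term K) (M N B : prog K) (s : seq (prog K)) (m : \bar K).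
Notation crel := (crel base).
Notation args_rel := (args_rel base).
Notation opens_rel := (opens_rel base).
Notation opens := (dist K (nat * (seq (prog K) * seq (prog K)))).
Notation progress := (progress base).
Hypothesis base_progress : forall M M', base M M' -> progress M M'.

(** Tests see arguments only up to [cn], so matching is done on keys. The default value is harmless:
    [open_wt] vanishes there. *)
Definition key t : nat * seq (prog K) :=
  if open_app t is Some (x, Ms) then (x, map cn Ms) else (0%N, [::]).

Definition open_wt M i : K := if is_open (elt M i) then wt M i else 0.

Definition open_test (h : nat * seq (prog K) -> \bar K) : @test K :=
  Test 0%E (fun=> 0%E) (fun x s => h (x, s)).

Lemma nonneg_open_test h : (forall v, 0 <= h v)%E -> nonneg (open_test h).
Proof. by move=> h0; split=> //= x s; exact: h0. Qed.

Lemma obs_open_test h t : (forall v, 0 <= h v)%E ->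
  obs (open_test h) t = if is_open t then h (key t) else if is_abs t then 0%E else obs (open_test h) t.
Proof.
move=> h0; rewrite /is_open /key; case e: open_app => [[x Ms]|] /=.
  by rewrite (obs_open (nonneg_open_test h0) e).
by case: t e => // B _; rewrite /= /obs run_lam add0e expect0.
Qed.

Lemma minf_open_test h M : (forall v, 0 <= h v)%E ->
  minf (open_test h) [::] M =
  (\sum_(0 <= i <oo) (open_wt (whnf M) i)%:E * h (key (elt (whnf M) i)))%E.
Proof.
move=> h0; rewrite minf_whnf; last exact: nonneg_open_test.
apply: eq_eseriesr => i _; rewrite /open_wt.
have [->|/whnf_nf w] := eqVneq (wt (whnf M) i) (0 : K); first by case: ifP; rewrite !mul0e.
rewrite obs_open_test//; case: ifP => // no; rewrite mul0e.
by move: w; rewrite /is_whnf no orbF => ->; rewrite mule0.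
Qed.

Lemma lval_open_test h a B (W : opens) :
  lval (open_test h) a B W = expect (fun w => h (w.1, map cn w.2.1)) W.
Proof. by rewrite /lval /aval mule0 add0e [expect _ B]expect0 add0e. Qed.

Lemma rval_open_test h a B (W : opens) :
  rval (open_test h) a B W = expect (fun w => h (w.1, map cn w.2.2)) W.
Proof. by rewrite /rval /aval mule0 add0e [expect _ B]expect0 add0e. Qed.

Definition abs_test (c : \bar K) (h : term K -> \bar K) : @test K :=
  Test c h (fun _ _ => 0%E).

Lemma nonneg_abs_test c h : (0 <= c)%E -> (forall u, 0 <= h u)%E -> nonneg (abs_test c h).
Proof. by move=> c0 h0; split. Qed.

Lemma lval_abs_test c h a B (W : opens) :
  lval (abs_test c h) a B W = (a * c + expect (h \o nrm) B)%E.
Proof. by rewrite /lval /aval [expect _ W]expect0 adde0. Qed.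

Lemma rval_abs_test c h a B (W : opens) :
  rval (abs_test c h) a B W = (a * c + expect (h \o nrm) B)%E.
Proof. by rewrite /rval /aval [expect _ W]expect0 adde0. Qed.

Lemma minf_abs_test c h M : (0 <= c)%E -> (forall u, 0 <= h u)%E ->
  minf (abs_test c h) [::] M = (absmass (whnf M) * c + expect (h \o nrm) (body (whnf M)))%E.
Proof. by move=> c0 h0; rewrite minf_lval ?lval_abs_test//; exact: nonneg_abs_test. Qed.

Lemma expect_body_abs (h : term K -> \bar K) M : (forall u, 0 <= h u)%E ->
  expect h (body (dfilter is_abs M)) = expect h (body M).
Proof.
move=> h0; rewrite !expect_body// expect_filter; apply: expect_eq => i _.
by case: (elt M i).
Qed.

Lemma total_abs M : total (dfilter is_abs M) = absmass M.
Proof. by rewrite totalE expect_filter. Qed.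

Lemma abs_dist_filter M : abs_dist (dfilter is_abs M).
Proof. by move=> i /=; rewrite /restr_wt; case: ifP => //; rewrite eqxx. Qed.

Lemma crel_one m M M' : crel m M M' -> crel 1%E M M'.
Proof. by move=> r; have [_ _ m1] := crel_bounds r; exact: (crel_cn r). Qed.

Lemma crel_ext m M M' M1 M1' : crel m M1 M1' -> ext_eq M M1 -> ext_eq M' M1' -> crel m M M'.
Proof.
move=> r e e'; have [_ _ m1] := crel_bounds r.
by apply: (crel_cn r) => //; exact: cn_ext.
Qed.

(** An open application evaluates like its head variable run on the arguments, so [RApps] applies up
    to [crel_conv]. *)
Lemma args_crel_open t t' x s s' : args_rel s s' ->
  (exists2 Ms, open_app t = Some (x, Ms) & map cn Ms = map cn s) ->
  (exists2 Ms, open_app t' = Some (x, Ms) & map cn Ms = map cn s') ->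
  crel 1%E (dpoint t) (dpoint t').
Proof.
move=> [e h] [Ms et eM] [Ms' et' eM'].
have r : crel 1%E (dapps (vars x) s) (dapps (vars x) s').
  by apply: RApps => //; exact: crel_refl.
have mE n Phi u Ns s1 : (forall n, nonneg (Phi n)) -> open_app u = Some (x, Ns) ->
    map cn Ns = map cn s1 -> mrun n Phi [::] (dpoint u) = mrun n Phi [::] (dapps (vars x) s1).
  move=> H eu eN; rewrite mrun_dapps// !mrun_dpoint// run_var.
  by rewrite (run_open _ _ H eu) cats0 eN.
have iE phi u Ns s1 : nonneg phi -> open_app u = Some (x, Ns) ->
    map cn Ns = map cn s1 -> minf phi [::] (dpoint u) = minf phi [::] (dapps (vars x) s1).
  move=> H eu eN; rewrite minf_dapps// !minf_dpoint// rinf_var.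
  by rewrite (rinf_open _ H eu) cats0 eN.
apply: (crel_conv r) => //; try exact: total_le1.
- by move=> n Phi H _; rewrite (mE _ _ _ _ s H et).
- by move=> phi H; rewrite (iE _ _ _ s H et).
- by move=> phi H; rewrite (iE _ _ _ s' H et').
Qed.

(** The relation that turns out to be a post-fixed point of [simF]. *)
Definition nfrel M M' : Prop := nf_pair M M' /\ crel 1%E M M'.

(** Constant tests isolate the weight of the abstractions, tests of the body alone the sum of the
    bodies. Both are exact on the left and lower bounds on the right, as [RAbs] and [crel_conv]
    require. *)
Lemma crel_abs_part m M M' : crel m M M' ->
  crel 1%E (dfilter is_abs (whnf M)) (dfilter is_abs (whnf M')).
Proof.
move=> /(crel_progress base_progress) [a [a' [b [B [B' [W [[a0 aa' ba' BB'] [hW hl hr]]]]]]]].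
have aE : absmass (whnf M) = a.
  have := hl _ (nonneg_abs_test lee01 (fun=> lexx 0%E)).
  rewrite minf_abs_test ?lee01// lval_abs_test !mule1.
  by rewrite [expect _ _]expect0 [expect _ B]expect0 !adde0.
have a'le : (a' <= absmass (whnf M'))%E.
  have := hr _ (nonneg_abs_test lee01 (fun=> lexx 0%E)).
  rewrite minf_abs_test ?lee01// rval_abs_test !mule1.
  by rewrite [expect _ _]expect0 [expect _ (body _)]expect0 !adde0.
have hB (h : term K -> \bar K) : (forall u, 0 <= h u)%E -> (forall u, h (nrm u) = h u) ->
    expect h (body (whnf M)) = expect h B.
  move=> h0 hn; have := hl _ (nonneg_abs_test (lexx 0%E) h0).
  rewrite minf_abs_test// lval_abs_test !mule0 !add0e => E.
  transitivity (expect (h \o nrm) (body (whnf M))); first by apply: expect_eq => i _ /=; rewrite hn.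
  by rewrite E; apply: expect_eq => i _ /=; rewrite hn.
have hB' (h : term K -> \bar K) : (forall u, 0 <= h u)%E -> (forall u, h (nrm u) = h u) ->
    (expect h B' <= expect h (body (whnf M')))%E.
  move=> h0 hn; have := hr _ (nonneg_abs_test (lexx 0%E) h0).
  rewrite minf_abs_test// rval_abs_test !mule0 !add0e => E.
  apply: (@le_trans _ _ (expect (h \o nrm) B')).
    by apply: expect_le => // i _ /=; rewrite hn.
  apply: le_trans E _; apply: expect_le => [u|i _] /=; first exact: h0.
  by rewrite hn.
apply: RAbs; rewrite ?total_abs ?absmass_le1 ?aE//; try exact: abs_dist_filter.
  exact: le_trans aa' a'le.
have tb N : (total (body (dfilter is_abs N)) <= absmass N)%E.
  by rewrite totalE expect_body_abs// -totalE total_body.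
apply: (crel_conv BB'); rewrite ?absmass_le1//.
- exact: le_trans ba' a'le.
- by apply: le_trans (tb _) _; rewrite aE; exact: le_trans aa' a'le.
- move=> n Phi H _; rewrite /mrun expect_body_abs; last by move=> u; exact: run_ge0.
  by rewrite hB// => u; [exact: run_ge0|apply: run_cong => //; exact: nrmK].
- move=> phi H; rewrite [leRHS]/minf expect_body_abs; last by move=> u; exact: rinf_ge0.
  by rewrite hB// => u; [exact: rinf_ge0|apply: rinf_cong => //; exact: nrmK].
- move=> phi H; rewrite [leRHS]/minf expect_body_abs; last by move=> u; exact: rinf_ge0.
  by apply: hB' => u; [exact: rinf_ge0|apply: rinf_cong => //; exact: nrmK].
Qed.

Lemma open_wt_ge0 M i : 0 <= open_wt M i.
Proof. by rewrite /open_wt; case: ifP => // _; exact: prob_ge0. Qed.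

Lemma ind_test_ge0 (v w : nat * seq (prog K)) : (0 <= (ind w v : K)%:E)%E.
Proof. by rewrite lee_fin ind_ge0. Qed.

Lemma lift_of_match (S : prog K -> prog K -> Prop) P Q (f : nat -> nat -> K) :
  (forall i j, 0 <= f i j) ->
  S (dfilter is_abs P) (dfilter is_abs Q) ->
  (forall i j, f i j != 0 -> S (dpoint (elt P i)) (dpoint (elt Q j))) ->
  (forall i, \sum_(0 <= j <oo) (f i j)%:E = (open_wt P i)%:E)%E ->
  (forall j, \sum_(0 <= i <oo) (f i j)%:E <= (open_wt Q j)%:E)%E ->
  lift_nf S P Q.
Proof.
move=> f0 S0 fS fp fq.
exists (fun i j => match i, j with 0%N, 0%N => 1 | i'.+1, j'.+1 => f i' j' | _, _ => 0 end).
have g0 i j : 0 <= (match i, j with 0%N, 0%N => 1 | i'.+1, j'.+1 => f i' j' | _, _ => 0 end) :> K.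
  by case: i j => [|i] [|j].
split=> //.
- by case=> [|i] [|j]; rewrite ?eqxx//=; exact: fS.
- move=> [|i]; rewrite series_shift/=.
  + by rewrite eseries0// adde0.
  + by case=> [|j]; rewrite lee_fin.
  + by rewrite add0e fp.
  + by case=> [|j]; rewrite lee_fin.
- move=> [|j]; rewrite series_shift/=.
  + by rewrite eseries0// adde0.
  + by case=> [|i]; rewrite lee_fin.
  + by rewrite add0e fq.
  + by case=> [|i]; rewrite lee_fin.
Qed.

Lemma is_open_key t : is_open t -> exists Ms, open_app t = Some ((key t).1, Ms) /\ map cn Ms = (key t).2.
Proof.
by rewrite /is_open /key; case: open_app => [[x Ms]|] // _; exists Ms.
Qed.

(** Tests that indicate a single key show that the left marginal of the coupling is the distribution
    of keys in [whnf M], and that the right one is below that of [whnf M']. *)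
Theorem crel_lift m M M' : crel m M M' -> lift_nf nfrel (whnf M) (whnf M').
Proof.
move=> r; have := crel_progress base_progress r.
move=> [a [a' [b [B [B' [W [[a0 aa' ba' BB'] [hW hl hr]]]]]]]].
have [|v|v|f [f0 fS fp fq]] := @coupling_matching K _ _ W (fun w => (w.1, map cn w.2.1))
    (fun w => (w.1, map cn w.2.2)) (open_wt (whnf M)) (open_wt (whnf M'))
    (fun i => key (elt (whnf M) i)) (fun i => key (elt (whnf M') i))
    (open_wt_ge0 _) (open_wt_ge0 _).
- apply: le_trans (prob_le1 (wt (whnf M'))); apply: lee_nneseries => i _ => [_|].
    by rewrite lee_fin open_wt_ge0.
  by rewrite lee_fin /open_wt; case: ifP => // _; exact: prob_ge0.
- have := hl _ (nonneg_open_test (ind_test_ge0 v)).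
  rewrite lval_open_test minf_open_test; last by move=> u; exact: ind_test_ge0.
  move=> E; rewrite le_eqVlt; apply/orP; left; apply/eqP.
  transitivity (\sum_(0 <= i <oo) (open_wt (whnf M) i)%:E * (ind (key (elt (whnf M) i)) v)%:E)%E.
    by apply: eq_eseriesr => i _; rewrite EFinM.
  by rewrite E; apply: eq_eseriesr => i _; rewrite EFinM.
- have := hr _ (nonneg_open_test (ind_test_ge0 v)).
  rewrite rval_open_test minf_open_test; last by move=> u; exact: ind_test_ge0.
  move=> E; apply: (@le_trans _ _ (expect (fun w => (ind (w.1, map cn w.2.2) v)%:E) W)).
    by apply: lee_nneseries => i _ => [_|]; rewrite ?EFinM// mule_ge0 ?lee_fin ?prob_ge0 ?ind_ge0.
  apply: le_trans E _; apply: lee_nneseries => i _ => [_|]; rewrite ?EFinM//.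
  by rewrite mule_ge0 ?lee_fin ?open_wt_ge0 ?ind_ge0.
apply: (lift_of_match f0 _ _ fp fq).
  split; last exact: crel_abs_part r.
  by left; split; exact: abs_dist_filter.
move=> i j fij; have [pi qj [k wk [ka kb]]] := fS i j fij.
have oi : is_open (elt (whnf M) i) by move: pi; rewrite /open_wt; case: ifP; rewrite ?eqxx.
have oj : is_open (elt (whnf M') j) by move: qj; rewrite /open_wt; case: ifP; rewrite ?eqxx.
split; first by right; split; [exists (elt (whnf M) i)|exists (elt (whnf M') j)].
have [Ms [e1 e2]] := is_open_key oi; have [Ms' [e1' e2']] := is_open_key oj.
apply: (args_crel_open (x := (elt W k).1) (hW k wk)).
- by exists Ms; rewrite ?e1 ?e2 -ka.
- by exists Ms'; rewrite ?e1' ?e2' -kb.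
Qed.

Lemma expect_strong_max (h : term K -> \bar K) l M : (forall u, 0 <= h u)%E ->
  expect h (strong_max l M) = expect (fun t => expect h (odflt dzero (trans l t))) M.
Proof. by move=> h0; rewrite expect_bind. Qed.

Lemma strong_max_none l M : (forall i, wt M i != 0 -> trans l (elt M i) = None) ->
  ext_eq (strong_max l M) dzero.
Proof.
move=> h phi p0; rewrite expect_strong_max// expect_dzero -(expect0 M).
by apply: expect_eq => i /h ->; exact: expect_dzero.
Qed.

Lemma strong_max_point l t : ext_eq (strong_max l (dpoint t)) (odflt dzero (trans l t)).
Proof. exact: dbind_dpoint. Qed.

Lemma strong_max_apply y (A : prog K) : abs_dist A -> ext_eq (strong_max (Apply y) A) (dapps A [:: vars y]).
Proof.
move=> h phi p0; rewrite expect_strong_max// /dapps expect_dmap; apply: expect_eq => i /h /= ->.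
by rewrite expect_dpoint.
Qed.

Lemma strong_max_converge (h : term K -> \bar K) (A : prog K) : (forall u, 0 <= h u)%E -> abs_dist A ->
  expect h (strong_max Converge A) = (total A * expect h idterm)%E.
Proof.
move=> h0 hA; rewrite expect_strong_max// totalE muleC -expectZ//; last exact: expect_ge0.
by apply: expect_eq => i /hA /= ->; rewrite mule1.
Qed.

Lemma crel_total m A A' : abs_dist A -> abs_dist A' -> crel m A A' -> (total A <= total A')%E.
Proof.
move=> hA hA' /(crel_progress base_progress).
move=> [a [a' [b [B [B' [W [[a0 aa' ba' BB'] [hW hl hr]]]]]]]].
have H := nonneg_abs_test (lee01 : 0 <= 1 :> \bar K)%E (fun=> lexx 0%E).
have tE N : abs_dist N -> minf (abs_test 1%E (fun=> 0%E)) [::] N = total N.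
  move=> hN; rewrite /minf (expect_abs_dist H hN); last by move=> B0; rewrite rinf_lam.
  by rewrite /aval mule1 [expect _ _]expect0 adde0.
have := hr _ H; have := hl _ H; rewrite !tE// lval_abs_test rval_abs_test !mule1.
rewrite [expect _ _]expect0 [expect _ B']expect0 !adde0 => ->.
exact: le_trans.
Qed.

Lemma crel_converge m A A' : abs_dist A -> abs_dist A' -> crel m A A' ->
  crel 1%E (strong_max Converge A) (strong_max Converge A').
Proof.
move=> hA hA' r; have tt := crel_total hA hA' r.
(* [Converge] yields the identity with weight [total A]. This weight is taken on the right as well,
   where falling short of [total A'] is allowed. *)
pose p (k : nat) : K := if k is 0%N then fine (total A) else 0.
have pE : (p 0%N)%:E = total A.
  rewrite /p fineK// ge0_fin_numE ?total_ge0//.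
  exact: le_lt_trans (total_le1 _) (ltry 1).
have p0 k : 0 <= p k by case: k => //; exact: fine_ge0 (total_ge0 A).
have psE (x : \bar K) : (0 <= x)%E -> psum p (fun=> x) = (total A * x)%E.
  move=> x0; rewrite /psum series_head ?pE// => i; rewrite ?mul0e//.
  by rewrite mule_ge0 ?lee_fin.
apply: (@RSum _ base 1%E p (fun=> 1%E) (fun=> idterm) (fun=> idterm)) => //;
  try exact: total_le1.
- by move=> k _; exact: crel_refl.
- by rewrite psE// mule1; exact: total_le1.
- move=> n Phi H mon; rewrite psE; last exact: mrun_ge0.
  by rewrite /mrun strong_max_converge// => u; exact: run_ge0.
- move=> phi H; rewrite psE; last exact: minf_ge0.
  by rewrite [leRHS]/minf strong_max_converge// => u; exact: rinf_ge0.
- move=> phi H; rewrite psE; last exact: minf_ge0.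
  rewrite [leRHS]/minf strong_max_converge//; last by move=> u; exact: rinf_ge0.
  by rewrite lee_wpmul2r//; exact: minf_ge0.
Qed.

(** A test that vanishes exactly at the key of the term forces every entry of the coupling to have
    this key; the constant test 1 shows that there is an entry. Its arguments are the required ones
    up to [cn]. *)
Lemma crel_open m t t' x x' Ms Ms' : crel m (dpoint t) (dpoint t') ->
  open_app t = Some (x, Ms) -> open_app t' = Some (x', Ms') -> x = x' /\ args_rel Ms Ms'.
Proof.
move=> /(crel_progress base_progress) [a [a' [b [B [B' [W [_ [hW hl hr]]]]]]]] e e'.
have lE h : (forall v, 0 <= h v)%E ->
    h (x, map cn Ms) = expect (fun w => h (w.1, map cn w.2.1)) W.
  move=> h0; have H := nonneg_open_test h0.
  by have := hl _ H; rewrite lval_open_test minf_dpoint// (rinf_open _ H e) cats0.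
have rE h : (forall v, 0 <= h v)%E ->
    (expect (fun w => h (w.1, map cn w.2.2)) W <= h (x', map cn Ms'))%E.
  move=> h0; have H := nonneg_open_test h0.
  by have := hr _ H; rewrite rval_open_test minf_dpoint// (rinf_open _ H e') cats0.
have [k wk] : exists k, wt W k != 0.
  apply: contrapT => nw; have := lE (fun=> 1%E) (fun=> lee01).
  rewrite /expect eseries0; first by move/eqP; rewrite onee_eq0.
  move=> i _ _; suff -> : wt W i = 0 by rewrite mul0e.
  by apply/eqP; apply: contra_notT nw => ?; exists i.
have kE : (x, map cn Ms) = ((elt W k).1, map cn (elt W k).2.1).
  have := lE (fun v => if `[< v = (x, map cn Ms) >] then 0%E else 1%E).
  rewrite asboolT// => /(_ (fun v => _)) E; symmetry.
  have /expect_supp : expect (fun w => if `[< (w.1, map cn w.2.1) = (x, map cn Ms) >]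
     then 0%E else 1%E) W = 0%E by rewrite -E// => v; case: ifP.
  exact.
have kE' : ((elt W k).1, map cn (elt W k).2.2) = (x', map cn Ms').
  have := rE (fun v => if `[< v = (x', map cn Ms') >] then 0%E else 1%E).
  rewrite asboolT// => E.
  have /expect_supp : expect (fun w => if `[< (w.1, map cn w.2.2) = (x', map cn Ms') >]
     then 0%E else 1%E) W = 0%E.
    apply/eqP; rewrite eq_le expect_ge0 ?E//; first by move=> v; case: ifP.
    by move=> v; case: ifP.
  exact.
case: kE => -> eM; case: kE' => -> eM'; split=> //.
have [ew hw] := hW k wk.
have sE (s1 s2 : seq (prog K)) : map cn s1 = map cn s2 -> size s1 = size s2.
  by move/(congr1 size); rewrite !size_map.
have nE (s1 s2 : seq (prog K)) i : map cn s1 = map cn s2 -> cn (nth dzero s1 i) = cn (nth dzero s2 i).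
  move=> es; have [lt|ge] := ltnP i (size s1).
    by rewrite -!(nth_map dzero (cn dzero)) -?(sE _ _ es)// es.
  by rewrite !nth_default -?(sE _ _ es).
split=> [|i]; first by rewrite (sE _ _ eM) ew (sE _ _ eM').
by apply: (crel_cn (hw i)) => //; [exact: nE|rewrite (nE _ _ i eM')].
Qed.

Lemma crel_strong_max l P P' : nfrel P P' -> crel 1%E (strong_max l P) (strong_max l P').
Proof.
move=> [[[hA hA']|[[t ot ->] [t' ot' ->]]] r].
  case: l => [|y||y i n].
  - apply: (crel_ext (crel_one (crel_dzero base))); apply: strong_max_none => i.
      by move=> /hA a; rewrite /= /is_whnf a.
    by move=> /hA' a; rewrite /= /is_whnf a.
  - apply: (@crel_ext _ _ _ (dapps P [:: vars y]) (dapps P' [:: vars y])); try exact: strong_max_apply.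
    by apply: RApps => // -[|i]; exact: crel_refl.
  - exact: crel_converge r.
  - apply: (crel_ext (crel_one (crel_dzero base))); apply: strong_max_none => j.
      by move=> /hA; case: (elt P j).
    by move=> /hA'; case: (elt P' j).
apply: (@crel_ext _ _ _ (odflt dzero (trans l t)) (odflt dzero (trans l t')));
  try exact: strong_max_point.
have na u : is_open u -> is_abs u = false by case: u.
have D := crel_one (crel_dzero base).
move: ot ot'; rewrite /is_open; case e: (open_app t) => [[x Ms]|] // _.
case e': (open_app t') => [[x' Ms']|] // _.
have [xx [es h]] := crel_open r e e'; subst x'.
have ot : is_open t by rewrite /is_open e.
have ot' : is_open t' by rewrite /is_open e'.
case: l => [|y||y i n] /=.
- by rewrite /is_whnf ot ot' !orbT.
- by rewrite !na.
- by rewrite !na.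
rewrite e e' es; case: ifP => // /and3P[_ /eqP sn].
case: i => [_|i /= lt]; first exact: crel_refl.
rewrite !(set_nth_default dzero idterm) ?es ?sn//; exact: h.
Qed.

Theorem crel_sim m M M' : crel m M M' -> sim M M'.
Proof.
move=> /crel_lift; have sub P P' : nfrel P P' -> sim_nf P P'.
  move=> h; exists nfrel => // Q Q' QQ'; split; first by case: QQ'.
  move=> l; exact: crel_lift (crel_strong_max l QQ').
by move=> [f [f0 fS fp fq]]; exists f; split=> // i j /fS /sub.
Qed.

End ToSim.

(** * Composition and limits of matchings *)

Section Matchings.
Import numFieldNormedType.Exports.
Context {K : realType}.

Definition matching (p q : nat -> K) (f : nat -> nat -> K) : Prop :=
  [/\ forall i j, 0 <= f i j,
      forall i, (\sum_(0 <= j <oo) (f i j)%:E = (p i)%:E)%E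
    & forall j, (\sum_(0 <= i <oo) (f i j)%:E <= (q j)%:E)%E].

Lemma matching_le p q f i j : matching p q f -> f i j <= q j.
Proof.
move=> [f0 _ fq]; rewrite -lee_fin; apply: le_trans (fq j).
by apply: (@series_term_le K (fun i => (f i j)%:E)) => k; rewrite lee_fin.
Qed.

(** Gluing along the middle family: the sum over [j] of [f i j * g j k / q j]. Where [q j] vanishes
    so does [f i j], and elsewhere the rows of [g] sum to [q j] exactly, so no weight is lost. *)
Lemma matching_comp p q r f g : matching p q f -> matching q r g ->
  exists2 h, matching p r h & forall i k, h i k != 0 -> exists2 j, f i j != 0 & g j k != 0.
Proof.
move=> mf mg; have fq := fun i j => matching_le i j mf; have [f0 fp fq'] := mf.
have [g0 gq gr] := mg.
have q0 j : 0 <= q j by exact: le_trans (fq 0%N j).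
have gle j k : g j k <= q j.
  rewrite -lee_fin -gq; apply: (@series_term_le K (fun k => (g j k)%:E)) => l.
  by rewrite lee_fin.
pose F i j k := f i j * (g j k / q j).
have F0 i j k : 0 <= F i j k by rewrite !mulr_ge0 ?invr_ge0.
have FE0 i j k : (0 <= (F i j k)%:E)%E by rewrite lee_fin.
have Fle i j k : F i j k <= f i j.
  rewrite -[leRHS]mulr1 ler_wpM2l//; have [->|qj] := eqVneq (q j) 0; first by rewrite invr0 mulr0.
  by rewrite ler_pdivrMr ?mul1r// lt_def qj q0.
pose h i k := fine (\sum_(0 <= j <oo) (F i j k)%:E)%E.
have hE i k : (h i k)%:E = (\sum_(0 <= j <oo) (F i j k)%:E)%E.
  rewrite /h fineK// ge0_fin_numE; last by apply: nneseries_ge0 => *.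
  apply: (@le_lt_trans _ _ (p i)%:E); last exact: ltry.
  by rewrite -fp; apply: lee_nneseries => j _ => [_|]; rewrite ?FE0// lee_fin.
exists h; first split.
- by move=> i k; apply: fine_ge0; apply: nneseries_ge0 => *.
- move=> i; under eq_eseriesr do rewrite hE.
  rewrite nneseries_swap; last by move=> *; exact: FE0.
  rewrite -fp; apply: eq_eseriesr => j _.
  transitivity (\sum_(0 <= k <oo) (f i j / q j)%:E * (g j k)%:E)%E.
    by apply: eq_eseriesr => k _; rewrite -EFinM /F mulrA mulrAC.
  rewrite nneseriesZ; [|by rewrite lee_fin divr_ge0|by move=> k; rewrite lee_fin].
  rewrite gq -EFinM; congr EFin; have [qj|qj] := eqVneq (q j) 0; last by rewrite divfK.
  by rewrite qj mulr0; apply/eqP; rewrite eq_le f0 -{1}qj fq.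
- move=> k; under eq_eseriesr do rewrite hE.
  rewrite nneseries_swap; last by move=> *; exact: FE0.
  apply: le_trans (gr k); apply: lee_nneseries => j _ => [_|]; first by apply: nneseries_ge0 => *.
  have -> : (\sum_(0 <= i <oo) (F i j k)%:E = \sum_(0 <= i <oo) (g j k / q j)%:E * (f i j)%:E)%E.
    by apply: eq_eseriesr => i _; rewrite /F mulrC EFinM.
  rewrite nneseriesZ; [|by rewrite lee_fin divr_ge0|by move=> i; rewrite lee_fin].
  apply: (@le_trans _ _ ((g j k / q j)%:E * (q j)%:E)%E).
    by rewrite lee_wpmul2l// lee_fin divr_ge0.
  rewrite -EFinM lee_fin; have [qj|qj] := eqVneq (q j) 0; last by rewrite divfK.
  by rewrite qj mulr0.
- move=> i k hik; apply: contrapT => nj; move: hik; rewrite /h eseries0 ?fine0 ?eqxx//.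
  move=> j _ _; congr EFin; apply/eqP; apply: contra_notT nj; rewrite /F !mulf_eq0 !negb_or.
  by move=> /andP[fij /andP[gjk _]]; exists j.
Qed.

Section Limit.
Variable U : set_system nat.
Hypothesis ultraU : UltraFilter U.
Let properU : ProperFilter U := ultra_proper.

(** The image of the ultrafilter lives on a compact segment; its cluster point there is a limit. *)
Lemma ultra_lim (x : nat -> K) (c : K) : U [set n | 0 <= x n <= c] ->
  exists l : K, x n @[n --> U] --> l.
Proof.
move=> xc; have cU : (x @ U) `[0, c]%classic by apply: (filterS _ xc) => n h; rewrite /= in_itv; exact: h.
have [l [_ cl]] := @segment_compact K 0 c _ (fmap_proper_filter x properU) cU.
exists l => V Vl; have [//|nV] := in_ultra_setVsetC (x @^-1` V) ultraU.
have [y [ny Vy]] := cl (~` V) V nV Vl.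
by [].
Qed.

Lemma cvg_big N (x : nat -> nat -> K) (l : nat -> K) :
  (forall j, x n j @[n --> U] --> l j) ->
  \sum_(0 <= j < N) x n j @[n --> U] --> \sum_(0 <= j < N) l j.
Proof.
move=> h; elim: N => [|N IH].
  by rewrite big_geq//; under eq_fun do rewrite big_geq//; exact: cvg_cst.
rewrite big_nat_recr//=; under eq_fun do rewrite big_nat_recr//=.
exact: cvgD.
Qed.

Lemma matching_limit p q (f : nat -> nat -> nat -> K) :
  (\sum_(0 <= j <oo) (q j)%:E < +oo)%E -> U [set n | matching p q (f n)] ->
  exists2 g, matching p q g & forall i j, g i j != 0 -> U [set n | f n i j != 0].
Proof.
move=> qfin good.
have q0 j : 0 <= q j.
  by have [n mn] := filter_ex good; apply: le_trans (matching_le 0%N j mn); case: mn.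
have lims (ij : nat * nat) : exists l : K, f n ij.1 ij.2 @[n --> U] --> l.
  apply: (@ultra_lim _ (q ij.2)); apply: (filterS _ good) => n mn /=.
  by rewrite (matching_le ij.1 ij.2 mn) andbT; case: mn.
have [g0 hg0] := boolp.choice lims.
pose g i j := g0 (i, j); have hg i j : f n i j @[n --> U] --> g i j := hg0 (i, j).
have gge i j : 0 <= g i j.
  by apply: (cvgr_to_ge (hg i j)); apply: (filterS _ good) => n [].
have rowle i N n : matching p q (f n) -> \sum_(0 <= j < N) f n i j <= p i.
  move=> [m1 m2 m3]; rewrite -lee_fin -m2 -sumEFin.
  by apply: nneseries_lim_ge => j _ _; rewrite lee_fin.
have colle j N n : matching p q (f n) -> \sum_(0 <= i < N) f n i j <= q j.
  move=> [m1 m2 m3]; rewrite -lee_fin; apply: le_trans (m3 j); rewrite -sumEFin.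
  by apply: nneseries_lim_ge => i _ _; rewrite lee_fin.
have gE0 i j : (0 <= (g i j)%:E)%E by rewrite lee_fin.
exists g; first split=> //.
- move=> i; apply/eqP; rewrite eq_le; apply/andP; split.
    apply: lime_le; first by apply: is_cvg_nneseries => *.
    apply: nearW => N; rewrite sumEFin lee_fin.
    apply: (cvgr_to_le (@cvg_big N (fun n j => f n i j) (g i) (hg i))).
    by apply: (filterS _ good) => n; exact: rowle.
  (* Tightness: an entry in column [j] is at most [q j] for every [n], and [q] is summable, so no
     weight of a row escapes to infinity in the limit. *)
  pose tl N : \bar K := (\sum_(N <= j <oo) (q j)%:E)%E.
  have tl0 : tl N @[N --> \oo] --> 0%E by apply: nneseries_tail_cvg => // j _; rewrite lee_fin.
  have tlfin N : tl N \is a fin_num.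
    rewrite ge0_fin_numE; last by apply: nneseries_ge0 => j _ _; rewrite lee_fin.
    apply: le_lt_trans qfin; rewrite (nneseries_split 0 N)//; last by move=> j _; rewrite lee_fin.
    by rewrite add0n leeDr// sume_ge0// => j _; rewrite lee_fin.
  have key N : ((p i)%:E <= \sum_(0 <= j <oo) (g i j)%:E + tl N)%E.
    apply: (@le_trans _ _ ((\sum_(0 <= j < N) g i j)%:E + tl N)%E); last first.
      rewrite leeD2r// -sumEFin; exact: nneseries_lim_ge.
    rewrite -(fineK (tlfin N)) -EFinD lee_fin -lerBlDr.
    apply: (cvgr_to_ge (@cvg_big N (fun n j => f n i j) (g i) (hg i))).
    apply: (filterS _ good) => n mn /=; have [m1 m2 m3] := mn.
    rewrite lerBlDr -lee_fin EFinD (fineK (tlfin N)) -m2.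
    rewrite (nneseries_split 0 N)//; last by move=> j _; rewrite lee_fin.
    rewrite add0n sumEFin leeD2l//; apply: lee_nneseries => j _ => [_|]; first by rewrite lee_fin.
    by rewrite lee_fin; exact: matching_le mn.
  have cv : (\sum_(0 <= j <oo) (g i j)%:E + tl N)%E @[N --> \oo] -->
      (\sum_(0 <= j <oo) (g i j)%:E + 0)%E.
    by apply: cvgeD => //; [exact: fin_num_adde_defl|exact: cvg_cst].
  by rewrite -[leRHS]adde0; apply: (cvge_ge _ cv); apply: nearW.
- move=> j; apply: lime_le; first by apply: is_cvg_nneseries => *.
  apply: nearW => N; rewrite sumEFin lee_fin.
  apply: (cvgr_to_le (@cvg_big N (fun n i => f n i j) (g^~ j) (hg^~ j))).
  by apply: (filterS _ good) => n; exact: colle.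
(* Otherwise the entries vanish on a set of [U], and their limit would be 0. *)
- move=> i j gij; have [//|] := in_ultra_setVsetC [set n | f n i j != 0] ultraU.
  move=> z; exfalso; move/negP: gij; apply; rewrite eq_le gge andbT.
  apply: (cvgr_to_le (hg i j)); apply: (filterS _ z) => n /= /negP; rewrite negbK => /eqP ->.
  exact: lexx.
Qed.

End Limit.
End Matchings.

(** * What simulation implies for abstractions and open applications *)

Section SimFacts.
Context {K : realType}.
Implicit Types (t u : term K) (M N P Q A B : prog K) (s : seq (prog K)).

(** An instance of the closure over the empty relation, through [RLe]. *)
Lemma sim_le M N : (forall phi, nonneg phi -> (minf phi [::] M <= minf phi [::] N)%E) -> sim M N.
Proof.
move=> h; apply: (@crel_sim K (fun _ _ => False) _ 1%E) => //.
by apply: RLe => //; exact: total_le1.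
Qed.

Lemma sim_refl M : sim M M.
Proof. exact: sim_le. Qed.

Lemma sim_ext M N : ext_eq M N -> sim M N.
Proof. by move=> e; apply: sim_le => phi H; rewrite /minf e// => u; exact: rinf_ge0. Qed.

Lemma ext_eq_sym T (M N : dist K T) : ext_eq M N -> ext_eq N M.
Proof. by move=> e phi p0; rewrite e. Qed.

Lemma abs_not_open M : abs_dist M -> open_point M -> False.
Proof.
move=> h [t ot e]; have := h 0%N; rewrite e /= /unit_wt /= oner_neq0 => /(_ isT).
by move: ot; case: t {e}.
Qed.

Lemma nf_pair_trans M N P : nf_pair M N -> nf_pair N P -> nf_pair M P.
Proof.
move=> [[a b]|[a b]] [[c d]|[c d]]; [by left| | |by right].
- by have := abs_not_open b c.
- by have := abs_not_open c b.
Qed.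

Lemma sim_nf_pair M N : sim_nf M N -> nf_pair M N.
Proof. by move=> /sim_nf_fix[]. Qed.

Lemma lift_nf_comp (S1 S2 : prog K -> prog K -> Prop) M N P :
  lift_nf S1 M N -> lift_nf S2 N P ->
  lift_nf (fun A C => exists2 B, S1 A B & S2 B C) M P.
Proof.
move=> [f [f0 fS fp fq]] [g [g0 gS gp gq]].
have [h [h0 hp hq] hS] := matching_comp (And3 f0 fp fq) (And3 g0 gp gq).
exists h; split=> // i k /hS[j fij gjk]; exists (part N j); [exact: fS|exact: gS].
Qed.

Lemma sim_nf_trans M N P : sim_nf M N -> sim_nf N P -> sim_nf M P.
Proof.
move=> MN NP; exists (fun A C => exists2 B, sim_nf A B & sim_nf B C); last by exists N.
move=> {M N P MN NP} A C [B /sim_nf_fix [AB h] /sim_nf_fix [BC h']]; split.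
  exact: nf_pair_trans AB BC.
by move=> l; exact: lift_nf_comp (h l) (h' l).
Qed.

Lemma sim_trans M N P : sim M N -> sim N P -> sim M P.
Proof.
move=> MN NP; have [f [f0 fS fp fq]] := lift_nf_comp MN NP.
exists f; split=> // i j /fS[B]; exact: sim_nf_trans.
Qed.

Lemma coef_ge0 M i : 0 <= coef M i.
Proof. by case: i => [|i] //=; case: ifP => // _; exact: prob_ge0. Qed.

Lemma lift_nf_inv P Q (f : nat -> nat -> K) :
  matching (coef P) (coef Q) f ->
  (forall i j, f i j != 0 -> nf_pair (part P i) (part Q j)) ->
  [/\ f 0%N 0%N = 1, forall j, f 0%N j.+1 = 0 & forall i, f i.+1 0%N = 0].
Proof.
move=> mf h; have [f0 fp fq] := mf.
have fE i j : (0 <= (f i j)%:E)%E by rewrite lee_fin.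
have opp (M : prog K) i : coef M i.+1 != 0 -> open_point (part M i.+1).
  by rewrite /=; case: ifP => [oi _|]; [exists (elt M i)|rewrite eqxx].
have z1 j : f 0%N j.+1 = 0.
  apply/eqP; apply: contraT => nz; have := h _ _ nz.
  have oQ : open_point (part Q j.+1).
    apply: opp; apply: contraNneq nz => cz.
    by rewrite eq_le f0 andbT -cz; exact: matching_le mf.
  case=> [[_ aQ]|[oP _]]; first by have := abs_not_open aQ oQ.
  by have := abs_not_open (@abs_dist_filter K P) oP.
have z2 i : f i.+1 0%N = 0.
  apply/eqP; apply: contraT => nz; have := h _ _ nz.
  have oP : open_point (part P i.+1).
    apply: opp; apply: contraNneq nz => cz.
    rewrite eq_le f0 andbT -lee_fin -cz -fp.
    exact: (@series_term_le K (fun j => (f i.+1 j)%:E) 0%N).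
  case=> [[aP _]|[_ oQ]]; first by have := abs_not_open aP oP.
  by have := abs_not_open (@abs_dist_filter K Q) oQ.
split=> //; have := fp 0%N; rewrite series_shift//= eseries0 ?adde0.
  by case.
by move=> j _ _; rewrite z1.
Qed.

Lemma open_matching P Q (f : nat -> nat -> K) : matching (coef P) (coef Q) f ->
  (forall i j, f i j != 0 -> nf_pair (part P i) (part Q j)) ->
  matching (open_wt P) (open_wt Q) (fun i j => f i.+1 j.+1).
Proof.
move=> mf h; have [f0 fp fq] := mf; have [_ z1 z2] := lift_nf_inv mf h.
have fE i j : (0 <= (f i j)%:E)%E by rewrite lee_fin.
split=> // [i|j].
  by have := fp i.+1; rewrite series_shift// z2 add0e.
by have := fq j.+1; rewrite series_shift// z1 add0e.
Qed.

Lemma sim_inv M N : sim M N -> exists f,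
  [/\ matching (coef (whnf M)) (coef (whnf N)) f,
      forall i j, f i j != 0 -> sim_nf (part (whnf M) i) (part (whnf N) j)
    & forall i j, f i j != 0 -> nf_pair (part (whnf M) i) (part (whnf N) j)].
Proof. by move=> [f [f0 fS fp fq]]; exists f; split=> // i j /fS /sim_nf_pair. Qed.

Lemma sim_abs_part M N : sim M N ->
  sim_nf (dfilter is_abs (whnf M)) (dfilter is_abs (whnf N)).
Proof.
move=> /sim_inv[f [mf fS fn]]; have [f1 _ _] := lift_nf_inv mf fn.
by apply: (fS 0%N 0%N); rewrite f1 oner_neq0.
Qed.

Definition openmass M : \bar K := minf (open_test (fun=> 1%E)) [::] M.

Lemma sim_openmass M N : sim M N -> (openmass M <= openmass N)%E.
Proof.
move=> /sim_inv[f [mf _ fn]]; have [f0 fp fq] := open_matching mf fn.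
rewrite /openmass !minf_open_test//.
apply: (@le_trans _ _ (\sum_(0 <= i <oo) \sum_(0 <= j <oo) (f i.+1 j.+1)%:E)%E).
  by apply: lee_nneseries => i _ => [_|]; rewrite mule1 ?fp// lee_fin open_wt_ge0.
rewrite nneseries_swap; last by move=> i j; rewrite lee_fin.
apply: lee_nneseries => j _ => [_|]; last by rewrite mule1 fq.
by apply: nneseries_ge0 => i _ _; rewrite lee_fin.
Qed.

Definition inst (y : nat) (x : nat) : nat := if x is x'.+1 then x' else y.

(** The beta step after the transition is invisible to [minf], which leaves the bodies with [y] for
    the bound variable. *)
Lemma minf_apply phi y A : nonneg phi -> abs_dist A ->
  minf phi [::] (strong_max (Apply y) A) = minf phi [::] (dmap (rename (inst y)) (body A)).
Proof.
move=> H hA; have R0 s v : (0 <= rinf phi s v)%E by exact: rinf_ge0.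
rewrite /minf (strong_max_apply y hA)// -/(minf _ _ _) minf_dapps// expect_dmap expect_body; last first.
  by move=> v; exact: R0.
apply: expect_eq => i /hA; case: (elt A i) => // B _; rewrite rinf_beta//.
by rewrite (minf_cong H (erefl _) (subst0_vars y B)).
Qed.

Lemma sim_apply y A A' : abs_dist A -> abs_dist A' -> sim_nf A A' ->
  sim (dmap (rename (inst y)) (body A)) (dmap (rename (inst y)) (body A')).
Proof.
move=> hA hA' /sim_nf_fix [_ /(_ (Apply y))] h.
apply: (@sim_trans _ (strong_max (Apply y) A)); first by apply: sim_le => phi H; rewrite minf_apply.
apply: sim_trans h _; by apply: sim_le => phi H; rewrite minf_apply.
Qed.

(** The abstractions of a program have coefficient 1 in the lift, whatever their weight. [Converge]
    produces the identity with weight [total A], and a further [Apply 0] turns it into the variable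
    0 with this weight: an open application, whose weight the lift does compare. *)
Lemma sim_total A A' : abs_dist A -> abs_dist A' -> sim_nf A A' -> (total A <= total A')%E.
Proof.
move=> hA hA' /sim_nf_fix [_ /(_ Converge)] /sim_abs_part.
move=> /(sim_apply 0 (@abs_dist_filter K _) (@abs_dist_filter K _)) /sim_openmass.
pose phi : @test K := open_test (fun=> 1%E).
have H : nonneg phi by apply: nonneg_open_test => v; exact: lee01.
pose h v := rinf phi [::] (rename (inst 0) v).
have h0 v : (0 <= h v)%E by exact: rinf_ge0.
have hn v : h (nrm v) = h v by apply: rinf_cong => //; exact: rename_nrm.
have E N : abs_dist N ->
    openmass (dmap (rename (inst 0)) (body (dfilter is_abs (weak_max Converge N)))) = total N.
  move=> hN; rewrite /openmass /minf expect_dmap -/phi.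
  rewrite (_ : rinf phi [::] \o rename (inst 0) = h)// expect_body_abs//.
  transitivity (minf (abs_test 0%E h) [::] (strong_max Converge N)).
    rewrite minf_abs_test// mule0 add0e; apply: expect_eq => i _ /=; by rewrite hn.
  have HT : nonneg (abs_test 0%E h) by exact: nonneg_abs_test.
  rewrite /minf strong_max_converge//; last by move=> v; exact: rinf_ge0.
  rewrite -/(minf _ _ _) minf_dpoint// rinf_lam add0e expect_dpoint; last by move=> v; exact: h0.
  by rewrite /= /h /= rinf_var mule1.
by rewrite !E.
Qed.

Lemma total_idterm_abs : absmass (whnf (@idterm K)) = 1%E.
Proof.
have := @minf_abs_test K 1%E (fun=> 0%E) idterm lee01 (fun=> lexx 0%E).
rewrite mule1 [expect _ (body _)]expect0 adde0 => <-.
rewrite minf_dpoint; last by apply: nonneg_abs_test => //; exact: lee01.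
by rewrite rinf_lam [expect _ _]expect0 adde0.
Qed.

Lemma not_sim_idterm : ~ sim (@idterm K) dzero.
Proof.
move=> /sim_abs_part /(sim_total (@abs_dist_filter K _) (@abs_dist_filter K _)).
rewrite !total_abs total_idterm_abs.
have -> : absmass (whnf (@dzero K)) = 0%E.
  have := @minf_abs_test K 1%E (fun=> 0%E) dzero lee01 (fun=> lexx 0%E).
  by rewrite mule1 [expect _ (body _)]expect0 adde0 => <-; rewrite minf_dzero.
by rewrite leNgt lte01.
Qed.

(** The call at position 0 leads to the identity, which the empty program does not simulate. So the
    right term must have the same transition, which fixes its head and its number of arguments; the
    other calls compare the arguments. *)
Lemma sim_nf_open t t' x x' Ms Ms' : sim_nf (dpoint t) (dpoint t') ->
  open_app t = Some (x, Ms) -> open_app t' = Some (x', Ms') ->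
  [/\ x = x', size Ms = size Ms' & forall i, sim (nth dzero Ms i) (nth dzero Ms' i)].
Proof.
move=> /sim_nf_fix [_ h] e e'.
have {}h l : sim (odflt dzero (trans l t)) (odflt dzero (trans l t')).
  apply: (@sim_trans _ (strong_max l (dpoint t))).
    exact: sim_ext (ext_eq_sym (strong_max_point l t)).
  apply: sim_trans (h l) _; exact: sim_ext (strong_max_point l t').
have := h (Call x 0 (size Ms)); rewrite /= e e' !eqxx /= leq0n andbT.
case: ifP => [/andP[/eqP xx /eqP ss] _|_ /not_sim_idterm //]; subst x'; split=> // i.
have [lt|ge] := ltnP i (size Ms); last by rewrite !nth_default ?ss//; exact: sim_refl.
have := h (Call x i.+1 (size Ms)); rewrite /= e e' !eqxx ss eqxx /= lt /=.
by rewrite !(set_nth_default dzero idterm) ?ss.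
Qed.

End SimFacts.

(* There may be no variable that is fresh for two given programs, so open
   programs are compared under sequences of renamings which eventually identify
   no two variables.  "Eventually" refers to an ultrafilter, along which
   matchings have limits. *)
Section Renamings.
Context {K : realType}.
Variable U : set_system nat.
Hypothesis ultraU : UltraFilter U.
Hypothesis freeU : forall n, U [set m | (n <= m)%N].
Let properU : ProperFilter U := ultra_proper.
Implicit Types (t u : term K) (M N P Q A B : prog K) (s : seq (prog K)).

Definition separating (r : nat -> nat -> nat) : Prop :=
  forall x y, x != y -> U [set n | r n x != r n y].

Definition rsim M N : Prop := exists2 r, separating r &
  U [set n | sim (dmap (rename (r n)) M) (dmap (rename (r n)) N)].

Lemma sim_rsim M N : sim M N -> rsim M N.
Proof.
move=> h; exists (fun _ => id); first by move=> x y xy; apply: filterE.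
apply: filterE => n /=; have e (Q : prog K) : dmap (rename id) Q = Q.
  by rewrite -[RHS]dmap_id; apply: dmap_ext => i; exact: rename_id.
by rewrite !e.
Qed.

Definition rcons0 (z : nat) (r : nat -> nat) (x : nat) : nat := if x is x'.+1 then r x' else z.

(** Exceeds [r n x] for all [x <= n]. Only finitely many variables are avoided at each stage, but
    since [U] is free each one is avoided eventually. *)
Definition fresh (r : nat -> nat -> nat) n : nat := (\sum_(x < n.+1) r n x).+1.

Lemma separating_cons r : separating r -> separating (fun n => rcons0 (fresh r n) (r n)).
Proof.
move=> sr; have F x : U [set n | fresh r n != r n x].
  apply: (filterS _ (freeU x)) => n /= xn; apply/eqP => e.
  suff : (r n x < fresh r n)%N by rewrite e ltnn.
  by rewrite /fresh ltnS (bigD1 (Ordinal (xn : x < n.+1)%N))//= leq_addr.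
move=> [|x] [|y] xy; [by []|exact: (F y)| |exact: sr].
by apply: (filterS _ (F x)) => n /=; rewrite eq_sym.
Qed.

Lemma body_rename r A : body (dmap (rename r) A) = dmap (rename (upren r)) (body A).
Proof.
rewrite /body /dbind dmap_dsum; apply: dsum_ext => i /=.
by case: (elt A i).
Qed.

Lemma coef_rename r P : coef (dmap (rename r) P) = coef P.
Proof. by apply: funext => -[|i] //=; rewrite is_open_rename. Qed.

Lemma part_rename r P k : part (dmap (rename r) P) k = dmap (rename r) (part P k).
Proof. by case: k => [|k] //=; rewrite dfilter_rename// => t; exact: is_abs_rename. Qed.

Lemma abs_dist_rename r A : abs_dist A -> abs_dist (dmap (rename r) A).
Proof. by move=> hA i /hA /=; rewrite is_abs_rename. Qed.

(** Going under the binder uses a different transition [Apply (fresh r n)] for each [n]; renaming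
    followed by this instantiation is again a separating sequence. *)
Lemma rsim_body A A' r : separating r -> abs_dist A -> abs_dist A' ->
  U [set n | sim_nf (dmap (rename (r n)) A) (dmap (rename (r n)) A')] ->
  rsim (body A) (body A').
Proof.
move=> sr hA hA' h; exists (fun n => rcons0 (fresh r n) (r n)); first exact: separating_cons.
apply: (filterS _ h) => n /= /(sim_apply (fresh r n) (@abs_dist_rename _ _ hA) (@abs_dist_rename _ _ hA')).
have e N : dmap (rename (inst (fresh r n))) (body (dmap (rename (r n)) N)) =
    dmap (rename (rcons0 (fresh r n) (r n))) (body N).
  rewrite body_rename dmap_dmap; apply: dmap_ext => i /=; rewrite rename_comp.
  by congr rename; apply: funext => -[].
by rewrite !e.
Qed.

Definition opn t : nat * seq (prog K) := if open_app t is Some w then w else (0%N, [::]).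

Lemma opnP t : is_open t -> open_app t = Some (opn t).
Proof. by rewrite /is_open /opn; case: open_app. Qed.

Lemma expect_diag phi P : nonneg phi ->
  expect (lo phi) (diag_opens P) =
  (\sum_(0 <= i <oo) (open_wt P i)%:E *
     to phi (opn (elt P i)).1 (map cn (opn (elt P i)).2))%E.
Proof.
move=> H; have lo0 w : (0 <= lo phi w)%E by exact: lo_ge0.
rewrite expect_bind//; apply: eq_eseriesr => i _; rewrite /open_wt /is_open /opn.
case: open_app => [[x Ms]|] /=; first by rewrite expect_dpoint.
by rewrite expect_zerop mule0 mul0e.
Qed.

(** The matching, enumerated through pairs, is the coupling. Matched heads are equal, so the head
    taken from the left also fits the arguments from the right. *)
Lemma matched_opens P Q g : matching (open_wt P) (open_wt Q) g ->
  (forall i j, g i j != 0 -> (opn (elt P i)).1 = (opn (elt Q j)).1) ->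
  exists W : dist K (nat * (seq (prog K) * seq (prog K))),
  [/\ forall phi, nonneg phi -> expect (lo phi) W = expect (lo phi) (diag_opens P),
      forall phi, nonneg phi -> (expect (ro phi) W <= expect (lo phi) (diag_opens Q))%E
    & forall k, wt W k != 0 -> exists i j,
        g i j != 0 /\ (elt W k).2 = ((opn (elt P i)).2, (opn (elt Q j)).2)].
Proof.
move=> [g0 gp gq] hh.
pose w k := g (Cantor.of_nat k).1 (Cantor.of_nat k).2.
pose el k : nat * (seq (prog K) * seq (prog K)) :=
  ((opn (elt P (Cantor.of_nat k).1)).1,
   ((opn (elt P (Cantor.of_nat k).1)).2, (opn (elt Q (Cantor.of_nat k).2)).2)).
have gE i j : (0 <= (g i j)%:E)%E by rewrite lee_fin.
have w0 k : 0 <= w k by exact: g0.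
have w1 : (\sum_(0 <= k <oo) (w k)%:E <= 1)%E.
  rewrite (@esum_cantor K (fun i j => (g i j)%:E))//.
  apply: le_trans (prob_le1 (wt P)); apply: lee_nneseries => i _ => [_|].
    exact: nneseries_ge0.
  by rewrite gp lee_fin /open_wt; case: ifP => // _; exact: prob_ge0.
exists (Dist (Subprob w0 w1) el); split.
- move=> phi H; rewrite expect_diag// /expect /=.
  rewrite (@esum_cantor K (fun i j => (g i j)%:E *
    to phi (opn (elt P i)).1 (map cn (opn (elt P i)).2))%E); last first.
    by move=> i j; rewrite mule_ge0//; case: H => _ _; exact.
  apply: eq_eseriesr => i _; rewrite -gp muleC -nneseriesZ//.
    by apply: eq_eseriesr => j _; rewrite muleC.
  by case: H => _ _; exact.
- move=> phi H; rewrite expect_diag// /expect /=.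
  have t0 i j : (0 <= to phi (opn (elt P i)).1 (map cn (opn (elt Q j)).2))%E.
    by case: H => _ _; exact.
  rewrite (@esum_cantor K (fun i j => (g i j)%:E *
    to phi (opn (elt P i)).1 (map cn (opn (elt Q j)).2))%E); last first.
    by move=> i j; rewrite mule_ge0.
  rewrite nneseries_swap; last by move=> i j; rewrite mule_ge0.
  apply: lee_nneseries => j _ => [_|].
    by apply: nneseries_ge0 => i _ _; rewrite mule_ge0.
  have T0 : (0 <= to phi (opn (elt Q j)).1 (map cn (opn (elt Q j)).2))%E.
    by case: H => _ _; exact.
  apply: (@le_trans _ _ (to phi (opn (elt Q j)).1 (map cn (opn (elt Q j)).2) *
     \sum_(0 <= i <oo) (g i j)%:E)%E); last by rewrite muleC lee_wpmul2r.
  rewrite -nneseriesZ//; apply: lee_nneseries => i _ => [_|]; first by rewrite mule_ge0.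
  have [->|/hh ->] := eqVneq (g i j) 0; first by rewrite mul0e mule0.
  by rewrite muleC.
- by move=> k wk; exists (Cantor.of_nat k).1, (Cantor.of_nat k).2.
Qed.

(** By [whnf_rename] the matchings for all [n] have the same marginals, so a limit is one more such
    matching. Where it is nonzero, the parts are similar after renaming for all [n] in a set of [U],
    so the given sequence witnesses [rsim] for the arguments, and its extension by a fresh variable
    for the bodies. *)
Lemma rsim_progress M N : rsim M N -> progress rsim M N.
Proof.
move=> [r sr h]; set P := whnf M; set Q := whnf N.
have lifts n : exists f : nat -> nat -> K, sim (dmap (rename (r n)) M) (dmap (rename (r n)) N) ->
   matching (coef P) (coef Q) f /\ forall i j, f i j != 0 ->
     sim_nf (dmap (rename (r n)) (part P i)) (dmap (rename (r n)) (part Q j)).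
  have [s|ns] := pselect (sim (dmap (rename (r n)) M) (dmap (rename (r n)) N)); last first.
    by exists (fun _ _ => 0).
  have := s; rewrite /sim !whnf_rename => -[f [f0 fS fp fq]]; exists f => _.
  rewrite !coef_rename in fp fq; split; first by split.
  by move=> i j /fS; rewrite !part_rename.
have [f hf] := boolp.choice lifts.
have qfin : (\sum_(0 <= j <oo) (coef Q j)%:E < +oo)%E.
  rewrite series_shift; last by move=> j; rewrite lee_fin coef_ge0.
  rewrite lte_add_pinfty ?ltry//; apply: le_lt_trans (ltry 1).
  apply: le_trans (prob_le1 (wt Q)); apply: lee_nneseries => j _ => [_|].
    by rewrite lee_fin (coef_ge0 Q j.+1).
  by rewrite lee_fin /coef; case: ifP => // _; exact: (prob_ge0 (wt Q) j).
have [g mg gU] : exists2 g, matching (coef P) (coef Q) g &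
    forall i j, g i j != 0 -> U [set n | f n i j != 0].
  by apply: (matching_limit ultraU qfin); apply: (filterS _ h) => n /= /hf[].
have gS i j : g i j != 0 ->
    U [set n | sim_nf (dmap (rename (r n)) (part P i)) (dmap (rename (r n)) (part Q j))].
  move=> /gU gij; apply: (filterS _ (filterI h gij)) => n [/= /hf[_ fS] fij].
  exact: fS.
(* A single [n] suffices, since renaming reflects the shape of normal forms; nonzero coefficients
   ensure that the entries in question are open. *)
have gn i j : g i j != 0 -> nf_pair (part P i) (part Q j).
  move=> gij; have [n] := filter_ex (gS i j gij); rewrite /= -!part_rename => /sim_nf_pair.
  have op k N' : open_point (part (dmap (rename (r n)) N') k) -> coef N' k != 0 ->
      open_point (part N' k).
    case: k => [oi _|k _]; last first.
      by rewrite /=; case: ifP => [oi _|]; [exists (elt N' k)|rewrite eqxx].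
    by have := abs_not_open (@abs_dist_filter K _) oi.
  have ab k N' : abs_dist (part (dmap (rename (r n)) N') k) -> abs_dist (part N' k).
    by rewrite part_rename => a i0 wi; have := a i0 wi; rewrite /= is_abs_rename.
  have [g0 gp gq] := mg.
  have cP : coef P i != 0.
    apply: contraNneq gij => cz; rewrite eq_le g0 andbT -lee_fin -cz -gp.
    by apply: (@series_term_le K (fun j => (g i j)%:E)) => k; rewrite lee_fin.
  have cQ : coef Q j != 0.
    by apply: contraNneq gij => cz; rewrite eq_le g0 andbT -cz; exact: matching_le mg.
  by case=> [[a b]|[a b]]; [left|right]; split; [exact: ab|exact: ab|exact: op|exact: op].
have [g1 _ _] := lift_nf_inv mg gn.
have mo := open_matching mg gn; have [go0 gop goq] := mo.
have heads i j : g i.+1 j.+1 != 0 ->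
    [/\ (opn (elt P i)).1 = (opn (elt Q j)).1, size (opn (elt P i)).2 = size (opn (elt Q j)).2
      & forall k, rsim (nth dzero (opn (elt P i)).2 k) (nth dzero (opn (elt Q j)).2 k)].
  move=> gij; have oP : is_open (elt P i).
    have : open_wt P i != 0.
      apply: contraNneq gij => cz; rewrite eq_le go0 andbT -lee_fin -cz -gop.
      by apply: (@series_term_le K (fun j => (g i.+1 j.+1)%:E)) => k; rewrite lee_fin.
    by rewrite /open_wt; case: ifP; rewrite ?eqxx.
  have oQ : is_open (elt Q j).
    have : open_wt Q j != 0.
      apply: contraNneq gij => cz; rewrite eq_le go0 andbT -cz.
      exact: (@matching_le K _ _ _ i j mo).
    by rewrite /open_wt; case: ifP; rewrite ?eqxx.
  have hop : U [set n | [/\ r n (opn (elt P i)).1 = r n (opn (elt Q j)).1,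
     size (opn (elt P i)).2 = size (opn (elt Q j)).2 &
     forall k, sim (dmap (rename (r n)) (nth dzero (opn (elt P i)).2 k))
                   (dmap (rename (r n)) (nth dzero (opn (elt Q j)).2 k))]].
    apply: (filterS _ (gS _ _ gij)) => n /=.
    have eP := open_app_rename (r n) (elt P i); have eQ := open_app_rename (r n) (elt Q j).
    rewrite (opnP oP) /= in eP; rewrite (opnP oQ) /= in eQ.
    move=> /sim_nf_open/(_ eP eQ)[h1 h2 h3]; split=> //.
      by move: h2; rewrite !size_map.
    rewrite !size_map in h2 => k.
    have [lt|ge] := ltnP k (size (opn (elt P i)).2).
      by have := h3 k; rewrite !(nth_map dzero) -?h2.
    by rewrite !nth_default -?h2//; exact: sim_refl.
  have [n0 [_ es _]] := filter_ex hop; split=> //.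
    (* Distinct heads would be renamed apart on a set of [U], and this set meets the one on which
       the renamed heads coincide. *)
    apply/eqP; apply: contraT => /sr nx.
    by have [n [[e _ _] /=]] := filter_ex (filterI hop nx); rewrite e eqxx.
  by move=> k; exists r => //; apply: (filterS _ hop) => n [_ _ h3] /=; exact: h3.
have [W [Wl Wr Wk]] := matched_opens mo (fun i j gij => let: And3 e _ _ := heads i j gij in e).
have absS : U [set n | sim_nf (dmap (rename (r n)) (dfilter is_abs P))
                              (dmap (rename (r n)) (dfilter is_abs Q))].
  by apply: (gS 0%N 0%N); rewrite g1 oner_neq0.
have aPQ : (absmass P <= absmass Q)%E.
  have [n /= hn] := filter_ex absS; rewrite -!total_abs.
  by apply: (@sim_total K _ _ _ _ hn); apply: abs_dist_rename; exact: abs_dist_filter.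
have a0 (N' : prog K) : (0 <= absmass N')%E by apply: expect_ge0 => t; case: ifP.
have tb (N' : prog K) : (total (body (dfilter is_abs N')) <= absmass N')%E.
  by rewrite totalE expect_body_abs// -totalE total_body.
have avalE phi N' a : nonneg phi -> aval phi a (body (dfilter is_abs N')) = aval phi a (body N').
  by move=> H; rewrite /aval expect_body_abs// => u; exact: tbnrm_ge0.
exists (absmass P), (absmass Q), (absmass Q), (body (dfilter is_abs P)),
  (body (dfilter is_abs Q)), W; split; split=> //.
- apply: RBase; rewrite ?absmass_le1//.
  + by apply: (rsim_body sr _ _ absS); exact: abs_dist_filter.
  + exact: le_trans (tb P) aPQ.
- move=> k /Wk [i [j [gij ->]]] /=; have [_ es hs] := heads i j gij; split=> // l.
  by apply: RBase => //; exact: total_le1.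
- by move=> phi H; rewrite minf_lval// /lval avalE// Wl.
- move=> phi H; rewrite [leRHS]minf_lval// /lval /rval avalE// leeD2l//; exact: Wr.
Qed.

Lemma sim_crel M N : sim M N -> crel rsim 1%E M N.
Proof. by move=> h; apply: RBase; rewrite ?total_le1//; exact: sim_rsim. Qed.

Lemma rsim_crel_sim M N : crel rsim 1%E M N -> sim M N.
Proof. exact: (crel_sim rsim_progress). Qed.

Lemma sim_lam M N : sim M N -> sim (lam M) (lam N).
Proof.
move=> /sim_crel r; apply: rsim_crel_sim; have t1 (N' : prog K) : total (lam N') = 1%E :> \bar K.
  by rewrite totalE expect_dpoint.
have ab (N' : prog K) : abs_dist (lam N') by [].
apply: RAbs; rewrite ?t1//.
have e (N' : prog K) : ext_eq (body (lam N')) N'.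
  by move=> phi p0; rewrite expect_body// expect_dpoint// => -[] // *; exact: expect_ge0.
exact: crel_ext r (e M) (e N).
Qed.

(** By linearity in the function part, [app M N] evaluates like [M] on the stack of the single
    argument [N], to which [RApps] applies. *)
Lemma sim_app M M' N N' : sim M M' -> sim N N' -> sim (app M N) (app M' N').
Proof.
move=> /sim_crel r /sim_crel r'; apply: rsim_crel_sim.
have rr : crel rsim 1%E (dapps M [:: N]) (dapps M' [:: N']).
  by apply: RApps => // -[|i] //=; rewrite nth_nil; exact: crel_refl.
apply: (crel_conv rr) => //; try exact: total_le1.
- by move=> n Phi H _; rewrite mrun_dpoint// run_app mrun_dapps.
- by move=> phi H; rewrite [leRHS]minf_dpoint// rinf_app// minf_dapps.
- by move=> phi H; rewrite [leRHS]minf_dpoint// rinf_app// minf_dapps.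
Qed.

Lemma sim_dsum (p : subprob K) (M N : nat -> prog K) :
  (forall i, p i != 0 -> sim (M i) (N i)) -> sim (dsum p M) (dsum p N).
Proof.
move=> h; apply: rsim_crel_sim; apply: (@RSum _ _ 1%E p (fun=> 1%E) M N) => //;
  try exact: total_le1.
- by move=> i; exact: prob_ge0.
- by move=> i /h; exact: sim_crel.
- by rewrite /psum; under eq_eseriesr do rewrite mule1; exact: prob_le1.
- by move=> n Phi H _; rewrite /mrun expect_dsum// => u; exact: run_ge0.
- by move=> phi H; rewrite [leRHS]/minf expect_dsum// => u; exact: rinf_ge0.
- by move=> phi H; rewrite [leRHS]/minf expect_dsum// => u; exact: rinf_ge0.
Qed.

End Renamings.

Lemma free_ultrafilter : exists2 U : set_system nat, UltraFilter U &
  forall n, U [set m | (n <= m)%N].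
Proof.
have [U [uU sub]] := @ultraFilterLemma nat (\oo)%classic _.
by exists U => // n; apply: sub; exists n.
Qed.

Theorem mainTheorem3 (K : realType) :
  (forall M : prog K, sim M M) /\
  (forall M N P : prog K, sim M N -> sim N P -> sim M P) /\
  (forall M N : prog K, sim M N -> sim (lam M) (lam N)) /\
  (forall M M' N N' : prog K,
    sim M M' -> sim N N' -> sim (app M N) (app M' N')) /\
  (forall (p : subprob K) (M N : nat -> prog K),
    (forall i, p i != 0 -> sim (M i) (N i)) -> sim (dsum p M) (dsum p N)).
Proof.
have [U uU fU] := free_ultrafilter; do 4?split.
- exact: sim_refl.
- exact: sim_trans.
- exact: (sim_lam uU fU).
- exact: (sim_app uU fU).
- exact: (sim_dsum uU fU).
Qed.
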